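(* Let $(\mathbb{E},\langle\,,\rangle,\rho,[\,,])$ be a Courant algebroid over a manifold $M$ such that $\mathbb{E}=TM\oplus E$ for some vector bundle $\mathrm{pr}:E\to M$, and let $\nabla$ be a vector bundle connection on $E$. The pair $(\mathrm{pr},\rho_\nabla\circ\phi)$ is a Courant algebroid action of $(\mathbb{E},\langle\,,\rangle,\rho,[\,,])$ on the manifold $E$ if and only if the corresponding Courant algebroid lift $(TE,g_\nabla,\rho_\nabla,[\,,]_\nabla)$ is a Courant algebroid. If this is the case, the stabilizer of the action at an arbitrary point of $E$ is coisotropic.
   Context: Everything is smooth. A tuple $(\mathbb{E},\langle\,,\rangle,\rho,[\,,])$ over $M$ consists of a vector bundle $\mathbb{E}\to M$, a non-degenerate symmetric pairing $\langle\,,\rangle\in\Gamma(\mathrm{Sym}^2\mathbb{E}^* )$, a vector bundle morphism $\rho:\mathbb{E}\to TM$ over $\mathrm{id}_M$ (the anchor), and an $\mathbb{R}$-bilinear bracket on $\Gamma(\mathbb{E})$. Define $\rho^*:T^*M\to\mathbb{E}$ by $\langle\rho^*\alpha,b\rangle=\alpha(\rho(b))$. Properties (for $a,b,c\in\Gamma(\mathbb{E})$, $f\in C^\infty(M)$): (Ca1) $[a,b]+[b,a]=\rho^*d\langle a,b\rangle$; (Ca2) $\rho(a)\langle b,c\rangle=\langle[a,b],c\rangle+\langle b,[a,c]\rangle$; (Ca3) $[a,[b,c]]=[[a,b],c]+[b,[a,c]]$; (Ca4) $[a,fb]=(\rho(a)f)b+f[a,b]$; (Ca5) $[fa,b]=-(\rho(b)f)a+f[a,b]+\langle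 a,b\rangle\rho^*df$. A Courant algebroid is a tuple satisfying (Ca1)–(Ca3); it then also satisfies (Ca4) and (Ca5). Courant algebroid lift: let $\mathbb{E}=TM\oplus E$ with $\mathrm{pr}:E\to M$ a vector bundle, and $\nabla$ a connection on $E$. For $X\in\mathfrak{X}(M)$ let $X^{h}\in\mathfrak{X}(E)$ be its horizontal lift with respect to $\nabla$; for $\varphi\in\Gamma(E)$ let $\varphi^{v}\in\mathfrak{X}(E)$ be its vertical lift, $\varphi^v_q=\frac{d}{dt}|_{t=0}(q+t\varphi_{\mathrm{pr}(q)})$. Set $\phi:\Gamma(\mathbb{E})\to\mathfrak{X}(E)$, $\phi(X+\varphi)=X^h+\varphi^v$; its image locally generates $\mathfrak{X}(E)$. The lift is the tuple $(TE,g_\nabla,\rho_\nabla,[\,,]_\nabla)$ over the manifold $E$, where $g_\nabla$ is the unique pairing on $TE$ with $g_\nabla(\phi a,\phi b)=\mathrm{pr}^*\langle a,b\rangle$, $\rho_\nabla:TE\to TE$ is the unique vector bundle endomorphism with $\rho_\nabla(\phi a)=\phi(\rho(a))=\rho(a)^h$, and $[\,,]_\nabla$ is the unique bracket on $\mathfrak{X}(E)$ with $[\phi a,\phi b]_\nabla=\phi[a,b]$ such that $(TE,g_\nabla,\rho_\nabla,[\,,]_\nabla)$ satisfies (Ca4) and (Ca5). A Courant algebroid action of a Courant algebroid $(\mathbb{E},\langle\,,\rangle,\rho,[\,,])$ over $M$ on a manifold $M'$ is a pair $(\Phi,\varrho)$ of a smooth map $\Phi:M'\to M$ and an $\mathbb{R}$-linear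 map $\varrho:\Gamma(\mathbb{E})\to\mathfrak{X}(M')$ such that for all $a,b\in\Gamma(\mathbb{E})$, $f\in C^\infty(M)$, $q\in M'$: $\Phi_{*q}(\varrho(a)_q)=\rho(a)_{\Phi(q)}$, $\varrho(fa)=(\Phi^*f)\varrho(a)$, and $[\varrho(a),\varrho(b)]_{\mathrm{Lie}}=\varrho([a,b])$. The stabilizer at $q\in M'$ is the kernel of $\varrho_q:\mathbb{E}_{\Phi(q)}\to T_qM'$, $\varrho_q(a_{\Phi(q)}):=\varrho(a)_q$. A subspace $W\subseteq\mathbb{E}_m$ is coisotropic if $W^\perp\subseteq W$, with $\perp$ taken with respect to the pairing. *)

(* Defs.v *)
From HB Require Import structures.
From mathcomp Require Import all_boot all_order all_algebra.
From mathcomp Require Import all_classical all_reals all_analysis.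

Set Implicit Arguments.
Unset Strict Implicit.
Unset Printing Implicit Defensive.

Import Order.TTheory GRing.Theory Num.Theory.
Import numFieldNormedType.Exports.

Local Open Scope classical_set_scope.
Local Open Scope ring_scope.

Section SmoothManifolds.
Context {R : realType}.

(* [U] is meant to be open. *)
Fixpoint Ck (k : nat) (n : nat) (U : set 'rV[R]_n) (f : 'rV[R]_n -> R^o)
    {struct k} : Prop :=
  match k with
  | 0 => forall x, U x -> {for x, continuous f}
  | k'.+1 => (forall x, U x -> differentiable f x) /\
             (forall v, Ck k' U (fun x => 'D_v f x))
  end.

Definition smooth_on (n : nat) (U : set 'rV[R]_n) (f : 'rV[R]_n -> R^o) : Prop :=
  forall k, Ck k U f.

Record chart (T : topologicalType) (n : nat) := Chart {
  dom : set T;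
  coord : T -> 'rV[R]_n;
  param : 'rV[R]_n -> T;  (* inverse of [coord] on [coord @` dom] *)
  dom_open : open dom;
  img_open : open (coord @` dom);
  coordK : forall p, dom p -> param (coord p) = p;
  coord_continuous : forall p, dom p -> {for p, continuous coord};
  param_continuous : forall x, (coord @` dom) x -> {for x, continuous param}
}.

Definition smooth_transition (T : topologicalType) (n : nat) (c d : chart T n) :=
  forall i, smooth_on (coord c @` (dom c `&` dom d))
                      (fun x => coord d (param c x) 0 i).

Record manifold (n : nat) := Manifold {
  carrier :> topologicalType;
  carrier_hausdorff : hausdorff_space carrier;
  carrier_second_countable : @second_countable carrier;
  atlas : set (chart carrier n);
  atlas_cover : forall p, exists2 c, atlas c & dom c p;
  atlas_smooth : forall c d, atlas c -> atlas d -> smooth_transition c d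
}.

(* The charts of the maximal atlas. *)
Definition smooth_chart (n : nat) (M : manifold n) (c : chart M n) : Prop :=
  forall d, atlas d -> smooth_transition c d /\ smooth_transition d c.

Definition smooth_fun (n : nat) (M : manifold n) (f : M -> R) : Prop :=
  forall c, atlas c -> smooth_on (coord c @` dom c) (f \o param c).

Definition smooth_map (n n' : nat) (M : manifold n) (N : manifold n')
    (F : M -> N) : Prop :=
  continuous F /\
  forall (c : chart M n) (d : chart N n') (i : 'I_n'), atlas c -> atlas d ->
    smooth_on (coord c @` (dom c `&` F @^-1` dom d))
              (fun x => coord d (F (param c x)) 0 i).

Section Tangent.
Variables (n : nat) (M : manifold n).

(* The derivations of C^oo(M) at [p]; a derivation is only meaningful on smooth
   functions, and is extended by 0 to the others so that Leibniz equality of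
   tangent vectors is equality as derivations. *)
Definition is_derivation (p : M) (v : (M -> R) -> R^o) : Prop :=
  [/\ forall f, ~ smooth_fun f -> v f = 0,
      forall (a : R) f g, smooth_fun f -> smooth_fun g ->
        v (fun x => a * f x + g x) = a * v f + v g
    & forall f g, smooth_fun f -> smooth_fun g ->
        v (fun x => f x * g x) = v f * g p + f p * v g].

Definition derivation_at (p : M) : {pred ((M -> R) -> R^o)} :=
  fun v => `[< is_derivation p v >].

Lemma derivation_at_submod (p : M) : submod_closed (derivation_at p).
Proof.
split.
  apply/asboolP; split=> [//|a f g _ _|f g _ _].
    by change ((0 : R) = a * 0 + 0); rewrite mulr0 addr0.
  by change ((0 : R) = 0 * g p + f p * 0); rewrite mulr0 mul0r addr0.
move=> a u v /asboolP[u0 uD uM] /asboolP[v0 vD vM]; apply/asboolP; split.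
- move=> f nf; change (a * u f + v f = 0).
  by rewrite u0 // v0 // mulr0 addr0.
- move=> b f g sf sg.
  change (a * u (fun x => b * f x + g x) + v (fun x => b * f x + g x) =
          b * (a * u f + v f) + (a * u g + v g)).
  by rewrite uD // vD // !mulrDr (mulrCA a b) -!addrA; congr (_ + _);
     rewrite addrCA.
- move=> f g sf sg.
  change (a * u (fun x => f x * g x) + v (fun x => f x * g x) =
          (a * u f + v f) * g p + f p * (a * u g + v g)).
  rewrite uM // vM // !mulrDr mulrDl (mulrCA (f p) a) !mulrA -!addrA.
  by congr (_ + _); rewrite addrCA.
Qed.

HB.instance Definition _ (p : M) :=
  GRing.isSubmodClosed.Build R ((M -> R) -> R^o) (derivation_at p)
    (derivation_at_submod p).

Record tangent (p : M) := Tangent {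
  tangent_val :> (M -> R) -> R^o;
  tangent_valP : tangent_val \in derivation_at p
}.

HB.instance Definition _ (p : M) := [isSub for @tangent_val p].
HB.instance Definition _ (p : M) := [Choice of tangent p by <:].
HB.instance Definition _ (p : M) := [SubChoice_isSubLmodule of tangent p by <:].

(* The tangent vector acting on smooth functions as [D] (0 if there is none). *)
Definition tangent_of (p : M) (D : (M -> R) -> R) : tangent p :=
  xget 0 [set w : tangent p | forall f, smooth_fun f -> w f = D f].

Definition lie (X Y : forall p, tangent p) (p : M) : tangent p :=
  tangent_of p (fun f => X p (fun x => Y x f) - Y p (fun x => X x f)).

End Tangent.

Definition pushforward (n n' : nat) (M : manifold n) (N : manifold n')
    (F : M -> N) (p : M) (v : tangent p) : tangent (F p) :=
  tangent_of (F p) (fun f => v (f \o F)).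

(* The common interface of the vector bundles TM, E and TM (+) E used below:
   their fibers, and which set-theoretic sections are smooth. Local triviality
   is not part of it; it is required of E in [vbundle]. *)
Record vfamily (M : Type) := VFamily {
  fiber :> M -> lmodType R;
  smooth_sec : set (forall m, fiber m)
}.

Definition TM (n : nat) (M : manifold n) : vfamily M :=
  @VFamily M (fun m => tangent m : lmodType R)
    [set X | forall f : M -> R, smooth_fun f -> smooth_fun (fun m => X m f)].

Definition dsum (M : Type) (V W : vfamily M) : vfamily M :=
  @VFamily M (fun m => (V m * W m)%type : lmodType R)
    [set a | smooth_sec (fun m => (a m).1) /\ smooth_sec (fun m => (a m).2)].

Section Bundles.
Variables (n : nat) (M : manifold n).

(* Vector bundle of rank [r] with total space [total_space]; [pt m] identifies the
   vector space [vfib m] with [bproj @^-1` [set m]], and [vec] is its inverse.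
   In [local_triv], [tau] is the second component of a fiberwise linear
   bijection of [bproj @^-1` U] onto U x R^r; it is a diffeomorphism iff it turns
   the product charts of U x R^r into smooth charts of [total_space]. *)
Record vbundle (r : nat) := VBundle {
  vfib : M -> lmodType R;
  total_space : manifold (n + r);
  bproj : total_space -> M;
  pt : forall m, vfib m -> total_space;
  vec : forall q, vfib (bproj q);
  pt_inj : forall m, injective (@pt m);
  proj_pt : forall m (v : vfib m), bproj (pt v) = m;
  vecK : forall q, pt (vec q) = q;
  local_triv : forall m0, exists (U : set M) (tau : forall m, vfib m -> 'rV[R]_r),
    [/\ open U, U m0,
        forall m, U m -> bijective (tau m) /\
          forall (a : R) u v, tau m (a *: u + v) = a *: tau m u + tau m v
      & forall c : chart M n, atlas c -> exists c' : chart total_space (n + r),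
        [/\ smooth_chart c',
            dom c' = bproj @^-1` (U `&` dom c)
          & forall m (v : vfib m), U m -> dom c m ->
              coord c' (pt v) = row_mx (coord c m) (tau m v)]]
}.

Definition sections (r : nat) (E : vbundle r) : vfamily M :=
  @VFamily M (vfib E) [set s | smooth_map (fun m => pt (s m))].

Record connection (r : nat) (E : vbundle r) := Connection {
  nabla :> (forall m, TM M m) -> (forall m, sections E m) ->
           (forall m, sections E m);
  nabla_smooth : forall X s, smooth_sec X -> smooth_sec s ->
    smooth_sec (nabla X s);
  nabla_linl : forall (f : M -> R) X Y s, smooth_fun f ->
    smooth_sec X -> smooth_sec Y -> smooth_sec s ->
    forall m, nabla (fun x => f x *: X x + Y x) s m
              = f m *: nabla X s m + nabla Y s m;
  nabla_addr : forall X s t, smooth_sec X -> smooth_sec s -> smooth_sec t ->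
    forall m, nabla X (fun x => s x + t x) m = nabla X s m + nabla X t m;
  nabla_leibniz : forall (f : M -> R) X s, smooth_fun f ->
    smooth_sec X -> smooth_sec s ->
    forall m, nabla X (fun x => f x *: s x) m
              = (X m f : R) *: s m + f m *: nabla X s m
}.

Section Lifts.
Variables (r : nat) (E : vbundle r) (N : connection E).

Definition vlift (s : forall m, sections E m) (q : total_space E) : TM (total_space E) q :=
  tangent_of q (fun F =>
    derive1 (fun t : R => F (pt (vec q + t *: s (bproj q))) : R^o) 0).

(* The vector (T s)(X_m) - (nabla_X s)^v at q = s(m), for any smooth section s
   through q. *)
Definition hlift (X : forall m, TM M m) (q : total_space E) : TM (total_space E) q :=
  xget 0 [set w : tangent q | forall s : forall m, sections E m,
    smooth_sec s -> s (bproj q) = vec q ->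
    forall F : total_space E -> R, smooth_fun F ->
      w F = X (bproj q) (fun m => F (pt (s m)))
            - (vlift (N X s) q : tangent q) F].

Definition lift_sec (a : forall m, dsum (TM M) (sections E) m) (q : total_space E) :
    TM (total_space E) q :=
  hlift (fun m => (a m).1) q + vlift (fun m => (a m).2) q.

End Lifts.
End Bundles.

Section Courant.
Variables (n : nat) (M : manifold n) (V : vfamily M).

Record courant_tuple := CourantTuple {
  pairing : forall m, V m -> V m -> R;
  anchor : forall m, V m -> TM M m;
  bracket : (forall m, V m) -> (forall m, V m) -> (forall m, V m);
  pairing_sym : forall m (u v : V m), pairing u v = pairing v u;
  pairing_lin : forall m (a : R) (u v w : V m),
    pairing (a *: u + v) w = a * pairing u w + pairing v w;
  pairing_nondeg : forall m (u : V m), (forall v, pairing u v = 0) -> u = 0;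
  pairing_smooth : forall a b, smooth_sec a -> smooth_sec b ->
    smooth_fun (fun m => pairing (a m) (b m));
  anchor_lin : forall m (a : R) (u v : V m),
    anchor (a *: u + v) = a *: anchor u + anchor v;
  anchor_smooth : forall a, smooth_sec a -> smooth_sec (fun m => anchor (a m));
  bracket_smooth : forall a b, smooth_sec a -> smooth_sec b ->
    smooth_sec (bracket a b);
  bracket_linl : forall (k : R) a b c,
    smooth_sec a -> smooth_sec b -> smooth_sec c ->
    forall m, bracket (fun x => k *: a x + b x) c m
              = k *: bracket a c m + bracket b c m;
  bracket_linr : forall (k : R) a b c,
    smooth_sec a -> smooth_sec b -> smooth_sec c ->
    forall m, bracket c (fun x => k *: a x + b x) m
              = k *: bracket c a m + bracket c b m
}.

Variable C : courant_tuple.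

Definition pair_sec (a b : forall m, V m) (m : M) : R := pairing C (a m) (b m).

Definition anchor_adj (m : M) (alpha : tangent m -> R) : V m :=
  xget 0 [set e : V m | forall b, pairing C e b = alpha (anchor C b)].

Definition dual_d (f : M -> R) (m : M) : V m :=
  anchor_adj (fun v : tangent m => v f).

Definition Ca1 : Prop := forall a b, smooth_sec a -> smooth_sec b ->
  forall m, bracket C a b m + bracket C b a m = dual_d (pair_sec a b) m.

Definition Ca2 : Prop := forall a b c,
  smooth_sec a -> smooth_sec b -> smooth_sec c ->
  forall m, (anchor C (a m) : tangent m) (pair_sec b c)
            = pair_sec (bracket C a b) c m + pair_sec b (bracket C a c) m.

Definition Ca3 : Prop := forall a b c,
  smooth_sec a -> smooth_sec b -> smooth_sec c ->
  forall m, bracket C a (bracket C b c) m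
            = bracket C (bracket C a b) c m + bracket C b (bracket C a c) m.

Definition Ca4 : Prop := forall a b (f : M -> R),
  smooth_sec a -> smooth_sec b -> smooth_fun f ->
  forall m, bracket C a (fun x => f x *: b x) m
            = ((anchor C (a m) : tangent m) f : R) *: b m + f m *: bracket C a b m.

Definition Ca5 : Prop := forall a b (f : M -> R),
  smooth_sec a -> smooth_sec b -> smooth_fun f ->
  forall m, bracket C (fun x => f x *: a x) b m
            = - (((anchor C (b m) : tangent m) f : R) *: a m)
              + f m *: bracket C a b m + pair_sec a b m *: dual_d f m.

Definition courant_algebroid : Prop := [/\ Ca1, Ca2 & Ca3].

Definition coisotropic (m : M) (W : set (V m)) : Prop :=
  [/\ W 0, forall (a : R) u v, W u -> W v -> W (a *: u + v)
    & [set u | forall w, W w -> pairing C u w = 0] `<=` W].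

Section Action.
Variables (n' : nat) (M' : manifold n') (Phi : M' -> M).
Variable rep : (forall m, V m) -> (forall q, TM M' q).

Record courant_action : Prop := CourantAction {
  act_base_smooth : smooth_map Phi;
  act_smooth : forall a, smooth_sec a -> smooth_sec (rep a);
  act_linear : forall (k : R) a b, smooth_sec a -> smooth_sec b ->
    forall q, rep (fun x => k *: a x + b x) q = k *: rep a q + rep b q;
  act_anchor : forall a, smooth_sec a ->
    forall q, pushforward Phi (rep a q) = anchor C (a (Phi q));
  act_fun_linear : forall (f : M -> R) a, smooth_fun f -> smooth_sec a ->
    forall q, rep (fun x => f x *: a x) q = f (Phi q) *: rep a q;
  act_bracket : forall a b, smooth_sec a -> smooth_sec b ->
    forall q, lie (rep a) (rep b) q = rep (bracket C a b) q
}.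

(* [rep] as a map on fibers, computed with any smooth section through [e]. *)
Definition act_at (q : M') (e : V (Phi q)) : TM M' q :=
  xget 0 [set rep a q | a in [set a | smooth_sec a /\ a (Phi q) = e]].

Definition stabilizer (q : M') : set (V (Phi q)) := [set e | act_at e = 0].

End Action.
End Courant.

Section CourantLift.
Variables (n r : nat) (M : manifold n) (E : vbundle M r) (N : connection E).
Variable C : courant_tuple (dsum (TM M) (sections E)).

Record is_courant_lift (L : courant_tuple (TM (total_space E))) : Prop :=
  IsCourantLift {
    lift_pairing : forall a b, smooth_sec a -> smooth_sec b ->
      forall q, pairing L (lift_sec N a q) (lift_sec N b q) = pair_sec C a b (bproj q);
    lift_anchor : forall a, smooth_sec a ->
      forall q, anchor L (lift_sec N a q) = hlift N (fun m => anchor C (a m)) q;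
    lift_bracket : forall a b, smooth_sec a -> smooth_sec b ->
      forall q, bracket L (lift_sec N a) (lift_sec N b) q = lift_sec N (bracket C a b) q;
    lift_Ca4 : Ca4 L;
    lift_Ca5 : Ca5 L
  }.

Definition lift_rep (L : courant_tuple (TM (total_space E)))
    (a : forall m, dsum (TM M) (sections E) m) (q : total_space E) : TM (total_space E) q :=
  anchor L (lift_sec N a q).

End CourantLift.
End SmoothManifolds.

Arguments bproj {R n M r} E q : rename.
Arguments stabilizer {R n M V n' M'} Phi rep q.

(* Main.v *)
From HB Require Import structures.
From Pilot Require Import Defs.
From mathcomp Require Import all_boot all_order all_algebra.
From mathcomp Require Import all_classical all_reals all_analysis.
From mathcomp Require Import ring lra.
Import Pilot.Defs.

Set Implicit Arguments.
Unset Strict Implicit.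
Unset Printing Implicit Defensive.

Import Order.TTheory GRing.Theory Num.Theory.
Import numFieldNormedType.Exports.

Local Open Scope classical_set_scope.
Local Open Scope ring_scope.

(** Write phi a for the lift of a section a of TM + E, rho for the anchor of C and pr for
    the projection of E.  The lifted anchor maps phi a to the horizontal lift rho(a)^h.

    Since rho(a)^h projects to rho(a) and is linear over functions of the base, all the
    conditions for an action hold except for the compatibility with brackets
    ([courant_action_lift]): the action exists if and only if
      (B)  [rho(a)^h, rho(b)^h] = rho([a, b])^h   for all a, b.
    As phi is a morphism of brackets, (B) says that the lifted anchor preserves brackets on
    lifts.

    If the lift is a Courant algebroid, its anchor preserves all brackets: expanding the
    Jacobi identity on u, v, f w with (Ca4) leaves the term
    ([rho u, rho v] - rho [u, v])(f) w ([Ca3_anchor_bracket]).  This gives (B).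

    Conversely, lifts generate the vector fields on E locally over the smooth functions
    ([lift_sec_generate]), so an identity between function-linear expressions follows from
    its validity on lifts, where it is inherited from C ([lift_tensor_eq0]).  By (Ca4) and
    (Ca5) the defects of (Ca1) and (Ca2) are function-linear.  So is the defect of the
    preservation of brackets by the anchor, because the lifted anchor kills the differentials
    of all functions on E ([anchor_dual_d_lift]): dual_d F only involves the horizontal
    derivatives of F, and rho o rho^* = 0 on the base.  So (B) extends from lifts to all
    fields.  The jacobiator is then function-linear in its last argument
    ([jacobiator_linr]) and skew-symmetric ([jacobiator_skew12], [jacobiator_skew23]),
    hence function-linear in all arguments, and it vanishes on lifts.

    The stabilizer at q is the kernel of rho at pr q.  It contains dual_d f for every f, so a
    vector u orthogonal to it satisfies rho(u) f = <dual_d f, u> = 0 for every f, that is,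
    rho(u) = 0.

    Tangent vectors are derivations of the algebra of smooth functions, and the horizontal
    lift is only characterized by the sections through a point.  The generation statement
    therefore rests on Hadamard's lemma ([hadamard]), by which a derivation is determined by
    its values on coordinates ([tangent_coordE]), on bump functions ([cutoff]), and on
    coordinates of E made of functions of the base and of fibrewise linear functions
    ([bundle_frame]), in which both lifts are computed ([vlift_fiber_linear], [hlift_xi]). *)

(** * Calculus of C^k functions on R^n *)

Lemma open_near (T : topologicalType) (U : set T) (x : T) (P : T -> Prop) :
  open U -> U x -> (forall y, U y -> P y) -> \forall y \near x, P y.
Proof. by move=> oU Ux UP; apply: filterS UP _; exact: open_nbhs_nbhs. Qed.

Section Differentiability.
Context {R : realType}.
Variables (V W : normedModType R).

Lemma differentiable_epsP (f : V -> W) (x : V) :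
  differentiable f x -> forall e, 0 < e ->
  \forall h \near (0 : V), `|f (h + x) - f x - 'd f x h| <= e * `|h|.
Proof.
move=> /diff_locally /eqaddoP df e e0.
have := df e e0; apply: filterS => h /=.
by rewrite /= opprD addrA.
Qed.

(** Recovers the derivative from an explicit first-order estimate; it serves where the
    derivative is an integral and no calculus rule applies. *)
Lemma differentiable_eps (f : V -> W) (x : V) (L : {linear V -> W}) :
  continuous L ->
  (forall e, 0 < e ->
    \forall h \near (0 : V), `|f (h + x) - f x - L h| <= e * `|h|) ->
  differentiable f x /\ 'd f x = L :> (V -> W).
Proof.
move=> cL fL.
have fo : f \o shift x = cst (f x) + L +o_ (0 : V) id.
  apply/eqaddoP => e e0; have := fL e e0; apply: filterS => h /=.
  by rewrite opprD addrA.
have dE := diff_unique cL fo.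
split=> //; apply/diff_locallyP; split; first by rewrite dE.
by rewrite dE.
Qed.

Lemma near_differentiable (f g : V -> W) (x : V) :
  {near x, f =1 g} -> differentiable f x -> differentiable g x.
Proof.
move=> fg df.
have gL e : 0 < e ->
    \forall h \near (0 : V), `|g (h + x) - g x - 'd f x h| <= e * `|h|.
  move=> e0; rewrite -(nbhs_singleton fg).
  have fg' : \forall h \near (0 : V), f (h + x) = g (h + x).
    by move: fg; rewrite (near_shift 0 x); apply: filterS => h /=; rewrite subr0.
  have := differentiable_epsP df e0.
  by apply: filterS2 fg' => h /= ->.
have dc : continuous ('d f x) by exact: diff_continuous.
by case: (differentiable_eps dc gL).
Qed.

End Differentiability.

Section CkCalculus.
Context {R : realType}.
Implicit Types (k n m : nat).

Lemma Ck_sub k n (U V : set 'rV[R]_n) f : V `<=` U -> Ck k U f -> Ck k V f.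
Proof.
move=> VU; elim: k f => [|k IH] f /=; first by move=> h x /VU /h.
by move=> [h1 h2]; split=> [x /VU /h1//|v]; exact: IH.
Qed.

(** [Ck k U f] only constrains the germs of f at the points of U, so every smoothness
    question below can be settled one point at a time, in a chart adapted to the point. *)
Lemma Ck_local k n (U : set 'rV[R]_n) f :
  (forall x, U x -> exists2 V : set 'rV[R]_n, V x & Ck k V f) -> Ck k U f.
Proof.
elim: k f => [|k IH] f h /=.
  by move=> x /h[V Vx]; apply.
split=> [x /h[V Vx [df _]]|v]; first exact: df.
by apply: IH => x /h[V Vx [_ hV]]; exists V => //; exact: hV.
Qed.

Lemma Ck_ext k n (U : set 'rV[R]_n) f g : open U ->
  (forall x, U x -> f x = g x) -> Ck k U f -> Ck k U g.
Proof.
move=> oU; elim: k f g => [|k IH] f g fg /=.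
  move=> h x Ux; have fgx : {near x, f =1 g}.
    exact: open_near oU Ux fg.
  rewrite /prop_for /continuous_at -(fg _ Ux).
  exact: (cvg_trans (near_eq_cvg fgx) (h x Ux)).
have fgx x : U x -> {near x, f =1 g}.
  by move=> Ux; exact: open_near oU Ux fg.
move=> [h1 h2]; split=> [x Ux|v].
  exact: near_differentiable (fgx x Ux) (h1 x Ux).
apply: (IH ('D_v f)) => // x Ux.
exact: near_eq_derive (fgx x Ux).
Qed.

Lemma Ck_pred k n (U : set 'rV[R]_n) f : Ck k.+1 U f -> Ck k U f.
Proof.
elim: k f => [|k IH] f /= [h1 h2].
  by move=> x /h1; exact: differentiable_continuous.
by split=> // v; apply: IH; exact: h2.
Qed.

Lemma Ck_cst k n (U : set 'rV[R]_n) (a : R) : Ck k U (fun=> a).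
Proof.
elim: k a => [|k IH] a /=; first by move=> x _; exact: cst_continuous.
split=> [x _|v]; first exact: differentiable_cst.
rewrite (_ : (fun x => 'D_v _ x) = fun=> 0); first exact: IH.
by apply/funext => x; rewrite derive_cst.
Qed.

Lemma CkD k n (U : set 'rV[R]_n) f g : open U ->
  Ck k U f -> Ck k U g -> Ck k U (fun x => f x + g x).
Proof.
move=> oU; elim: k f g => [|k IH] f g /=.
  by move=> h1 h2 x Ux; exact: (cvgD (h1 x Ux) (h2 x Ux)).
move=> [f1 f2] [g1 g2]; split=> [x Ux|v].
  exact: (differentiableD (f1 x Ux) (g1 x Ux)).
apply: (Ck_ext oU _ (IH _ _ (f2 v) (g2 v))) => x Ux.
by rewrite -deriveD //; apply: diff_derivable; [exact: f1|exact: g1].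
Qed.

Lemma CkM k n (U : set 'rV[R]_n) (f g : 'rV[R]_n -> R^o) : open U ->
  Ck k U f -> Ck k U g -> Ck k U (fun x => f x * g x).
Proof.
move=> oU; elim: k f g => [|k IH] f g.
  move=> /= h1 h2 x Ux; exact: (@cvgM R _ _ _ _ _ _ _ (h1 x Ux) (h2 x Ux)).
move=> hf hg; have [f1 f2] := hf; have [g1 g2] := hg; split=> [x Ux|v].
  exact: (@differentiableM R _ _ _ _ (f1 x Ux) (g1 x Ux)).
have h1 := IH _ _ (Ck_pred hf) (g2 v).
have h2 := IH _ _ (Ck_pred hg) (f2 v).
apply: (Ck_ext oU _ (CkD oU h1 h2)) => x Ux /=.
rewrite -[LHS](@deriveM R) //; apply: diff_derivable; [exact: f1|exact: g1].
Qed.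

Lemma Ck_sum k n (U : set 'rV[R]_n) (I : Type) (r : seq I) (P : pred I)
    (F : I -> 'rV[R]_n -> R^o) : open U ->
  (forall i, P i -> Ck k U (F i)) -> Ck k U (fun x => \sum_(i <- r | P i) F i x).
Proof.
move=> oU hF; elim: r => [|i r IH].
  apply: (Ck_ext oU _ (Ck_cst _ _ 0)) => x _; by rewrite big_nil.
have hi : Ck k U (fun x => if P i then F i x else 0).
  by case: (P i) (hF i) => [h|_]; [exact: h|exact: Ck_cst].
apply: (Ck_ext oU _ (CkD oU hi IH)) => x _.
by rewrite big_cons; case: (P i) => //; rewrite add0r.
Qed.

Lemma Ck_coord k n (U : set 'rV[R]_n) i : Ck k U (fun x => x 0 i).
Proof.
case: k => [|k] /=; first by move=> x _; exact: matrix_normedtype.coord_continuous.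
split=> [x _|v]; first exact: differentiable_coord.
rewrite (_ : (fun x => 'D_v _ x) = fun=> v 0 i); first exact: Ck_cst.
apply/funext => x; have := derive_mx (@derivable_id _ _ x v).
by rewrite derive_id => /rowP/(_ i); rewrite mxE => <-.
Qed.

Lemma rV_differentiable n m (G : 'rV[R]_n -> 'rV[R]_m) x :
  (forall i, differentiable (fun x => G x 0 i : R^o) x) -> differentiable G x.
Proof.
move=> h; rewrite (_ : G = \sum_i (fun x => G x 0 i *: 'e_i)).
  by apply: differentiable_sum => i; exact: (differentiableZl (k := fun x => G x 0 i)).
by apply/funext => y; rewrite fct_sumE -row_sum_delta.
Qed.

Lemma rV_continuous (T : topologicalType) m (G : T -> 'rV[R]_m) x :
  (forall i, {for x, continuous (fun x => G x 0 i : R^o)}) ->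
  {for x, continuous G}.
Proof.
move=> h; apply/cvgrPdist_le => /= e e0; near=> y.
rewrite [leLHS]/Num.Def.normr/= mx_normrE (bigmax_le _ (ltW e0))//= => -[i j] _.
rewrite !mxE (ord1 i); move: j; near: y; apply: filter_forall => /= j.
exact: ((cvgrPdist_le _ _).1 (h j)).
Unshelve. all: by end_near. Qed.

Lemma derive_comp_coord n m (F : 'rV[R]_m -> R^o) (G : 'rV[R]_n -> 'rV[R]_m) x v :
  (forall i, differentiable (fun x => G x 0 i : R^o) x) ->
  differentiable F (G x) ->
  'D_v (F \o G) x = \sum_i 'D_('e_i) F (G x) * 'D_v (fun x => G x 0 i : R^o) x.
Proof.
move=> hG hF; have dG := rV_differentiable hG.
have dFG : differentiable (F \o G) x by exact: differentiable_comp.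
rewrite (deriveE v dFG) (diff_comp dG hF) /=.
have vG i : 'd G x v 0 i = 'D_v (fun x => G x 0 i : R^o) x.
  rewrite -(deriveE v dG) derive_mx; last exact: (@diff_derivable _ _ _ _ _ _ dG).
  by rewrite mxE.
rewrite (row_sum_delta ('d G x v)) linear_sum; apply: eq_bigr => i _.
by rewrite linearZ vG mulrC (deriveE _ hF).
Qed.

(** By the chain rule the directional derivatives of F o G are sums of products of
    D_i F o G and derivatives of the components of G, all of class C^k by induction. *)
Lemma Ck_comp k n m (U : set 'rV[R]_n) (V : set 'rV[R]_m)
    (F : 'rV[R]_m -> R^o) (G : 'rV[R]_n -> 'rV[R]_m) : open U ->
  (forall x, U x -> V (G x)) -> Ck k V F ->
  (forall i, Ck k U (fun x => G x 0 i)) -> Ck k U (F \o G).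
Proof.
move=> oU UV; elim: k F => [|k IH] F.
  move=> hF hG x Ux; apply: continuous_comp; last exact/hF/UV.
  by apply: rV_continuous => i; exact: hG.
move=> [F1 F2] hG; split=> [x Ux|v].
  apply: differentiable_comp; last exact/F1/UV.
  by apply: rV_differentiable => i; have [dG _] := hG i; exact: dG.
have h : Ck k U (fun x => \sum_i 'D_('e_i) F (G x) * 'D_v (fun x => G x 0 i : R^o) x).
  apply: Ck_sum => // i _; apply: CkM => //; last by have [_ dG] := hG i; exact: dG.
  apply: (IH ('D_('e_i) F)); first exact: F2.
  by move=> j; apply: Ck_pred; exact: hG.
apply: (Ck_ext oU _ h) => x Ux; rewrite -derive_comp_coord //.
  by move=> i; have [dG _] := hG i; exact: dG.
exact/F1/UV.
Qed.

Lemma CkV k n (U : set 'rV[R]_n) (f : 'rV[R]_n -> R^o) : open U ->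
  (forall x, U x -> f x != 0) -> Ck k U f -> Ck k U (fun x => (f x)^-1).
Proof.
move=> oU fn0; elim: k => [|k IH].
  move=> hf x Ux; exact: (@cvgV R _ _ _ _ _ (fn0 x Ux) (hf x Ux)).
move=> hf; have [f1 f2] := hf; split=> [x Ux|v].
  by apply: (@differentiableV R); [exact: f1|exact: fn0].
have hV := IH (Ck_pred hf).
have h := CkM oU (CkM oU (Ck_cst k U (-1)) (CkM oU hV hV)) (f2 v).
apply: (Ck_ext oU _ h) => x Ux /=.
rewrite [RHS](@deriveV R) //; last 2 first.
  exact: fn0.
  by apply: diff_derivable; exact: f1.
by rewrite mulN1r -invfM -expr2.
Qed.

End CkCalculus.

(** * Smooth bump functions on R^n *)

Section Bump.
Context {R : realType}.

(** The functions p(1/x) exp(-1/x): this family is stable under differentiation, so that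
    smoothness of exp(-1/x) at 0 becomes an induction over the family. *)
Definition flat (p : {poly R}) (x : R) : R :=
  if 0 < x then p.[x^-1] * expR (- x^-1) else 0.

(** Induction on p, spending half of the exponential rate a on the linear factor X and
    the other half on the quotient. *)
Lemma poly_le_expR (p : {poly R}) (a : R) : 0 < a ->
  exists2 C, 0 <= C & forall y, 0 <= y -> `|p.[y]| <= C * expR (a * y).
Proof.
elim/poly_ind: p a => [|p c IH] a a0.
  by exists 0 => // y y0; rewrite horner0 normr0 mul0r.
have [C C0 hC] := IH (a / 2) (divr_gt0 a0 (ltr0Sn _ _)).
exists (C * (2 / a) + `|c|) => [|y y0].
  by rewrite addr_ge0 // mulr_ge0 // divr_ge0 // ltW.
rewrite hornerMXaddC (le_trans (ler_normD _ _)) // mulrDl lerD //; last first.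
  rewrite ler_peMr // (le_trans _ (expR_ge1Dx _)) // lerDl mulr_ge0 // ltW//.
rewrite normrM (ger0_norm y0).
have e1 : y <= (2 / a) * expR (a / 2 * y).
  have := expR_ge1Dx (a / 2 * y) => h.
  rewrite -(ler_pM2l (divr_gt0 a0 (ltr0Sn R 1))) mulrA.
  have -> : a / 2 * (2 / a) = 1 by field; lra.
  by rewrite mul1r; lra.
apply: le_trans (ler_pM _ y0 (hC y y0) e1) _; first exact: normr_ge0.
rewrite mulrACA -expRD -mulrDl.
by have -> : a / 2 + a / 2 = a by lra.
Qed.

(** The quadratic bound is what gives derivative 0 at the origin for every member of the
    family; it comes from the growth bound applied to p X^2 at 1/x. *)
Lemma flat_le_sqr (p : {poly R}) :
  exists2 C, 0 <= C & forall x, `|flat p x| <= C * x ^+ 2.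
Proof.
have [C C0 hC] := @poly_le_expR (p * 'X^2) 1 ltr01; exists C => // x.
rewrite /flat; case: ifP => [x0|_]; last by rewrite normr0 mulr_ge0 // sqr_ge0.
have := hC x^-1; rewrite invr_ge0 (ltW x0) => /(_ isT).
rewrite hornerM hornerXn mul1r (normrM p.[_]) => h; rewrite (normrM p.[_]).
rewrite expRN (ger0_norm (x := _^-1)); last by rewrite invr_ge0 expR_ge0.
rewrite ler_pdivrMr ?expR_gt0 //.
move: h; rewrite (ger0_norm (x := _ ^+ 2)) ?sqr_ge0 // exprVn.
by rewrite ler_pdivrMr ?exprn_gt0 // mulrAC.
Qed.

Lemma is_derive_flat (p : {poly R}) (x : R) :
  is_derive x (1 : R) (flat p) (flat ('X^2 * (p - p^`())) x).
Proof.
have [x0|x0|->] := ltgtP x 0.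
- apply: (@near_eq_is_derive _ _ _ (cst 0)).
    apply: (open_near (U := [set y : R | y < 0])) => //.
    move=> y /= y0.
    by rewrite /flat ltNge (ltW y0).
  by rewrite /flat ltNge (ltW x0) /=; exact: is_derive_cst.
- apply: (@near_eq_is_derive R R R (fun x : R => p.[x^-1] * expR (- x^-1) : R)).
    apply: (open_near (U := [set y : R | 0 < y])) => //.
    by move=> y /= y0; rewrite /flat y0.
  rewrite /flat x0.
  have xn0 : x != 0 by rewrite gt_eqF.
  have dV : is_derive x 1 (fun x : R => x^-1) (- x ^- 2).
    apply: DeriveDef; first exact: derivableV.
    by rewrite deriveV // derive_id /GRing.scale /= mulr1.
  have dN : is_derive x 1 (fun x : R => - x^-1) (x ^- 2).
    by apply: is_derive_eq; rewrite opprK.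
  have dp := is_derive1_comp (is_derive_poly p x^-1) dV.
  have de := @is_derive1_comp R expR (fun x => - x^-1) x _ _ (is_derive_expR (- x^-1)) dN.
  have -> : ('X^2 * (p - p^`())).[x^-1] * expR (- x^-1) =
    p.[x^-1] *: (expR (- x^-1) * x ^- 2) + expR (- x^-1) *: (p^`().[x^-1] * - x ^- 2).
    by rewrite hornerM hornerXn hornerD hornerN /GRing.scale /= exprVn; ring.
  exact: (is_deriveM dp de).
- rewrite {2}/flat ltxx.
  have [C C0 hC] := flat_le_sqr p.
  have f0 : flat p 0 = 0 by rewrite /flat ltxx.
  have dc : continuous (\0 : {linear R -> R}) by exact: cst_continuous.
  have [] := @differentiable_eps R R R (flat p) 0 (\0 : {linear R -> R}) dc.
    move=> e e0; near=> h; rewrite addr0 f0 !subr0.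
    rewrite (le_trans (hC h)) // -real_normK ?num_real // expr2 mulrA.
    rewrite ler_wpM2r //.
    have h1 : `|h| <= e / (C + 1).
      near: h; apply/nbhs_ballP; exists (e / (C + 1)); first by rewrite /= divr_gt0 // ltr_wpDl.
      by move=> h /=; rewrite /ball /= sub0r normrN => /ltW.
    rewrite ler_pdivlMr in h1; last by rewrite ltr_wpDl.
    by rewrite (le_trans _ h1) // mulrC ler_wpM2l // lerDl.
  move=> /derivable1_diffP df dE; apply: DeriveDef => //.
  by rewrite deriveE ?dE //; exact/derivable1_diffP.
Unshelve. all: by end_near. Qed.

Lemma Ck_flat k n (U : set 'rV[R]_n) (g : 'rV[R]_n -> R^o) p : open U ->
  Ck k U g -> Ck k U (fun x => flat p (g x)).
Proof.
move=> oU; elim: k p => [|k IH] p.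
  move=> hg x Ux; apply: (continuous_comp (hg x Ux)).
  apply/differentiable_continuous/derivable1_diffP.
  by case: (is_derive_flat p (g x)).
move=> hg; have [g1 g2] := hg; have hgk := Ck_pred hg.
have df y : differentiable (flat p) y.
  by apply/derivable1_diffP; case: (is_derive_flat p y).
split=> [x Ux|v].
  exact: (@differentiable_comp R _ R R _ _ _ (g1 x Ux) (df _)).
have h := CkM oU (IH ('X^2 * (p - p^`())) hgk) (g2 v).
apply: (Ck_ext oU _ h) => x Ux /=.
have dg := g1 x Ux.
have dfg : differentiable (flat p \o g) x := @differentiable_comp R _ R R _ _ _ dg (df _).
rewrite [RHS](deriveE v dfg) (@diff_comp R _ R R _ _ _ dg (df _)) /= -(deriveE v dg).
have -> : 'D_v g x = 'D_v g x *: (1 : R) by rewrite /GRing.scale /= mulr1.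
rewrite linearZ -(deriveE (1 : R) (df (g x))).
have -> : 'D_1 (flat p) (g x) = flat ('X^2 * (p - p^`())) (g x).
  by case: (is_derive_flat p (g x)).
by rewrite /GRing.scale /= mulr1 mulrC.
Qed.

Lemma flat1_gt0 x : 0 < x -> 0 < flat 1 x.
Proof. by move=> x0; rewrite /flat x0 hornerC mul1r expR_gt0. Qed.

Lemma flat_le0 p x : x <= 0 -> flat p x = 0.
Proof. by move=> x0; rewrite /flat ltNge x0. Qed.

Lemma flat1_ge0 x : 0 <= flat 1 x.
Proof. by have [/flat_le0->//|/flat1_gt0/ltW] := leP x 0. Qed.

(** Vanishes for t <= 0 and is 1 for t >= 1: one of the two summands of the denominator
    is 0 there. *)
Definition smooth_step (t : R) : R := flat 1 t / (flat 1 t + flat 1 (1 - t)).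

Lemma smooth_step_den t : flat 1 t + flat 1 (1 - t) != 0.
Proof.
apply: lt0r_neq0; have [t0|t0] := leP t 0.
  by rewrite ltr_wpDl ?flat1_ge0 // flat1_gt0 //; lra.
by rewrite ltr_pwDl ?flat1_ge0 // flat1_gt0.
Qed.

Lemma smooth_step_le0 t : t <= 0 -> smooth_step t = 0.
Proof. by move=> t0; rewrite /smooth_step flat_le0 // mul0r. Qed.

Lemma smooth_step_ge1 t : 1 <= t -> smooth_step t = 1.
Proof.
move=> t0; have := smooth_step_den t.
rewrite /smooth_step (flat_le0 _ (x := 1 - t)); last by lra.
by rewrite addr0 => h; rewrite divff.
Qed.

Lemma Ck_smooth_step k n (U : set 'rV[R]_n) (g : 'rV[R]_n -> R^o) : open U ->
  Ck k U g -> Ck k U (fun x => smooth_step (g x)).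
Proof.
move=> oU hg; have h1 := Ck_flat 1 oU hg.
have hN : Ck k U (fun x => 1 - g x).
  have := CkD oU (Ck_cst k U 1) (CkM oU (Ck_cst k U (-1)) hg).
  by apply: (Ck_ext oU) => x _; rewrite mulN1r.
have h2 := Ck_flat 1 oU hN.
apply: (CkM oU h1); apply: CkV => //; first by move=> x _; exact: smooth_step_den.
exact: CkD.
Qed.

Lemma rV_norm_coord n (x : 'rV[R]_n) i : `|x 0 i| <= `|x|.
Proof.
rewrite [leRHS]/Num.Def.normr/= mx_normrE.
exact: (le_bigmax _ _ (ord0, i)).
Qed.

(** The smooth step composed with the squared Euclidean distance.  The norm on row vectors
    is the supremum norm, which is bounded by the Euclidean one, hence the closed ball
    outside of which the bump vanishes. *)
Lemma rV_bump n (x0 : 'rV[R]_n) (e : R) : 0 < e ->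
  exists beta : 'rV[R]_n -> R^o,
  [/\ smooth_on setT beta, \forall x \near x0, beta x = 1,
      compact [set x : 'rV[R]_n | `|x - x0| <= e]
    & forall x, e < `|x - x0| -> beta x = 0].
Proof.
move=> e0.
(* With q the squared Euclidean distance to x0, the step is 1 where q <= d and 0
   where q >= 2 d = e^2. *)
set d := e ^+ 2 / 2.
have d0 : 0 < d by rewrite divr_gt0 // exprn_gt0.
pose q (x : 'rV[R]_n) : R := \sum_i (x 0 i - x0 0 i) * (x 0 i - x0 0 i).
have hq k : Ck k setT q.
  have hB i : Ck k setT (fun x : 'rV[R]_n => x 0 i - x0 0 i).
    exact: (CkD openT (Ck_coord _ _ i) (Ck_cst _ _ (- x0 0 i))).
  by apply: Ck_sum => [|i _]; [exact: openT|exact: (CkM openT (hB i) (hB i))].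
exists (fun x => smooth_step (2 - d^-1 * q x)); split.
- move=> k; apply: Ck_smooth_step; first exact: openT.
  have := CkD openT (Ck_cst k setT 2) (CkM openT (Ck_cst k setT (- d^-1)) (hq k)).
  by apply: (Ck_ext openT) => x _; rewrite mulNr.
- have cq : {for x0, continuous (q : _ -> R^o)}. exact: (hq 0).
  have q0 : q x0 = 0.
    by rewrite /q big1 // => i _; rewrite subrr mulr0.
  have := cq; rewrite /prop_for /continuous_at q0 => /cvgrPdist_le /(_ d d0).
  apply: filterS => x; rewrite sub0r normrN => qd.
  apply: smooth_step_ge1.
  have : d^-1 * q x <= 1.
    by rewrite mulrC ler_pdivrMr // mul1r (le_trans (ler_norm _)).
  by lra.
- have h := closed_ballE x0 e0.
  rewrite (_ : [set _ | _] = closed_ball x0 e); last first.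
    by rewrite h; apply/seteqP; split=> x; rewrite /closed_ball_ /= distrC.
  apply: bounded_closed_compact; last exact: closed_ball_closed.
  rewrite h; exists (`|x0| + e); split; first exact: num_real.
  move=> M hM x; rewrite /closed_ball_ /= => xe; rewrite ltW // (le_lt_trans _ hM) //.
  by rewrite -[x](subrK x0) addrC (le_trans (ler_normD _ _)) // lerD2l distrC.
- move=> x ex; apply: smooth_step_le0.
  have [i ei] : exists i, e < `|x 0 i - x0 0 i|.
    apply: contrapT => /forallNP h; move: ex; apply/negP; rewrite -leNgt.
    rewrite [leLHS]/Num.Def.normr/= mx_normrE (bigmax_le _ (ltW e0))//= => -[i j] _.
    by rewrite !mxE (ord1 i) leNgt; exact/negP/h.
  have : e ^+ 2 <= q x.
    rewrite /q (bigD1 i) //= -expr2 -[leLHS]addr0 lerD //.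
      by rewrite -[leRHS]real_normK ?num_real // lerXn2r ?nnegrE ?normr_ge0 ?(ltW e0) ?(ltW ei).
    by apply: sumr_ge0 => j _; rewrite -expr2 sqr_ge0.
  have -> : e ^+ 2 = 2 * d by rewrite /d; field.
  move=> h; have : 2 <= d^-1 * q x by rewrite mulrC ler_pdivlMr.
  by lra.
Qed.

End Bump.

(** * Smooth functions on a manifold *)

Section Charts.
Context {R : realType}.
Variables (T : topologicalType) (n : nat) (c : chart (R := R) T n).

Lemma near_dom p : dom c p -> \forall q \near p, dom c q.
Proof. by move=> cp; apply: (open_near (@dom_open _ _ _ c) cp). Qed.

Lemma near_coord p (P : 'rV[R]_n -> Prop) : dom c p ->
  (\forall x \near coord c p, P x) -> \forall q \near p, P (coord c q).
Proof. by move=> cp; exact: (coord_continuous cp). Qed.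

Lemma near_param p (P : T -> Prop) : dom c p ->
  (\forall q \near p, P q) -> \forall x \near coord c p, P (param c x).
Proof.
move=> cp; rewrite -{1}(coordK cp).
by apply: (param_continuous (c := c)); exists p.
Qed.

(** Near coord c p every point is the image of some q in the domain, and q = param c x lies
    in W by continuity of param. *)
Lemma chart_image_open (W : set T) : open W -> open (coord c @` (dom c `&` W)).
Proof.
move=> oW; rewrite openE => _ [p [cp Wp] <-].
have h1 : nbhs (coord c p) (coord c @` dom c).
  by apply: open_nbhs_nbhs; split; [exact: img_open|exists p].
have h2 : \forall x \near coord c p, W (param c x).
  by apply: near_param => //; exact: (open_near oW Wp).
rewrite /interior /=; near=> x.
have [q cq qx] : (coord c @` dom c) x by near: x.
exists q => //; split=> //; rewrite -(coordK cq) qx; near: x.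
exact: h2.
Unshelve. all: by end_near. Qed.

Lemma chart_preimage_open (V : set 'rV[R]_n) :
  open V -> open (dom c `&` coord c @^-1` V).
Proof.
move=> oV; rewrite openE => p [cp Vp].
have h := near_coord cp (open_near oV Vp (fun y h => h)).
by apply: filterI h; exact: near_dom.
Qed.

End Charts.

Section SmoothFunctions.
Context {R : realType}.
Variables (n : nat) (M : manifold (R := R) n).
Implicit Types (p q : M) (f g : M -> R) (c d : chart (R := R) M n).

Lemma atlas_smooth_chart c : atlas c -> smooth_chart c.
Proof. by move=> hc d hd; split; exact: atlas_smooth. Qed.

Lemma chart_near p : exists2 c, smooth_chart c & dom c p.
Proof.
by have [c hc cp] := atlas_cover p; exists c => //; exact: atlas_smooth_chart.
Qed.

Lemma smooth_fun_chart c f : smooth_chart c -> smooth_fun f ->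
  smooth_on (coord c @` dom c) (f \o param c).
Proof.
move=> hc sf k; apply: Ck_local => _ [p cp <-].
have [d hd dp] := atlas_cover p.
pose V := coord c @` (dom c `&` dom d); exists V; first by exists p.
have oV : open V := chart_image_open (@dom_open _ _ _ d).
have VK x : V x -> [/\ dom c (param c x), dom d (param c x) & coord c (param c x) = x].
  by move=> [q [cq dq] <-]; rewrite coordK.
apply: (Ck_ext oV (f := (f \o param d) \o (coord d \o param c))).
  by move=> x /VK[cx dx _] /=; rewrite coordK.
apply: (Ck_comp (V := coord d @` dom d)) => //.
- by move=> x /VK[_ dx _]; exists (param c x).
- exact: sf.
- by move=> i; exact: (hc d hd).1.
Qed.

(** Smoothness at p tested in a single chart of the maximal atlas.  Functions
    that exist only near p are represented by arbitrary functions on M. *)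
Definition smooth_germ p f := exists c (V : set 'rV[R]_n),
  [/\ smooth_chart c, dom c p, open V, V (coord c p)
    & smooth_on V (f \o param c)].

(** Charts are smoothly compatible, so that any chart will do around each point. *)
Lemma smooth_germ_fun f : (forall p, smooth_germ p f) -> smooth_fun f.
Proof.
move=> h c hc k; apply: Ck_local => _ [p cp <-].
have [d [V [hd dp oV Vp sV]]] := h p.
pose W := dom d `&` coord d @^-1` V.
have oW : open W := @chart_preimage_open _ _ _ d _ oV.
pose U := coord c @` (dom c `&` W); exists U; first by exists p.
have oU : open U := chart_image_open oW.
apply: (Ck_ext oU (f := (f \o param d) \o (coord d \o param c))).
  by move=> _ [q [cq [dq Vq]] <-] /=; rewrite !coordK.
apply: (Ck_comp (V := V)) => //.
  by move=> _ [q [cq [dq Vq]] <-] /=; rewrite !coordK.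
move=> i; apply: Ck_sub ((hd c hc).2 i k).
by move=> _ [q [cq [dq Vq]] <-]; exists q.
Qed.

Lemma smooth_germ_eq p f g : smooth_fun g -> {near p, f =1 g} -> smooth_germ p f.
Proof.
move=> sg fg; have [c hc cp] := chart_near p.
exists c, (coord c @` (dom c `&` interior [set q | f q = g q])); split=> //.
- by apply: chart_image_open; exact: open_interior.
- by exists p.
- move=> k; apply: (Ck_ext _ (f := g \o param c)).
  + by apply: chart_image_open; exact: open_interior.
  + by move=> _ [q [cq /interior_subset fgq] <-] /=; rewrite coordK.
  + by apply: Ck_sub (smooth_fun_chart hc sg k) => _ [q [cq _] <-]; exists q.
Qed.

Lemma smooth_fun_cst (a : R) : smooth_fun (fun _ : M => a).
Proof. by move=> c hc k; exact: Ck_cst. Qed.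

Lemma smooth_funD f g : smooth_fun f -> smooth_fun g ->
  smooth_fun (fun q => f q + g q).
Proof. 
move=> sf sg c hc k; have h := CkD (@img_open _ _ _ c) (sf c hc k) (sg c hc k).
exact: (Ck_ext (@img_open _ _ _ c) _ h).
 Qed.

Lemma smooth_funM f g : smooth_fun f -> smooth_fun g ->
  smooth_fun (fun q => f q * g q).
Proof. 
move=> sf sg c hc k; have h := CkM (@img_open _ _ _ c) (sf c hc k) (sg c hc k).
exact: (Ck_ext (@img_open _ _ _ c) _ h).
 Qed.

Lemma smooth_funZ (a : R) f : smooth_fun f -> smooth_fun (fun q => a * f q).
Proof. by move=> sf; apply: smooth_funM => //; exact: smooth_fun_cst. Qed.

Lemma smooth_funN f : smooth_fun f -> smooth_fun (fun q => - f q).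
Proof.
move=> sf; rewrite (_ : (fun q => _) = fun q => (-1) * f q); first exact: smooth_funZ.
by apply/funext => q; rewrite mulN1r.
Qed.

Lemma smooth_funB f g : smooth_fun f -> smooth_fun g ->
  smooth_fun (fun q => f q - g q).
Proof. by move=> sf sg; apply: smooth_funD => //; exact: smooth_funN. Qed.

Lemma smooth_fun_sum (I : Type) (r : seq I) (P : pred I) (F : I -> M -> R) :
  (forall i, P i -> smooth_fun (F i)) ->
  smooth_fun (fun q => \sum_(i <- r | P i) F i q).
Proof.
move=> sF c hc k.
apply: (Ck_sum r (@img_open _ _ _ c) (F := fun i => F i \o param c)) => i Pi.
exact: sF.
Qed.

Lemma smooth_fun_continuous f : smooth_fun f -> continuous (f : M -> R^o).
Proof.
move=> sf p; have [c hc cp] := atlas_cover p.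
have h : {for coord c p, continuous (f \o param c : _ -> R^o)}.
  by apply: (sf c hc 0); exists p.
have h' := continuous_comp (coord_continuous cp) h.
have e : {near p, (f \o param c) \o coord c =1 f}.
  by apply: filterS (near_dom cp) => q cq /=; rewrite coordK.
rewrite /continuous_at -(nbhs_singleton e).
exact: (cvg_trans (near_eq_cvg e) h').
Qed.

(** Extension by zero.  A bump function supported in a compact ball of the chart
    pulls back to M; the image K of the ball is compact, hence closed since M is Hausdorff,
    and theta f vanishes on the open complement of K, which makes it smooth there. *)
Lemma cutoff c p (V : set 'rV[R]_n) :
  smooth_chart c -> dom c p -> open V -> V (coord c p) ->
  exists theta : M -> R,
  [/\ \forall q \near p, theta q = 1,
      exists2 K, closed K & K `<=` dom c `&` coord c @^-1` V /\
                            forall q, ~ K q -> theta q = 0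
    & forall f, smooth_on V (f \o param c) -> smooth_fun (fun q => theta q * f q)].
Proof.
move=> hc cp oV Vp.
pose O := V `&` (coord c @` dom c).
have oO : open O by apply: openI => //; exact: img_open.
have Op : O (coord c p) by split => //; exists p.
have : nbhs (coord c p) O by apply: open_nbhs_nbhs.
rewrite -nbhs_ballE => -[e /= e0 eO].
have e20 : 0 < e / 2 by rewrite divr_gt0.
have [beta [sb b1 cK b0]] := rV_bump (coord c p) e20.
pose B := [set x : 'rV[R]_n | `|x - coord c p| <= e / 2].
have BO : B `<=` O.
  move=> x xB; apply: eO; rewrite -ball_normE /= distrC.
  apply: (le_lt_trans xB); rewrite ltr_pdivrMr // ltr_pMr // ltr1n //.
pose K := param c @` B.
have clK : closed K.
  apply: compact_closed; first exact: carrier_hausdorff.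
  apply: continuous_compact => //.
  apply: continuous_in_subspaceT => x /set_mem /BO [_ Ix].
  exact: param_continuous.
have KB q : K q -> dom c q /\ B (coord c q).
  by move=> [x xB <-]; have [_ [q' cq' e']] := BO _ xB; rewrite -e' coordK // e'.
pose theta q := if `[< dom c q >] then beta (coord c q) else 0.
have t0 q : ~ K q -> theta q = 0.
  move=> nK; rewrite /theta; case: asboolP => // cq; apply: b0.
  rewrite ltNge; apply/negP => h; apply: nK; exists (coord c q) => //.
  exact: coordK.
exists theta; split.
- near=> q; rewrite /theta; case: asboolP; last by move=> []; near: q; exact: near_dom.
  by move=> _; near: q; exact: (near_coord cp b1).
- exists K => //; split=> // q /KB[cq /BO[]]; by split.
- move=> f sf; apply: smooth_germ_fun => q.
  have [/KB[cq /BO Oq]|nK] := pselect (K q).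
    exists c, O; split=> // k.
    apply: (Ck_ext oO (f := fun x => beta x * (f \o param c) x)).
      move=> _ [_ [q' cq' <-]] /=; rewrite coordK // /theta.
      by case: asboolP.
    apply: CkM => //; first by apply: Ck_sub (sb k).
    by apply: Ck_sub (sf k) => x [].
  apply: (smooth_germ_eq (smooth_fun_cst 0)).
  apply: (open_near (U := ~` K)) => //; first by rewrite openC.
  by move=> q' /t0 ->; rewrite mul0r.
Unshelve. all: by end_near. Qed.

Lemma smooth_bump p (P : M -> Prop) : (\forall q \near p, P q) ->
  exists theta : M -> R,
  [/\ smooth_fun theta, \forall q \near p, theta q = 1 &
      exists2 K, closed K & (forall q, K q -> P q) /\
                            forall q, ~ K q -> theta q = 0].
Proof.
move=> hP; have [c hc cp] := chart_near p.
pose W := interior [set q | P q].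
pose V := coord c @` (dom c `&` W).
have oV : open V by apply: chart_image_open; exact: open_interior.
have [|theta [t1 [K cK [KV t0]] sm]] := cutoff hc cp oV; first by exists p.
exists theta; split => //.
  rewrite (_ : theta = fun q => theta q * 1); last by apply/funext => q; rewrite mulr1.
  by apply: (sm (fun=> 1)) => k; exact: Ck_cst.
exists K => //; split=> // q /KV[cq [q' [cq' /interior_subset Pq'] e]].
by rewrite -(coordK cq) -e coordK.
Qed.

(** Germs at p of global smooth functions.  Thanks to [cutoff] this agrees with
    smoothness in a chart, and it makes the algebra of germs immediate. *)
Definition smooth_near p f := exists g, smooth_fun g /\ {near p, f =1 g}.

Lemma smooth_nearP f : (forall p, smooth_near p f) -> smooth_fun f.
Proof.
by move=> h; apply: smooth_germ_fun => p; have [g [sg fg]] := h p; exact: smooth_germ_eq fg.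
Qed.

Lemma smooth_near_fun p f : smooth_fun f -> smooth_near p f.
Proof. by move=> sf; exists f; split=> //; near=> q. Unshelve. all: by end_near. Qed.

Lemma smooth_germ_near p f : smooth_germ p f -> smooth_near p f.
Proof.
move=> [c [V [hc cp oV Vp sV]]].
have [theta [t1 _ /(_ _ sV) sm]] := cutoff hc cp oV Vp.
by exists (fun q => theta q * f q); split=> //; apply: filterS t1 => q ->; rewrite mul1r.
Qed.

Lemma coord_near c p i : smooth_chart c -> dom c p ->
  smooth_near p (fun q => coord c q 0 i).
Proof.
move=> hc cp; apply: smooth_germ_near; exists c, (coord c @` dom c); split=> //.
- exact: img_open.
- move=> k; apply: (Ck_ext (@img_open _ _ _ c) (f := fun x => x 0 i)); last exact: Ck_coord.
  by move=> _ [q cq <-] /=; rewrite coordK.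
Qed.

End SmoothFunctions.

(** Smooth maps are detected by composition with smooth functions alone.  Bump functions
    around F p separate F p from the complement of a neighbourhood, which gives continuity,
    and cut-off coordinate functions give the components of F in charts. *)
Lemma smooth_mapP (R : realType) (n n' : nat) (M : manifold (R := R) n)
    (N : manifold n') (F : M -> N) :
  smooth_map F <-> forall f : N -> R, smooth_fun f -> smooth_fun (f \o F).
Proof.
split=> [[cF sF] f sf c hc k|h].
  apply: Ck_local => _ [p cp <-].
  have [d hd dp] := atlas_cover (F p).
  have oFd : open (F @^-1` dom d) by apply: open_comp => [x _|]; [exact: cF|exact: dom_open].
  pose V := coord c @` (dom c `&` F @^-1` dom d); exists V; first by exists p.
  have oV : open V := chart_image_open oFd.
  apply: (Ck_ext oV (f := (f \o param d) \o (coord d \o F \o param c))).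
    by move=> _ [q [cq dq] <-] /=; rewrite coordK // coordK.
  apply: (Ck_comp (V := coord d @` dom d)) => //.
  - by move=> _ [q [cq dq] <-] /=; rewrite coordK //; exists (F q).
  - exact: sf.
  - by move=> i; exact: sF.
have cF : continuous F.
  move=> p W WFp.
  have [theta [st t1 [K cK [KW t0]]]] := @smooth_bump _ _ _ (F p) W WFp.
  have := smooth_fun_continuous (h _ st) (x := p).
  have e1 : theta (F p) = 1 by exact: (nbhs_singleton t1).
  move/cvgrPdist_lt => /(_ 1 ltr01) /=; rewrite e1.
  apply: filterS => q; apply: contraPP => nW.
  by rewrite t0 ?subr0 ?normr1 ?ltxx // => /KW.
split=> // c d i hc hd k; apply: Ck_local => _ [p [cp dp] <-].
have [u [su ui]] := coord_near i (atlas_smooth_chart hd) dp.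
pose W := interior [set q | coord d (F q) 0 i = u (F q)].
pose V := coord c @` (dom c `&` W); exists V.
  by exists p => //; split=> //; exact: (cF p _ ui).
have oV : open V by apply: chart_image_open; exact: open_interior.
apply: (Ck_ext oV (f := (u \o F) \o param c)).
  by move=> _ [q [cq /interior_subset Wq] <-] /=; rewrite coordK.
by apply: Ck_sub (h _ su c hc k) => _ [q [cq _] <-]; exists q.
Qed.

(** * Hadamard's lemma *)

Section UnitIntegral.
Context {R : realType}.
Implicit Types f g : R -> R.

(** Continuity is asked on both sides of 0 and 1: the integrands below are defined on
    a neighbourhood of the segment. *)
Definition cont01 f := forall s : R, 0 <= s <= 1 -> {for s, continuous f}.

Definition int01 f : R := Rintegral lebesgue_measure `[0, 1] f.

Lemma cont01_within f : cont01 f -> {within `[(0 : R), 1], continuous f}.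
Proof.
move=> cf; apply: continuous_in_subspaceT => s /set_mem /=.
by rewrite in_itv /=; exact: cf.
Qed.

Lemma cont01_integrable f : cont01 f ->
  lebesgue_measure.-integrable `[0, 1] (EFin \o f).
Proof.
move=> cf; apply: continuous_compact_integrable; first exact: segment_compact.
exact: cont01_within.
Qed.

Lemma int01_cst (a : R) : int01 (fun=> a) = a.
Proof.
rewrite /int01 Rintegral_cst //.
have h : lebesgue_measure `[(0 : R), 1] = 1%E.
  by rewrite lebesgue_measure_itv /= lte_fin ltr01 oppr0 adde0.
by rewrite -[RHS]mulr1; congr (a * _); exact: (congr1 fine h).
Qed.

Lemma int01Z (a : R) f : cont01 f -> int01 (fun s => a * f s) = a * int01 f.
Proof. by move=> cf; apply: RintegralZl => //; exact: cont01_integrable. Qed.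

Lemma int01D f g : cont01 f -> cont01 g ->
  int01 (fun s => f s + g s) = int01 f + int01 g.
Proof. by move=> cf cg; apply: RintegralD => //; exact: cont01_integrable. Qed.

Lemma int01B f g : cont01 f -> cont01 g ->
  int01 (fun s => f s - g s) = int01 f - int01 g.
Proof. by move=> cf cg; apply: RintegralB => //; exact: cont01_integrable. Qed.

Lemma cont01_cst (a : R) : cont01 (fun=> a).
Proof. by move=> s _; exact: cst_continuous. Qed.

Lemma cont01D f g : cont01 f -> cont01 g -> cont01 (fun s => f s + g s).
Proof. by move=> cf cg s hs; exact: (cvgD (cf s hs) (cg s hs)). Qed.

Lemma cont01M f g : cont01 f -> cont01 g -> cont01 (fun s => f s * g s).
Proof. by move=> cf cg s hs; exact: (cvgM (cf s hs) (cg s hs)). Qed.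

Lemma cont01B f g : cont01 f -> cont01 g -> cont01 (fun s => f s - g s).
Proof. by move=> cf cg s hs; exact: (cvgB (cf s hs) (cg s hs)). Qed.

Lemma cont01_sum n (F : 'I_n -> R -> R) : (forall i, cont01 (F i)) ->
  cont01 (fun s => \sum_i F i s).
Proof.
move=> cF; rewrite (_ : (fun s => _) = \sum_i F i); last first.
  by apply/funext => s; rewrite fct_sumE.
elim/big_ind : _ => [|f g|i _]; [exact: cont01_cst|exact: cont01D|exact: cF].
Qed.

Lemma int01_bound f (C : R) : cont01 f ->
  (forall s : R, 0 <= s <= 1 -> `|f s| <= C) -> `|int01 f| <= C.
Proof.
move=> cf fC.
have h : lebesgue_measure.-integrable `[0, 1] (EFin \o (fun s => `|f s|)).
  by apply: cont01_integrable => s hs; apply: cvg_norm; exact: cf.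
apply: le_trans (le_normr_Rintegral _ (cont01_integrable cf)) _ => //.
rewrite -[leRHS]int01_cst; apply: le_Rintegral => //.
by apply: cont01_integrable; exact: cont01_cst.
Qed.

Lemma int01_FTC f (F : R -> R) : cont01 f ->
  (forall s : R, 0 <= s <= 1 -> is_derive s (1 : R) F (f s)) -> int01 f = F 1 - F 0.
Proof.
move=> cf dF; rewrite /int01 /Rintegral.
have cF s : 0 <= s <= 1 -> {for s, continuous F}.
  move=> /dF [d _]; exact/differentiable_continuous/derivable1_diffP.
rewrite (continuous_FTC2 (F := F) ltr01 (cont01_within cf)) //.
- split.
  + by move=> s; rewrite in_itv /= => /andP[s0 s1]; have [] := dF s; rewrite ?ltW.
  + by apply: cvg_at_right_filter; apply: cF; rewrite lexx ler01.
  + by apply: cvg_at_left_filter; apply: cF; rewrite lexx ler01.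
- move=> s; rewrite in_itv /= => /andP[s0 s1]; rewrite derive1E.
  by have [] := dF s; rewrite ?ltW.
Qed.

Lemma int01_sum n (F : 'I_n -> R -> R) : (forall i, cont01 (F i)) ->
  int01 (fun s => \sum_i F i s) = \sum_i int01 (F i).
Proof.
move=> cF; rewrite (_ : (fun s => _) = \sum_i F i); last first.
  by apply/funext => s; rewrite fct_sumE.
have [] : cont01 (\sum_i F i) /\ int01 (\sum_i F i) = \sum_i int01 (F i).
  elim/big_ind2 : _ => [|f a g b [cf <-] [cg <-]|i _]; last by split.
    by split; [exact: cont01_cst|exact: int01_cst].
  by split; [exact: cont01D|exact: int01D].
by [].
Qed.

End UnitIntegral.

Section Hadamard.
Context {R : realType}.
Variable n : nat.
Implicit Types (x y v w : 'rV[R]_n) (h f : 'rV[R]_n -> R^o).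

Lemma derive_coord h x v : differentiable h x ->
  'D_v h x = \sum_i v 0 i * 'D_('e_i) h x.
Proof.
move=> dh; rewrite (deriveE v dh) [in LHS](row_sum_delta v) linear_sum.
by apply: eq_bigr => i _; rewrite linearZ (deriveE _ dh).
Qed.

Lemma is_derive_line h y w (t : R) : differentiable h (y + t *: w) ->
  is_derive t (1 : R) (fun s : R => h (y + s *: w)) ('D_w h (y + t *: w)).
Proof.
move=> dh.
have E : (fun s : R => s^-1 *: (((fun s : R => h (y + s *: w)) \o shift t) (s *: (1 : R))
                                 - h (y + t *: w))) =
         (fun s : R => s^-1 *: ((h \o shift (y + t *: w)) (s *: w) - h (y + t *: w))).
  apply/funext => s /=; congr (_ *: (h _ - _)).
  have -> : s *: (1 : R) = s by exact: mulr1.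
  by rewrite scalerDl addrCA.
apply: DeriveDef; rewrite ?/derivable ?/derive E //.
exact: (@diff_derivable _ _ _ _ _ w dh).
Qed.

Lemma mean_value h y w (O : set 'rV[R]_n) :
  (forall x, O x -> differentiable h x) ->
  (forall t : R, 0 <= t <= 1 -> O (y + t *: w)) ->
  exists2 t : R, 0 <= t <= 1 & h (y + w) - h y = 'D_w h (y + t *: w).
Proof.
move=> dh hO.
have dl (t : R) : 0 <= t <= 1 ->
    is_derive t (1 : R) (fun s : R => h (y + s *: w)) ('D_w h (y + t *: w)).
  by move=> t01; apply: is_derive_line; apply: dh; exact: hO.
have [t||] := @MVT_segment R (fun s : R => h (y + s *: w))
                  (fun t => 'D_w h (y + t *: w)) 0 1 ler01.
- by rewrite in_itv /= => /andP[t0 t1]; apply: dl; rewrite !ltW.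
- apply: continuous_in_subspaceT => t /set_mem /=; rewrite in_itv /= => t01.
  by have [d _] := dl t t01; exact/differentiable_continuous/derivable1_diffP.
- move=> t; rewrite in_itv /= scale1r scale0r addr0 subr0 mulr1 => t01 e.
  by exists t.
Qed.

Definition lin_form (a : 'I_n -> R) (v : 'rV[R]_n) : R^o := \sum_i v 0 i * a i.

Lemma lin_form_is_linear a : linear (lin_form a).
Proof.
move=> k u v; rewrite /lin_form scaler_sumr -big_split; apply: eq_bigr => i _.
by rewrite !mxE mulrDl /GRing.scale /= mulrA.
Qed.

HB.instance Definition _ a :=
  GRing.isLinear.Build R 'rV[R]_n R^o _ (lin_form a) (lin_form_is_linear a).

Lemma lin_form_continuous a : continuous (lin_form a).
Proof.
move=> x; suff : Ck 0 setT (lin_form a) by move=> /(_ x I).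
apply: Ck_sum => [|i _]; first exact: openT.
exact: (CkM openT (Ck_coord _ _ _) (Ck_cst _ _ _)).
Qed.

Variables (O : set 'rV[R]_n) (x0 : 'rV[R]_n) (e : R).
Hypotheses (oO : open O) (e0 : 0 < e).
Hypothesis (BO : forall x, `|x - x0| <= e -> O x).

Let line x (s : R) := x0 + s *: (x - x0).

Lemma line_in x (s : R) : 0 <= s <= 1 -> `|x - x0| <= e -> `|line x s - x0| <= e.
Proof.
move=> /andP[s0 s1] xe; rewrite /line addrC addKr normrZ ger0_norm //.
by rewrite (le_trans _ xe) // ler_piMl.
Qed.

(** The first-order mean value theorem is applied twice: to h along w, and then to each
    partial derivative of h.  The second derivatives are continuous on the closed ball, which
    is compact, so that one constant serves all points; this uniformity is what allows
    differentiation under the integral sign below. *)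
Lemma taylor2 h : smooth_on O h -> exists2 C, 0 <= C & forall y w,
  (forall t : R, 0 <= t <= 1 -> `|y + t *: w - x0| <= e) ->
  `|h (y + w) - h y - \sum_i w 0 i * 'D_('e_i) h y| <= C * `|w| ^+ 2.
Proof.
move=> sh.
have dh x : O x -> differentiable h x by have [d _] := sh 1; exact: d.
have ddh i x : O x -> differentiable ('D_('e_i) h) x.
  by have [_ /(_ 'e_i) [d _]] := sh 2; exact: d.
(* D2 (i, j) is the second partial derivative in the directions j, then i *)
pose D2 (ij : 'I_n * 'I_n) : 'rV[R]_n -> R^o := 'D_('e_(ij.1)) ('D_('e_(ij.2)) h).
have cD2 ij x : O x -> {for x, continuous (D2 ij)}.
  by have [_ /(_ 'e_(ij.2)) [_ /(_ 'e_(ij.1)) c]] := sh 2; exact: c.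
have bD2 ij : exists C, 0 <= C /\ forall x, `|x - x0| <= e -> `|D2 ij x| <= C.
  have [_ [_ _ cB _]] := rV_bump x0 e0.
  have cw : {within [set x | `|x - x0| <= e], continuous (D2 ij)}.
    by apply: continuous_in_subspaceT => x /set_mem /= xe; exact/cD2/BO.
  have /compact_bounded [C [_ hC]] := continuous_compact cw cB.
  exists (`|C| + 1); split=> [|x xe]; first by rewrite addr_ge0.
  apply: (hC (`|C| + 1)); last by exists x.
  by rewrite (le_lt_trans (ler_norm C)) // ltrDl.
have [C hC] := choice bD2.
exists (\sum_j \sum_i C (i, j)).
  by apply: sumr_ge0 => j _; apply: sumr_ge0 => i _; have [] := hC (i, j).
move=> y w hB.
have hO (t : R) : 0 <= t <= 1 -> O (y + t *: w) by move=> /hB/BO.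
have [t t01 ->] := mean_value dh hO.
have Oy : O y by have := hO 0; rewrite scale0r addr0; apply; rewrite lexx ler01.
rewrite (derive_coord w (dh _ (hO t t01))) -sumrB mulr_suml.
apply: le_trans (ler_norm_sum _ _ _) _; apply: ler_sum => j _.
rewrite -mulrBr normrM.
have ht (s : R) : 0 <= s <= 1 -> 0 <= s * t <= 1.
  move: t01 => /andP[t0 t1] /andP[s0 s1]; rewrite mulr_ge0 //=.
  by rewrite mulr_ile1.
have hOt (s : R) : 0 <= s <= 1 -> O (y + s *: (t *: w)).
  by move=> s01; rewrite scalerA; apply: hO; exact: ht.
have [s s01 ->] := mean_value (ddh j) hOt.
rewrite (derive_coord _ (ddh j _ (hOt s s01))) mulr_suml expr2.
have h1 : `|\sum_i (t *: w) 0 i * 'D_('e_i) ('D_('e_j) h) (y + s *: (t *: w))| <=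
    \sum_i `|w| * C (i, j).
  apply: le_trans (ler_norm_sum _ _ _) _; apply: ler_sum => i _.
  rewrite normrM ler_pM //.
    rewrite mxE normrM (le_trans _ (rV_norm_coord w i)) // ler_piMl //.
    by move: t01 => /andP[t0 t1]; rewrite ger0_norm.
  have [_] := hC (i, j); apply; rewrite scalerA; apply: hB; exact: ht.
apply: le_trans (ler_pM _ _ (rV_norm_coord w j) h1) _ => //.
by rewrite mulr_sumr; apply: ler_sum => i _; rewrite mulrCA mulrA mulrC.
Qed.

(** The integral over s in [0, 1] of s^j h(x0 + s (x - x0)).  The weights s^j make the
    family stable under differentiation in x. *)
Definition ray_int (j : nat) h x : R^o := int01 (fun s => s ^+ j * h (line x s)).

Lemma cont01_line h j x : (forall x, O x -> {for x, continuous h}) ->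
  `|x - x0| <= e -> cont01 (fun s => s ^+ j * h (line x s)).
Proof.
move=> ch xe; apply: cont01M.
  by move=> s _; exact: exprn_continuous.
move=> s s01; apply: (@continuous_comp _ _ _ (line x) h); last first.
  by apply: ch; apply: BO; exact: line_in.
rewrite /line; apply: cvgD; first exact: cvg_cst.
by apply: cvgZr_tmp; exact: cvg_id.
Qed.

(** Differentiation under the integral sign: the remainder of the integrand is O(|v|^2)
    uniformly in s, by [taylor2]. *)
Lemma ray_int_diff j h x : smooth_on O h -> `|x - x0| < e ->
  differentiable (ray_int j h) x /\
  'd (ray_int j h) x = lin_form (fun i => ray_int j.+1 ('D_('e_i) h) x) :> (_ -> _).
Proof.
move=> sh xe.
have ch z : O z -> {for z, continuous h} by exact: (sh 0).
have cdh i z : O z -> {for z, continuous ('D_('e_i) h : _ -> R^o)}.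
  by have [_ c] := sh 1; exact: c.
apply: differentiable_eps; first exact: lin_form_continuous.
have [C C0 hC] := taylor2 sh.
move=> eps eps0; near=> v.
have xe' : `|x - x0| <= e by exact: ltW.
have ve : `|v| <= e - `|x - x0|.
  near: v; apply/nbhs_ballP; exists (e - `|x - x0|); first by rewrite /= subr_gt0.
  by move=> v /=; rewrite -ball_normE /= sub0r normrN => /ltW.
have vx : `|v + x - x0| <= e.
  by rewrite -addrA (le_trans (ler_normD _ _)) // -lerBrDr.
have vxE s : line (v + x) s = line x s + s *: v.
  have -> : line (v + x) s = x0 + s *: (v + (x - x0)) by rewrite /line addrA.
  by rewrite scalerDr [s *: v + _]addrC addrA.
have cl z : `|z - x0| <= e -> cont01 (fun s => s ^+ j * h (line z s)).
  by move=> ze; exact: (cont01_line ch ze).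
have cdl i : cont01 (fun s => s ^+ j.+1 * 'D_('e_i) h (line x s)).
  exact: (cont01_line (cdh i) xe').
have E : ray_int j h (v + x) - ray_int j h x - lin_form (fun i => ray_int j.+1 ('D_('e_i) h) x) v
   = int01 (fun s => s ^+ j * h (line (v + x) s) - s ^+ j * h (line x s)
                - \sum_i v 0 i * (s ^+ j.+1 * 'D_('e_i) h (line x s))).
  rewrite int01B; last 2 first.
  - by apply: cont01B; exact: cl.
  - apply: cont01_sum => i; apply: cont01M; first exact: cont01_cst.
    exact: cdl.
  rewrite (int01B (cl _ vx) (cl _ xe')).
  rewrite int01_sum; last first.
    move=> i; apply: cont01M; first exact: cont01_cst.
    exact: cdl.
  congr (_ - _); apply: eq_bigr => i _; by rewrite (int01Z _ (cdl i)).
rewrite E.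
apply: (@le_trans _ _ (C * `|v| ^+ 2)).
  apply: int01_bound.
    apply: cont01B; first by apply: cont01B; exact: cl.
    apply: cont01_sum => i; apply: cont01M; first exact: cont01_cst.
    exact: cdl.
  move=> s s01; have /andP[s0 s1] := s01.
  have -> : s ^+ j * h (line (v + x) s) - s ^+ j * h (line x s)
                - \sum_i v 0 i * (s ^+ j.+1 * 'D_('e_i) h (line x s)) =
     s ^+ j * (h (line x s + s *: v) - h (line x s) - \sum_i (s *: v) 0 i * 'D_('e_i) h (line x s)).
    rewrite vxE mulrBr mulrBr mulr_sumr; congr (_ - _); apply: eq_bigr => i _.
    by rewrite mxE exprS; ring.
  rewrite normrM (le_trans (ler_piMl _ _)) //.
    by rewrite ger0_norm ?exprn_ge0 // exprn_ile1.
  apply: le_trans (hC _ _ _) _ => [t t01|].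
    have -> : line x s + t *: (s *: v) = line (t *: v + x) s.
      have -> : line (t *: v + x) s = x0 + s *: (t *: v + (x - x0)) by rewrite /line addrA.
      by rewrite scalerDr [s *: (t *: v) + _]addrC addrA !scalerA (mulrC t).
    apply: line_in => //; rewrite -addrA (le_trans (ler_normD _ _)) // -lerBrDr.
    by rewrite (le_trans _ ve) // normrZ ler_piMl //; move: t01 => /andP[t0 t1]; rewrite ger0_norm.
  rewrite ler_wpM2l // lerXn2r ?nnegrE // normrZ ler_piMl // ger0_norm //.
rewrite expr2 mulrA ler_wpM2r //.
have h1 : `|v| <= eps / (C + 1).
  near: v; apply/nbhs_ballP; exists (eps / (C + 1)).
    by rewrite /= divr_gt0 // ltr_wpDl.
  by move=> v /=; rewrite -ball_normE /= sub0r normrN => /ltW.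
rewrite ler_pdivlMr in h1; last by rewrite ltr_wpDl.
by rewrite (le_trans _ h1) // mulrC ler_wpM2l // lerDl.
Unshelve. all: by end_near. Qed.

Lemma ray_int_smooth j h : smooth_on O h ->
  smooth_on [set x | `|x - x0| < e] (ray_int j h).
Proof.
move=> sh k; elim: k j h sh => [|k IH] j h sh.
  move=> x xe; apply: differentiable_continuous.
  by have [] := ray_int_diff j sh xe.
have oB : open [set x : 'rV[R]_n | `|x - x0| < e].
  rewrite (_ : [set _ | _] = ball x0 e); first exact: ball_open.
  by rewrite -ball_normE; apply/seteqP; split=> x /=; rewrite distrC.
split=> [x xe|v]; first by have [] := ray_int_diff j sh xe.
have hk : Ck k [set x | `|x - x0| < e]
    (fun x => \sum_i v 0 i * ray_int j.+1 ('D_('e_i) h) x).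
  apply: Ck_sum => // i _; apply: CkM => //; first exact: Ck_cst.
  by apply: IH => k'; have [_ d] := sh k'.+1; exact: d.
apply: (Ck_ext oB _ hk) => x xe.
have [d dE] := ray_int_diff j sh xe.
by rewrite (deriveE v d) dE.
Qed.

(** The fundamental theorem of calculus along the ray from x0 to x. *)
Lemma hadamard_ball h : smooth_on O h -> forall x, `|x - x0| < e ->
  h x = h x0 + \sum_i (x 0 i - x0 0 i) * ray_int 0 ('D_('e_i) h) x.
Proof.
move=> sh x xe.
have dh z : O z -> differentiable h z by have [d _] := sh 1; exact: d.
have cdh i z : O z -> {for z, continuous ('D_('e_i) h : _ -> R^o)}.
  by have [_ c] := sh 1; exact: c.
have c i : cont01 (fun s => s ^+ 0 * 'D_('e_i) h (line x s)).
  exact: (cont01_line (cdh i) (ltW xe)).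
have ci i : cont01 (fun s => (x - x0) 0 i * (s ^+ 0 * 'D_('e_i) h (line x s))).
  by apply: cont01M => //; exact: cont01_cst.
have : int01 (fun s => \sum_i (x - x0) 0 i * (s ^+ 0 * 'D_('e_i) h (line x s))) =
   h (line x 1) - h (line x 0).
  apply: (int01_FTC (F := fun s => h (line x s))); first exact: cont01_sum.
  move=> s s01; have Ol : O (line x s) by apply: BO; apply: line_in => //; exact: ltW.
  have := is_derive_line (dh _ Ol); rewrite (derive_coord _ (dh _ Ol)).
  by under eq_bigr do rewrite -[X in _ * X]mul1r -(expr0 s).
rewrite int01_sum // /line scale1r scale0r addr0 subrKC => hE.
apply/eqP; rewrite -subr_eq0 opprD addrA subr_eq0 -hE; apply/eqP.
by apply: eq_bigr => i _; rewrite int01Z // !mxE.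
Qed.

Lemma ray_int_center h : ray_int 0 h x0 = h x0.
Proof.
rewrite /ray_int -[RHS](int01_cst (h x0)); congr int01; apply/funext => s.
by rewrite expr0 mul1r /line subrr scaler0 addr0.
Qed.

End Hadamard.

(** The smooth division property which makes every derivation of smooth functions at a
    point a combination of partial derivatives. *)
Lemma hadamard (R : realType) n (O : set 'rV[R]_n) x0 (h : 'rV[R]_n -> R^o) :
  open O -> O x0 -> smooth_on O h ->
  exists (V : set 'rV[R]_n) (g : 'I_n -> 'rV[R]_n -> R^o),
  [/\ open V, V x0, forall i, smooth_on V (g i),
      forall x, V x -> h x = h x0 + \sum_i (x 0 i - x0 0 i) * g i x
    & forall i, g i x0 = 'D_('e_i) h x0].
Proof.
move=> oO Ox0 sh.
have : nbhs x0 O by exact: open_nbhs_nbhs.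
rewrite -nbhs_ballE => -[d /= d0 dO].
pose e := d / 2.
have e0 : 0 < e by rewrite divr_gt0.
have BO x : `|x - x0| <= e -> O x.
  move=> xe; apply: dO; rewrite -ball_normE /= distrC (le_lt_trans xe) //.
  by rewrite /e; lra.
exists [set x | `|x - x0| < e], (fun i => ray_int x0 0 ('D_('e_i) h)); split.
- rewrite (_ : [set _ | _] = ball x0 e); first exact: ball_open.
  by rewrite -ball_normE; apply/seteqP; split=> x /=; rewrite distrC.
- by rewrite /= subrr normr0.
- move=> i; have si : smooth_on O ('D_('e_i) h).
    by move=> k; have [_ dh] := sh k.+1; exact: dh.
  exact: (ray_int_smooth e0 BO 0 si).
- exact: (hadamard_ball BO sh).
- by move=> i; exact: ray_int_center.
Qed.

(** * Tangent vectors as derivations *)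

Section SmoothNear.
Context {R : realType}.
Variables (n : nat) (M : manifold (R := R) n) (p : M).
Implicit Types (f g : M -> R).

Lemma smooth_near_eq f g : {near p, f =1 g} -> smooth_near p g -> smooth_near p f.
Proof.
move=> fg [h [sh gh]]; exists h; split=> //.
by apply: filterS2 fg gh => q -> ->.
Qed.

Lemma smooth_nearD f g : smooth_near p f -> smooth_near p g ->
  smooth_near p (fun q => f q + g q).
Proof.
move=> [f' [sf ff']] [g' [sg gg']]; exists (fun q => f' q + g' q).
split; first exact: smooth_funD.
by apply: filterS2 ff' gg' => q -> ->.
Qed.

Lemma smooth_nearM f g : smooth_near p f -> smooth_near p g ->
  smooth_near p (fun q => f q * g q).
Proof.
move=> [f' [sf ff']] [g' [sg gg']]; exists (fun q => f' q * g' q).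
split; first exact: smooth_funM.
by apply: filterS2 ff' gg' => q -> ->.
Qed.

Lemma smooth_near_sum m (F : 'I_m -> M -> R) : (forall i, smooth_near p (F i)) ->
  smooth_near p (fun q => \sum_i F i q).
Proof.
move=> sF; rewrite (_ : (fun q => _) = \sum_i F i); last first.
  by apply/funext => q; rewrite fct_sumE.
elim/big_ind : _ => [|f g|i _]; [|exact: smooth_nearD|exact: sF].
by apply: smooth_near_fun; exact: smooth_fun_cst.
Qed.

End SmoothNear.

Section Tangent.
Context {R : realType}.
Variables (n : nat) (M : manifold (R := R) n).
Implicit Types (p q : M) (f g : M -> R).

Lemma tangentP p (v : tangent p) : is_derivation p v.
Proof. exact/asboolP/(tangent_valP v). Qed.

Lemma tangent_ext p (v w : tangent p) :
  (forall f, smooth_fun f -> v f = w f) -> v = w.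
Proof.
move=> vw; apply: val_inj; apply/funext => f /=.
have [sf|nf] := pselect (smooth_fun f); first exact: vw.
by have [-> //] := tangentP v; have [-> //] := tangentP w.
Qed.

(** The value of [tangent_of] is a choice among tangent vectors that act as D; one exists
    when D is linear and satisfies the Leibniz rule, and it is determined on smooth functions. *)
Lemma tangent_ofE p (D : (M -> R) -> R) :
  (forall (a : R) f g, smooth_fun f -> smooth_fun g ->
     D (fun x => a * f x + g x) = a * D f + D g) ->
  (forall f g, smooth_fun f -> smooth_fun g ->
     D (fun x => f x * g x) = D f * g p + f p * D g) ->
  forall f, smooth_fun f -> tangent_of p D f = D f.
Proof.
move=> Dlin Dmul.
pose D' f : R^o := if `[< smooth_fun f >] then D f else 0.
have D'E f : smooth_fun f -> D' f = D f by move=> sf; rewrite /D'; case: asboolP.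
have dD' : is_derivation p D'.
  split.
  - by move=> f nf; rewrite /D'; case: asboolP.
  - move=> a f g sf sg; rewrite !D'E ?Dlin //.
    by apply: smooth_funD => //; exact: smooth_funZ.
  - by move=> f g sf sg; rewrite !D'E ?Dmul //; exact: smooth_funM.
have inD : D' \in derivation_at p by exact/asboolP.
rewrite /tangent_of.
case: xgetP => [w _ /= h|/(_ (Tangent inD)) h]; first exact: h.
by exfalso; apply: h => f sf; exact: D'E.
Qed.

Lemma tangent_linE p (a : R) (u v : tangent p) f :
  ((a *: u + v : TM M p) : tangent p) f = a * u f + v f.
Proof. by []. Qed.

Lemma tangent_addE p (u v : tangent p) f : ((u + v : TM M p) : tangent p) f = u f + v f.
Proof. by []. Qed.

Lemma tangent_oppE p (u : tangent p) f : ((- u : TM M p) : tangent p) f = - u f.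
Proof. by []. Qed.

Lemma tangent_scaleE p (a : R) (u : tangent p) f :
  ((a *: u : TM M p) : tangent p) f = a * u f.
Proof. by []. Qed.

Lemma tangent_0E p f : ((0 : TM M p) : tangent p) f = 0.
Proof. by []. Qed.

Lemma tangent_sumE p m (F : 'I_m -> TM M p) f :
  ((\sum_i F i : TM M p) : tangent p) f = \sum_i (F i : tangent p) f.
Proof. by elim/big_ind2 : _ => // u a v b <- <-. Qed.

Section Point.
Variables (p : M) (v : tangent p).

Lemma tangentL (a : R) f g : smooth_fun f -> smooth_fun g ->
  v (fun x => a * f x + g x) = a * v f + v g.
Proof. by have [_ h _] := tangentP v; exact: h. Qed.

Lemma tangentM f g : smooth_fun f -> smooth_fun g ->
  v (fun x => f x * g x) = v f * g p + f p * v g.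
Proof. by have [_ _ h] := tangentP v; exact: h. Qed.

Lemma eq_tangent f g : f =1 g -> v f = v g.
Proof. by move=> /funext ->. Qed.

Lemma tangent_cst (a : R) : v (fun=> a) = 0.
Proof.
have s1 := smooth_fun_cst (M:=M) 1.
have e1 : v (fun=> 1) = 0.
  have := tangentM s1 s1; rewrite !mulr1 mul1r => h.
  by move: h => /eqP; rewrite -subr_eq subrr => /eqP.
have sa := smooth_fun_cst (M:=M) a.
rewrite (eq_tangent (g := fun x => a * 1 + 0)) => [|x]; last by rewrite mulr1 addr0.
have s0 := smooth_fun_cst (M:=M) 0.
rewrite (tangentL _ s1 s0) e1 mulr0 add0r.
rewrite (eq_tangent (g := fun x => -1 * 1 + 1)) => [|x]; last by rewrite mulr1 addNr.
by rewrite (tangentL _ s1 s1) e1 mulr0 addr0.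
Qed.

Lemma tangentZ (a : R) f : smooth_fun f -> v (fun x => a * f x) = a * v f.
Proof.
move=> sf; have := tangentL a sf (smooth_fun_cst (M:=M) 0).
by rewrite tangent_cst addr0 => <-; congr (v _); apply/funext => x; rewrite addr0.
Qed.

Lemma tangentD f g : smooth_fun f -> smooth_fun g ->
  v (fun x => f x + g x) = v f + v g.
Proof.
move=> sf sg; have := tangentL 1 sf sg.
by rewrite mul1r => <-; congr (v _); apply/funext => x; rewrite mul1r.
Qed.

Lemma tangentB f g : smooth_fun f -> smooth_fun g ->
  v (fun x => f x - g x) = v f - v g.
Proof.
move=> sf sg; rewrite tangentD //; last exact: smooth_funN.
congr (_ + _); rewrite -mulN1r -tangentZ //.
by congr (v _); apply/funext => x; rewrite mulN1r.
Qed.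

Lemma tangent_sum m (F : 'I_m -> M -> R) : (forall i, smooth_fun (F i)) ->
  v (fun x => \sum_i F i x) = \sum_i v (F i).
Proof.
move=> sF.
have h (r : seq 'I_m) : v (fun x => \sum_(i <- r) F i x) = \sum_(i <- r) v (F i).
  elim: r => [|i r IH].
    rewrite big_nil -[RHS](tangent_cst 0); congr (v _).
    by apply/funext => x; rewrite big_nil.
  rewrite big_cons -IH -tangentD //; last exact: smooth_fun_sum.
  by congr (v _); apply/funext => x; rewrite big_cons.
exact: h.
Qed.

(** If f = g on a neighbourhood, a bump function theta supported there has
    theta (f - g) = 0, and the Leibniz rule turns this into v f = v g. *)
Lemma tangent_near f g : smooth_fun f -> smooth_fun g -> {near p, f =1 g} ->
  v f = v g.
Proof.
move=> sf sg fg; have [theta [st t1 [K cK [KP t0]]]] := smooth_bump fg.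
have sfg := smooth_funB sf sg.
have := tangentM st sfg; rewrite (nbhs_singleton fg) subrr mulr0 add0r.
rewrite (nbhs_singleton t1) mul1r tangentB //.
rewrite (_ : (fun x => theta x * (f x - g x)) = (fun=> 0)).
  by rewrite tangent_cst => /esym/eqP; rewrite subr_eq0 => /eqP.
apply/funext => x; have [Kx|nKx] := pselect (K x).
  by rewrite KP // subrr mulr0.
by rewrite t0 // mul0r.
Qed.

End Point.

Lemma vfield_lin (h : M -> R) (X Y : forall m, TM M m) : smooth_fun h ->
  smooth_sec X -> smooth_sec Y ->
  @smooth_sec _ _ (TM M) (fun m => h m *: X m + Y m).
Proof.
move=> sh sX sY f sf; apply: smooth_funD; last exact: sY.
by apply: smooth_funM => //; exact: sX.
Qed.

Lemma lieE (X Y : forall m, TM M m) p f : smooth_sec X -> smooth_sec Y ->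
  smooth_fun f ->
  lie X Y p f = (X p : tangent p) (fun x => (Y x : tangent x) f)
              - (Y p : tangent p) (fun x => (X x : tangent x) f).
Proof.
move=> sX sY; apply: tangent_ofE => [a g h sg sh|g h sg sh].
  have -> : (fun x => (Y x : tangent x) (fun y => a * g y + h y)) =
            (fun x => a * (Y x : tangent x) g + (Y x : tangent x) h).
    by apply/funext => x; rewrite tangentL.
  have -> : (fun x => (X x : tangent x) (fun y => a * g y + h y)) =
            (fun x => a * (X x : tangent x) g + (X x : tangent x) h).
    by apply/funext => x; rewrite tangentL.
  rewrite !tangentL; [ring| | | |]; by [exact: sX|exact: sY].
have -> : (fun x => (Y x : tangent x) (fun y => g y * h y)) =
          (fun x => (Y x : tangent x) g * h x + g x * (Y x : tangent x) h).
  by apply/funext => x; rewrite tangentM.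
have -> : (fun x => (X x : tangent x) (fun y => g y * h y)) =
          (fun x => (X x : tangent x) g * h x + g x * (X x : tangent x) h).
  by apply/funext => x; rewrite tangentM.
have sXg := sX g sg; have sYg := sY g sg; have sXh := sX h sh; have sYh := sY h sh.
rewrite !tangentD; try exact: smooth_funM.
rewrite !tangentM //; ring.
Qed.

End Tangent.

Lemma pushforwardE (R : realType) (n n' : nat) (M : manifold (R := R) n) (N : manifold n')
    (F : M -> N) (p : M) (v : tangent p) (f : N -> R) : smooth_map F -> smooth_fun f ->
  pushforward F v f = v (f \o F).
Proof.
move=> /smooth_mapP sF; apply: tangent_ofE => [a g h sg sh|g h sg sh].
  by rewrite -tangentL //; exact: sF.
by rewrite -tangentM //; exact: sF.
Qed.

(** * Tangent vectors in coordinates *)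

Section Coordinates.
Context {R : realType}.
Variables (n : nat) (M : manifold (R := R) n) (c : chart (R := R) M n).
Hypothesis hc : smooth_chart c.
Implicit Types (p q : M) (f g : M -> R).

Lemma near_near p (P : M -> Prop) :
  (\forall q \near p, P q) -> \forall q \near p, \forall x \near q, P x.
Proof. by move=> /nbhs_interior; apply: filterS. Qed.

Definition partial (i : 'I_n) f q : R := 'D_('e_i) (f \o param c : _ -> R^o) (coord c q).

Lemma smooth_near_comp p (V : set 'rV[R]_n) (g : 'rV[R]_n -> R^o) :
  dom c p -> open V -> V (coord c p) -> smooth_on V g ->
  smooth_near p (fun q => g (coord c q)).
Proof.
move=> cp oV Vp sg; apply: smooth_germ_near.
exists c, ((coord c @` dom c) `&` V); split.
- exact: hc.
- exact: cp.
- by apply: openI => //; exact: img_open.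
- by split=> //; exists p.
- move=> k; apply: (Ck_ext _ (f := g)).
  + by apply: openI => //; exact: img_open.
  + by move=> x [[q cq <-] _] /=; rewrite coordK.
  + by apply: Ck_sub (sg k) => x [].
Qed.

Lemma partial_smooth_near i f p : smooth_fun f -> dom c p ->
  smooth_near p (partial i f).
Proof.
move=> sf cp; apply: (smooth_near_comp (V := coord c @` dom c)
  (g := 'D_('e_i) (f \o param c : _ -> R^o))) => //; first exact: img_open.
move=> k; have [_ h] := smooth_fun_chart hc sf k.+1; exact: h.
Qed.

(** Write f = f(p) + sum (u_i - u_i(p)) g_i near p with Hadamard's lemma; a derivation
    only sees g_i(p), which is the i-th partial derivative. *)
Lemma tangent_coordE p (u : 'I_n -> M -> R) (v : tangent p) f : dom c p ->
  (forall i, smooth_fun (u i)) ->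
  (forall i, \forall q \near p, u i q = coord c q 0 i) ->
  smooth_fun f -> v f = \sum_i partial i f p * v (u i).
Proof.
move=> cp su ui sf.
have Ip : (coord c @` dom c) (coord c p) by exists p.
have [V [g [oV Vp sg fg gp]]] := hadamard (@img_open _ _ _ c) Ip (smooth_fun_chart hc sf).
have [G GP] := choice (fun i => smooth_near_comp cp oV Vp (sg i)).
have sG i : smooth_fun (G i) by have [] := GP i.
have gG i : \forall q \near p, g i (coord c q) = G i q by have [] := GP i.
have uG i : smooth_fun (fun q => (u i q - u i p) * G i q).
  by apply: smooth_funM => //; apply: smooth_funB => //; exact: smooth_fun_cst.
have sumuG : smooth_fun (fun q => \sum_i (u i q - u i p) * G i q).
  by apply: smooth_fun_sum => i _; exact: uG.
have up i : u i p = coord c p 0 i by exact: (nbhs_singleton (ui i)).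
have fE : {near p, f =1 fun q => f p + \sum_i (u i q - u i p) * G i q}.
  have gG' : \forall q \near p, forall i, g i (coord c q) = G i q by exact: filter_forall.
  have ui' : \forall q \near p, forall i, u i q = coord c q 0 i by exact: filter_forall.
  have Vq : \forall q \near p, V (coord c q).
    by apply: near_coord => //; apply: (open_nbhs_nbhs (conj oV Vp)).
  near=> q.
  have cq : dom c q by near: q; exact: near_dom.
  have := fg (coord c q) (near Vq q _); rewrite /= !coordK // => ->; last by [].
  congr (_ + _); apply: eq_bigr => i _.
  by rewrite (near gG' q) ?(near ui' q) ?up.
have sfp := smooth_fun_cst (M := M) (f p).
rewrite (tangent_near v sf (smooth_funD sfp sumuG) fE) tangentD // tangent_cst add0r.
rewrite tangent_sum //; apply: eq_bigr => i _.
have sup := smooth_fun_cst (M := M) (u i p).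
rewrite tangentM //; last exact: smooth_funB.
rewrite subrr mul0r addr0 tangentB // tangent_cst subr0 mulrC.
congr (_ * _); rewrite -(nbhs_singleton (gG i)) gp //.
Unshelve. all: by end_near. Qed.

Lemma tangent_ext_coord p (u : 'I_n -> M -> R) (v w : tangent p) : dom c p ->
  (forall i, smooth_fun (u i)) ->
  (forall i, \forall q \near p, u i q = coord c q 0 i) ->
  (forall i, v (u i) = w (u i)) -> v = w.
Proof.
move=> cp su ui vw; apply: tangent_ext => f sf.
by rewrite !(tangent_coordE _ cp su ui sf); apply: eq_bigr => i _; rewrite vw.
Qed.

(** In coordinates X f is a combination of the X u_i with smooth coefficients. *)
Lemma vfield_smooth_near p (u : 'I_n -> M -> R) (X : forall q, TM M q) : dom c p ->
  (forall i, smooth_fun (u i)) ->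
  (forall i, \forall q \near p, u i q = coord c q 0 i) ->
  (forall i, smooth_near p (fun q => (X q : tangent q) (u i))) ->
  forall f, smooth_fun f -> smooth_near p (fun q => (X q : tangent q) f).
Proof.
move=> cp su ui sX f sf.
apply: (smooth_near_eq (g := fun q => \sum_i partial i f q * (X q : tangent q) (u i))).
  have ui' : \forall q \near p, forall i, \forall x \near q, u i x = coord c x 0 i.
    by apply: filter_forall => i; exact: near_near.
  apply: filterS2 (near_dom cp) ui' => q cq uq.
  exact: tangent_coordE.
apply: smooth_near_sum => i; apply: smooth_nearM => //.
exact: partial_smooth_near.
Qed.

(** The partial derivatives of a chart, multiplied by a cutoff, are global vector fields. *)
Lemma coord_frame p : dom c p ->
  exists (u : 'I_n -> M -> R) (X : 'I_n -> forall q, TM M q),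
  [/\ forall i, smooth_fun (u i), forall i, smooth_sec (X i),
      forall i, \forall q \near p, u i q = coord c q 0 i
    & forall i j, \forall q \near p, (X i q : tangent q) (u j) = (i == j)%:R].
Proof.
move=> cp.
have [u uP] := choice (fun i => coord_near i hc cp).
have su i : smooth_fun (u i) by have [] := uP i.
have ui i : \forall q \near p, u i q = coord c q 0 i.
  by have [_] := uP i; apply: filterS => q.
have Ip : (coord c @` dom c) (coord c p) by exists p.
have [theta [t1 [K cK [KV t0]] sm]] := cutoff hc cp (@img_open _ _ _ c) Ip.
pose X i q : TM M q := tangent_of q (fun f => theta q * partial i f q).
have dpar (f : M -> R) q : smooth_fun f -> dom c q ->
    differentiable (f \o param c : _ -> R^o) (coord c q).
  by move=> sf cq; have [d _] := smooth_fun_chart hc sf 1; apply: d; exists q.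
have XE i q f : smooth_fun f -> (X i q : tangent q) f = theta q * partial i f q.
  have [cq|ncq] := pselect (dom c q); last first.
    have tq : theta q = 0 by apply: t0 => /KV[].
    by apply: tangent_ofE => // [a g h _ _|g h _ _]; rewrite tq; ring.
  apply: tangent_ofE => [a g h sg sh|g h sg sh]; rewrite /partial.
    have -> : 'D_('e_i) ((fun x => a * g x + h x) \o param c : _ -> R^o) (coord c q) =
       a * 'D_('e_i) (g \o param c : _ -> R^o) (coord c q) +
       'D_('e_i) (h \o param c : _ -> R^o) (coord c q).
      have dg := diff_derivable (dpar g q sg cq).
      have dh := diff_derivable (dpar h q sh cq).
      rewrite -[a * _](deriveZ a (dg _)) -deriveD //; last exact: derivableZ.
    ring.
  have -> : 'D_('e_i) ((fun x => g x * h x) \o param c : _ -> R^o) (coord c q) =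
     g q *: 'D_('e_i) (h \o param c : _ -> R^o) (coord c q) +
     h q *: 'D_('e_i) (g \o param c : _ -> R^o) (coord c q).
    have dg := diff_derivable (dpar g q sg cq).
    have dh := diff_derivable (dpar h q sh cq).
    have := @deriveM R _ (g \o param c) (h \o param c) (coord c q) 'e_i (dg _) (dh _).
    by rewrite /= coordK.
  rewrite /GRing.scale /=; ring.
exists u, X; split=> // [i f sf|i j].
- rewrite (_ : (fun m => _) = (fun m => theta m * partial i f m)); last first.
    by apply/funext => q; rewrite XE.
  apply: sm => k.
  apply: (Ck_ext (@img_open _ _ _ c) (f := 'D_('e_i) (f \o param c : _ -> R^o))).
    by move=> _ [q cq <-]; rewrite /= /partial /= coordK.
  by have [_ h] := smooth_fun_chart hc sf k.+1; exact: h.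
- apply: filterS3 t1 (near_dom cp) (near_near (ui j)) => q tq cq uq.
  rewrite XE // tq mul1r /partial.
  have uq' : \forall x \near coord c q, (u j \o param c) x = x 0 j.
    have h1 : \forall x \near coord c q, u j (param c x) = coord c (param c x) 0 j.
      exact: (near_param cq uq).
    have h2 : nbhs (coord c q) (coord c @` dom c).
      by apply: open_nbhs_nbhs; split; [exact: img_open|exists q].
    by apply: filterS2 h1 h2 => x + [q' cq' qx]; rewrite /= -qx coordK.
  rewrite (@near_eq_derive R 'rV[R]_n R^o _ (fun x : 'rV[R]_n => x 0 j) _ _ uq').
  have := derive_mx (@derivable_id R _ (coord c q) ('e_i)).
  rewrite derive_id => /rowP/(_ j) h; rewrite [in RHS]mxE in h; rewrite -h.
  by rewrite mxE eqxx eq_sym.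
Qed.

End Coordinates.

(** Both sides of the last identity agree on the coordinate functions. *)
Lemma tangent_frame (R : realType) n (M : manifold (R := R) n) (c : chart M n) p :
  smooth_chart c -> dom c p ->
  exists (u : 'I_n -> M -> R) (X : 'I_n -> forall q, TM M q),
  [/\ forall i, smooth_fun (u i), forall i, smooth_sec (X i),
      forall i, \forall q \near p, u i q = coord c q 0 i,
      forall i j, \forall q \near p, (X i q : tangent q) (u j) = (i == j)%:R
    & \forall q \near p, forall v : TM M q,
        v = \sum_i (v : tangent q) (u i) *: X i q].
Proof.
move=> hc cp; have [u [X [su sX ui Xu]]] := coord_frame hc cp.
exists u, X; split=> //.
have ui' : \forall q \near p, forall i, \forall x \near q, u i x = coord c x 0 i.
  by apply: filter_forall => i; exact: near_near.
have Xu' : \forall q \near p, forall i j, (X i q : tangent q) (u j) = (i == j)%:R.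
  by apply: filter_forall => i; apply: filter_forall => j; exact: Xu.
apply: filterS3 (near_dom cp) ui' Xu' => q cq uq Xq v.
apply: (tangent_ext_coord hc cq su uq) => j.
have E i : ((v : tangent q) (u i) *: X i q : tangent q) (u j) =
    (v : tangent q) (u i) * (i == j)%:R by rewrite -Xq.
rewrite tangent_sumE (eq_bigr _ (fun i _ => E i)) (bigD1 j) //= eqxx mulr1.
by rewrite big1 ?addr0 // => i /negbTE ->; rewrite mulr0.
Qed.

(** * Modules of sections and the tensor principle *)

Section TensorPrinciple.
Context {R : realType}.
Variables (n : nat) (M : manifold (R := R) n) (V : vfamily (R := R) M).

Definition lin_closed := forall (f : M -> R) (a b : forall m, V m),
  smooth_fun f -> smooth_sec a -> smooth_sec b ->
  smooth_sec (fun m => f m *: a m + b m).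

Hypothesis VL : lin_closed.

Lemma smooth_sec0 (a : forall m, V m) : smooth_sec a ->
  smooth_sec (fun m => 0 : V m).
Proof.
move=> sa; have := VL (smooth_fun_cst (-1)) sa sa; congr (smooth_sec _).
by apply/functional_extensionality_dep => m; rewrite scaleN1r addNr.
Qed.

Lemma smooth_secZ (f : M -> R) (a : forall m, V m) : smooth_fun f -> smooth_sec a ->
  smooth_sec (fun m => f m *: a m).
Proof.
move=> sf sa; have := VL sf sa (smooth_sec0 sa); congr (smooth_sec _).
by apply/functional_extensionality_dep => m; rewrite addr0.
Qed.

Lemma smooth_secD (a b : forall m, V m) : smooth_sec a -> smooth_sec b ->
  smooth_sec (fun m => a m + b m).
Proof.
move=> sa sb; have := VL (smooth_fun_cst 1) sa sb; congr (smooth_sec _).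
by apply/functional_extensionality_dep => m; rewrite scale1r.
Qed.

Lemma smooth_secB (a b : forall m, V m) : smooth_sec a -> smooth_sec b ->
  smooth_sec (fun m => a m - b m).
Proof.
move=> sa sb; have := VL (smooth_fun_cst (-1)) sb sa; congr (smooth_sec _).
by apply/functional_extensionality_dep => m; rewrite scaleN1r addrC.
Qed.

Lemma smooth_sec_sum k (f : 'I_k -> M -> R) (a : 'I_k -> forall m, V m)
    (z : forall m, V m) (r : seq 'I_k) : smooth_sec z ->
  (forall i, smooth_fun (f i)) -> (forall i, smooth_sec (a i)) ->
  smooth_sec (fun m => \sum_(i <- r) f i m *: a i m).
Proof.
move=> sz sf sa; elim: r => [|i r IH].
  have := smooth_sec0 sz; congr (smooth_sec _).
  by apply/functional_extensionality_dep => m; rewrite big_nil.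
have := VL (sf i) (sa i) IH; congr (smooth_sec _).
by apply/functional_extensionality_dep => m; rewrite big_cons.
Qed.

Variables (W : lmodType R) (p : M) (T : (forall m, V m) -> W).
Hypothesis TL : forall (f : M -> R) (a b : forall m, V m),
  smooth_fun f -> smooth_sec a -> smooth_sec b ->
  T (fun m => f m *: a m + b m) = f p *: T a + T b.

Lemma tensor0 (a : forall m, V m) : smooth_sec a -> T (fun m => 0) = 0.
Proof.
move=> sa; have := TL (smooth_fun_cst (-1)) sa sa; rewrite scaleN1r addNr => <-.
by congr (T _); apply/functional_extensionality_dep => m; rewrite scaleN1r addNr.
Qed.

(** If theta = 1 at p and a vanishes on the support of theta, then a = (1 - theta) a, and
    T a = (1 - theta(p)) T a = 0. *)
Lemma tensor_near0 (a : forall m, V m) : smooth_sec a ->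
  (\forall m \near p, a m = 0) -> T a = 0.
Proof.
move=> sa a0; have [theta [st t1 [K cK [KP t0]]]] := smooth_bump a0.
have s1 := smooth_funB (smooth_fun_cst 1) st.
have := TL s1 sa (smooth_sec0 sa).
rewrite (nbhs_singleton t1) subrr scale0r add0r (tensor0 sa) => <-.
congr (T _); apply/functional_extensionality_dep => m; rewrite addr0.
have [Km|nKm] := pselect (K m); first by rewrite KP // scaler0.
by rewrite t0 // subr0 scale1r.
Qed.

(** The difference between z and its expansion vanishes near p, so T kills it.  This is
    how statements about all sections are reduced to the members of a local frame. *)
Lemma tensor_expand k (f : 'I_k -> M -> R) (a : 'I_k -> forall m, V m)
    (z : forall m, V m) : smooth_sec z ->
  (forall i, smooth_fun (f i)) -> (forall i, smooth_sec (a i)) ->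
  (\forall m \near p, z m = \sum_i f i m *: a i m) ->
  T z = \sum_i f i p *: T (a i).
Proof.
move=> sz sf sa zE.
have sS r := smooth_sec_sum r sz sf sa.
have TS (r : seq 'I_k) : T (fun m => \sum_(i <- r) f i m *: a i m) =
    \sum_(i <- r) f i p *: T (a i).
  elim: r => [|i r IH].
    rewrite big_nil -[RHS](tensor0 sz); congr (T _).
    by apply/functional_extensionality_dep => m; rewrite big_nil.
  rewrite big_cons -IH -TL //; congr (T _).
  by apply/functional_extensionality_dep => m; rewrite big_cons.
rewrite -TS; apply/eqP; rewrite -subr_eq0; apply/eqP.
have := TL (smooth_fun_cst (-1)) (sS (index_enum _)) sz.
rewrite scaleN1r addrC => <-; apply: tensor_near0; first exact: VL (smooth_fun_cst _) _ _.
by apply: filterS zE => m ->; rewrite scaleN1r addNr.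
Qed.

End TensorPrinciple.

Lemma TM_lin_closed (R : realType) n (M : manifold (R := R) n) : lin_closed (TM M).
Proof. by move=> f a b sf sa sb; exact: vfield_lin. Qed.

Lemma dsum_lin_closed (R : realType) n (M : manifold (R := R) n) (V W : vfamily (R := R) M) :
  lin_closed V -> lin_closed W -> lin_closed (dsum V W).
Proof.
by move=> hV hW f a b sf [a1 a2] [b1 b2]; split; [exact: hV|exact: hW].
Qed.

(** * Local trivializations of a vector bundle *)

Section BundleCharts.
Context {R : realType}.
Variables (n r : nat) (M : manifold (R := R) n) (E : vbundle M r).
Local Notation P := (total_space E).

(** Equal points of the total space lie in the same fibre; the function G absorbs the
    dependence of the type of a vector on its base point. *)
Lemma pt_eq (T : Type) (G : forall m, vfib E m -> T) m m' (u : vfib E m) (v : vfib E m') :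
  pt u = pt v -> G m u = G m' v.
Proof.
move=> uv; have mm' : m = m' by rewrite -(proj_pt u) uv proj_pt.
by case: _ / mm' v uv => v /pt_inj ->.
Qed.

Lemma vec_ptE (T : Type) (G : forall m, vfib E m -> T) m (v : vfib E m) :
  G _ (vec (pt v)) = G m v.
Proof. by apply: pt_eq; rewrite vecK. Qed.

(** A local trivialization with an adapted chart c' of the total space, as provided by
    [local_triv] for one chart c of the base. *)
Record is_triv (U : set M) (tau : forall m, vfib E m -> 'rV[R]_r)
    (c : chart (R := R) M n) (c' : chart (R := R) P (n + r)) : Prop := IsTriv {
  triv_open : open U;
  triv_bij : forall m, U m -> bijective (tau m);
  triv_lin : forall m, U m -> forall (a : R) u v, tau m (a *: u + v) = a *: tau m u + tau m v;
  triv_atlas : atlas c;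
  triv_chart : smooth_chart c';
  triv_dom : dom c' = bproj E @^-1` (U `&` dom c);
  triv_coord : forall m (v : vfib E m), U m -> dom c m ->
    coord c' (pt v) = row_mx (coord c m) (tau m v) }.

Lemma exists_triv m0 : exists U tau c c', [/\ is_triv U tau c c', U m0 & dom c m0].
Proof.
have [U [tau [oU Um0 tauP h]]] := local_triv E m0.
have [c hc cm0] := atlas_cover m0.
have [c' [c'1 c'2 c'3]] := h c hc.
exists U, tau, c, c'; split=> //; split=> // m Um; by have [] := tauP m Um.
Qed.

Section Triv.
Variables (U : set M) (tau : forall m, vfib E m -> 'rV[R]_r).
Variables (c : chart (R := R) M n) (c' : chart (R := R) P (n + r)).
Hypothesis ht : is_triv U tau c c'.

Lemma triv_domP q : dom c' q <-> U (bproj E q) /\ dom c (bproj E q).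
Proof. by rewrite (triv_dom ht). Qed.

Lemma triv_coordE q : dom c' q ->
  coord c' q = row_mx (coord c (bproj E q)) (tau (vec q)).
Proof.
by move=> /triv_domP[Uq cq]; rewrite -(triv_coord ht (vec q) Uq cq) vecK.
Qed.

Lemma triv_tau0 m : U m -> tau (0 : vfib E m) = 0.
Proof.
move=> Um; have := triv_lin ht Um (-1) 0 0.
by rewrite scaler0 addr0 scaleN1r addNr.
Qed.

Lemma triv_proj_smooth q (f : M -> R) : smooth_fun f -> dom c' q ->
  smooth_germ q (f \o bproj E).
Proof.
move=> sf c'q; exists c', (coord c' @` dom c'); split=> //.
- exact: triv_chart ht.
- exact: img_open.
- move=> k; apply: (Ck_ext (@img_open _ _ _ c') (f := (f \o param c) \o lsubmx)).
    move=> _ [q' c'q' <-] /=; rewrite coordK // triv_coordE // row_mxKl coordK //.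
    by have /triv_domP[] := c'q'.
  apply: (Ck_comp (V := coord c @` dom c)); first exact: img_open.
  + move=> _ [q' c'q' <-]; rewrite triv_coordE // row_mxKl.
    by exists (bproj E q') => //; have /triv_domP[] := c'q'.
  + exact: (sf c (triv_atlas ht)).
  + move=> i; apply: (Ck_ext (@img_open _ _ _ c') (f := fun x => x 0 (lshift r i))).
      by move=> x _; rewrite mxE.
    exact: Ck_coord.
Qed.

(** In the adapted charts F o pt o s is F o param c' composed with
    x |-> (x, components of s), so smooth components are enough. *)
Lemma triv_section_smooth m1 (s : forall m, vfib E m) (F : P -> R) :
  U m1 -> dom c m1 -> smooth_fun F ->
  (forall b, smooth_near m1 (fun m => tau (s m) 0 b)) ->
  smooth_near m1 (fun m => F (pt (s m))).
Proof.
move=> Um1 cm1 sF sb.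
have [g gP] := choice sb.
have sg b : smooth_fun (g b) by have [] := gP b.
pose A m := U m /\ forall b, tau (s m) 0 b = g b m.
have nA : \forall m \near m1, A m.
  have h1 : \forall m \near m1, forall b, tau (s m) 0 b = g b m.
    by apply: filter_forall => b; have [_] := gP b; exact: filterS.
  by apply: filterI h1; apply: open_nbhs_nbhs; split => //; exact: triv_open ht.
pose W := interior A.
have WA m : W m -> A m by exact: interior_subset.
have oW : open W by exact: open_interior.
have hc := atlas_smooth_chart (triv_atlas ht).
apply: smooth_germ_near; exists c, (coord c @` (dom c `&` W)); split=> //.
- exact: chart_image_open.
- by exists m1.
move=> k.
pose G (x : 'rV[R]_n) : 'rV[R]_(n + r) := row_mx x (\row_b g b (param c x)).
have GE m : dom c m -> W m -> G (coord c m) = coord c' (pt (s m)).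
  move=> cm /WA[Um gm]; rewrite /G (triv_coord ht) // coordK //; congr (row_mx _ _).
  by apply/rowP => b; rewrite mxE -gm.
apply: (Ck_ext _ (f := (F \o param c') \o G)).
- exact: chart_image_open.
- move=> _ [m [cm Wm] <-] /=; rewrite GE // !coordK //; apply/triv_domP.
  by rewrite proj_pt; split=> //; have [] := WA _ Wm.
- apply: (Ck_comp (V := coord c' @` dom c')).
  + exact: chart_image_open.
  + move=> _ [m [cm Wm] <-]; rewrite GE //; exists (pt (s m)) => //.
    by apply/triv_domP; rewrite proj_pt; split=> //; have [] := WA _ Wm.
  + exact: (smooth_fun_chart (triv_chart ht) sF).
  + move=> j; case: (split_ordP j) => [i ->|b ->].
      apply: (Ck_ext _ (f := fun x => x 0 i)); last exact: Ck_coord.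
        exact: chart_image_open.
      by move=> x _; rewrite /G row_mxEl.
    apply: (Ck_ext _ (f := g b \o param c)).
    * exact: chart_image_open.
    * by move=> x _; rewrite /G row_mxEr mxE.
    * by apply: Ck_sub (sg b c (triv_atlas ht) k) => _ [m [cm _] <-]; exists m.
Qed.

End Triv.

(** In adapted charts the projection is the projection onto the first n coordinates. *)
Lemma bproj_smooth_fun (f : M -> R) : smooth_fun f -> smooth_fun (f \o bproj E).
Proof.
move=> sf; apply: smooth_germ_fun => q.
have [U [tau [c [c' [ht Uq cq]]]]] := exists_triv (bproj E q).
by apply: (triv_proj_smooth ht sf); apply/(triv_domP ht).
Qed.

Lemma bproj_smooth : smooth_map (bproj E).
Proof. by apply/smooth_mapP => f; exact: bproj_smooth_fun. Qed.

Lemma near_bproj q (A : M -> Prop) : (\forall m \near bproj E q, A m) ->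
  \forall x \near q, A (bproj E x).
Proof. by have [cE _] := bproj_smooth; exact: cE. Qed.

Lemma section_smoothP (s : forall m, sections E m) :
  smooth_sec s <-> forall F : P -> R, smooth_fun F -> smooth_fun (fun m => F (pt (s m))).
Proof. exact: smooth_mapP. Qed.

Lemma zero_section_smooth : @smooth_sec _ _ (sections E) (fun m => 0).
Proof.
apply/section_smoothP => F sF; apply: smooth_nearP => m1.
have [U [tau [c [c' [ht Um cm]]]]] := exists_triv m1.
apply: (triv_section_smooth ht) => // b.
apply: (smooth_near_eq (g := fun=> 0)).
  apply: (open_near (triv_open ht)) => // m' Um'.
  by rewrite (triv_tau0 ht Um') mxE.
by apply: smooth_near_fun; exact: smooth_fun_cst.
Qed.

(** The functions xi_b = theta tau_b are fibrewise linear on the whole total space: theta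
    kills them where tau is not defined.  They replace the fibre coordinates of the
    trivialization, with the advantage of being global smooth functions. *)
Lemma fiber_coord m0 U tau c c' : is_triv U tau c c' -> U m0 -> dom c m0 ->
  exists (xi : 'I_r -> P -> R) (theta : M -> R),
  [/\ forall b, smooth_fun (xi b), smooth_fun theta,
      \forall m \near m0, theta m = 1,
      forall b m (v : vfib E m), xi b (pt v) = theta m * tau m v 0 b
    & exists2 K, closed K & K `<=` U `&` dom c /\ forall m, ~ K m -> theta m = 0].
Proof.
move=> ht Um0 cm0.
have nUc : \forall m \near m0, U m /\ dom c m.
  apply: filterI; last exact: near_dom.
  by apply: open_nbhs_nbhs; split => //; exact: triv_open ht.
have [theta [st t1 [K cK [KP t0]]]] := smooth_bump nUc.
pose xi b (q : P) : R := theta (bproj E q) * tau _ (vec q) 0 b.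
have xiE b m (v : vfib E m) : xi b (pt v) = theta m * tau m v 0 b.
  exact: (vec_ptE (fun m (v : vfib E m) => theta m * tau m v 0 b)).
exists xi, theta; split=> //; last by exists K => //; split=> // m /KP[].
move=> b; apply: smooth_nearP => q.
have [Kq|nKq] := pselect (K (bproj E q)); last first.
  apply: (smooth_near_eq (g := fun=> 0)); last first.
    by apply: smooth_near_fun; exact: smooth_fun_cst.
  have : \forall m \near bproj E q, theta m = 0.
    apply: (open_near (U := ~` K)) => //; by rewrite openC.
  by move=> /near_bproj; apply: filterS => x; rewrite /xi => ->; rewrite mul0r.
have c'q : dom c' q by apply/(triv_domP ht); exact: KP.
apply: smooth_nearM.
  by apply: smooth_near_fun; exact: bproj_smooth_fun.
apply: (smooth_near_eq (g := fun x => coord c' x 0 (rshift n b))).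
  apply: filterS (near_dom c'q) => x c'x.
  by rewrite (triv_coordE ht) // row_mxEr.
exact: coord_near (triv_chart ht) _.
Qed.

Lemma section_lin_closed : lin_closed (sections E).
Proof.
move=> f a b sf /section_smoothP sa /section_smoothP sb.
apply/section_smoothP => F sF; apply: smooth_nearP => m1.
have [U [tau [c [c' [ht Um cm]]]]] := exists_triv m1.
have [xi [theta [sxi st t1 xiE _]]] := fiber_coord ht Um cm.
apply: (triv_section_smooth ht) => // k.
apply: (smooth_near_eq (g := fun m => f m * xi k (pt (a m)) + xi k (pt (b m)))).
  have nU : nbhs m1 U by apply: open_nbhs_nbhs; split => //; exact: triv_open ht.
  apply: filterS2 t1 nU => m tm Um'.
  by rewrite !xiE tm !mul1r (triv_lin ht) // !mxE.
apply: smooth_near_fun; apply: smooth_funD; last exact: sb.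
by apply: smooth_funM => //; exact: sa.
Qed.

(** The sections theta tau^-1(e_a), extended by zero. *)
Lemma fiber_frame (m0 : M) U tau c c' (xi : 'I_r -> P -> R) (theta : M -> R) (K : set M) :
  is_triv U tau c c' -> smooth_fun theta -> (\forall m \near m0, theta m = 1) ->
  (forall b m (v : vfib E m), xi b (pt v) = theta m * tau m v 0 b) ->
  closed K -> K `<=` U `&` dom c -> (forall m, ~ K m -> theta m = 0) ->
  exists t : 'I_r -> forall m, sections E m,
  [/\ forall a, smooth_sec (t a),
      \forall m \near m0, forall a b, xi b (pt (t a m)) = (a == b)%:R
    & \forall m \near m0, forall v : vfib E m, v = \sum_a xi a (pt v) *: t a m].
Proof.
move=> ht st t1 xiE cK KU t0.
have ex a m : exists v : vfib E m, U m -> tau m v = 'e_a.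
  have [Um|nUm] := pselect (U m); last by exists 0.
  by have [g _ gK] := triv_bij ht Um; exists (g 'e_a) => _; rewrite gK.
pose e a m := projT1 (cid (ex a m)).
have eP a m : U m -> tau m (e a m) = 'e_a := projT2 (cid (ex a m)).
pose t a m : sections E m := theta m *: e a m.
have tauZ m (k : R) (v : vfib E m) : U m -> tau m (k *: v) = k *: tau m v.
  by move=> Um; rewrite -[k *: v]addr0 (triv_lin ht Um) (triv_tau0 ht Um) addr0.
have tauD m (u v : vfib E m) : U m -> tau m (u + v) = tau m u + tau m v.
  by move=> Um; rewrite -[u]scale1r (triv_lin ht Um) !scale1r.
have tauS m (I : Type) (s : seq I) (F : I -> vfib E m) : U m ->
    tau m (\sum_(i <- s) F i) = \sum_(i <- s) tau m (F i).
  move=> Um; elim: s => [|i s IH]; first by rewrite !big_nil (triv_tau0 ht Um).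
  by rewrite !big_cons tauD // IH.
(* theta = 1 forces m to lie in K, where tau is a linear bijection *)
have nK : \forall m \near m0, K m /\ theta m = 1.
  by apply: filterS t1 => m tm; split=> //; apply: contrapT => /t0 /eqP; rewrite tm oner_eq0.
have tE m a : U m -> tau m (t a m) = theta m *: 'e_a.
  by move=> Um; rewrite tauZ // eP.
exists t; split.
- move=> a; apply/section_smoothP => F sF; apply: smooth_nearP => m1.
  have [Km1|nKm1] := pselect (K m1); last first.
    apply: (smooth_near_eq (g := fun m => F (pt (0 : vfib E m)))); last first.
      by apply: smooth_near_fun; have /section_smoothP := zero_section_smooth; apply.
    apply: (open_near (U := ~` K)) => //; first by rewrite openC.
    by move=> m /t0 tm; rewrite /t tm scale0r.
  have [Um1 cm1] := KU _ Km1.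
  apply: (triv_section_smooth ht) => // b.
  apply: (smooth_near_eq (g := fun m => theta m * ('e_a : 'rV[R]_r) 0 b)).
    apply: (open_near (triv_open ht)) => // m Um.
    by rewrite tE // mxE.
  apply: smooth_near_fun; apply: smooth_funM => //; exact: smooth_fun_cst.
- apply: filterS nK => m [/KU[Um _] tm] a b.
  by rewrite xiE tE // tm mul1r scale1r mxE eqxx /= eq_sym.
- apply: filterS nK => m [/KU[Um _] tm] v.
  have [g gK _] := triv_bij ht Um; apply: (can_inj gK).
  rewrite tauS // [LHS]row_sum_delta; apply: eq_bigr => a _.
  by rewrite tauZ // tE // tm scale1r xiE tm mul1r.
Qed.

End BundleCharts.

(** * Frames of the total space and vertical lifts *)

Section BundleFrame.
Context {R : realType}.
Variables (n r : nat) (M : manifold (R := R) n) (E : vbundle M r).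
Local Notation P := (total_space E).

(** Global functions and sections which behave near m0 like base coordinates u, their
    partial derivatives X, fibre coordinates xi, and the frame t dual to xi.  The last two
    clauses say that the functions u o pr and xi are coordinates of the total space: they
    determine tangent vectors and detect smooth fields. *)
Record bundle_frame (m0 : M) (u : 'I_n -> M -> R) (X : 'I_n -> forall m, TM M m)
    (xi : 'I_r -> P -> R) (t : 'I_r -> forall m, sections E m) : Prop := BundleFrame {
  frame_u : forall i, smooth_fun (u i);
  frame_X : forall i, smooth_sec (X i);
  frame_xi : forall b, smooth_fun (xi b);
  frame_t : forall a, smooth_sec (t a);
  frame_xi_lin : forall b m (a : R) (v w : vfib E m),
    xi b (pt (a *: v + w)) = a * xi b (pt v) + xi b (pt w);
  frame_Xu : \forall m \near m0, forall i j, (X i m : tangent m) (u j) = (i == j)%:R;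
  frame_XE : \forall m \near m0, forall v : TM M m,
    v = \sum_i (v : tangent m) (u i) *: X i m;
  frame_xit : \forall m \near m0, forall a b, xi b (pt (t a m)) = (a == b)%:R;
  frame_tE : \forall m \near m0, forall v : vfib E m, v = \sum_a xi a (pt v) *: t a m;
  frame_ext : \forall m \near m0, forall q, bproj E q = m -> forall v w : tangent q,
    (forall i, v (u i \o bproj E) = w (u i \o bproj E)) ->
    (forall b, v (xi b) = w (xi b)) -> v = w;
  frame_smooth : \forall m \near m0, forall q, bproj E q = m ->
    forall Z : forall q, TM P q,
    (forall i, smooth_near q (fun x => (Z x : tangent x) (u i \o bproj E))) ->
    (forall b, smooth_near q (fun x => (Z x : tangent x) (xi b))) ->
    forall F, smooth_fun F -> smooth_near q (fun x => (Z x : tangent x) F) }.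

Lemma exists_bundle_frame m0 : exists u X xi t, bundle_frame m0 u X xi t.
Proof.
have [U [tau [c [c' [ht Um0 cm0]]]]] := exists_triv E m0.
have hc := atlas_smooth_chart (triv_atlas ht).
have [u [X [su sX uc Xu XE]]] := tangent_frame hc cm0.
have [xi [theta [sxi st t1 xiE [K cK [KU t0]]]]] := fiber_coord ht Um0 cm0.
have [t [stt xit tE]] := fiber_frame ht st t1 xiE cK KU t0.
exists u, X, xi, t.
(* the first n coordinates come from the base, the last r ones from the fibre *)
pose w (k : 'I_(n + r)) : P -> R :=
  match fintype.split k with inl i => u i \o bproj E | inr a => xi a end.
have wl i : w (lshift r i) = u i \o bproj E by rewrite /w (unsplitK (inl i)).
have wr a : w (rshift n a) = xi a by rewrite /w (unsplitK (inr a)).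
have sw k : smooth_fun (w k).
  rewrite /w; case: fintype.split => [i|a] //; exact: bproj_smooth_fun.
have nq : \forall m \near m0, forall q, bproj E q = m ->
    dom c' q /\ forall k, \forall x \near q, w k x = coord c' x 0 k.
  have h1 : \forall m \near m0, \forall x \near m, forall i, u i x = coord c x 0 i.
    by apply: near_near; exact: filter_forall.
  have h2 : \forall m \near m0, \forall x \near m, theta x = 1 by exact: near_near.
  have h3 : \forall m \near m0, \forall x \near m, U x.
    apply: near_near; apply: open_nbhs_nbhs; split => //; exact: triv_open ht.
  have h4 : \forall m \near m0, \forall x \near m, dom c x.
    by apply: near_near; exact: near_dom.
  near=> m => q qm.
  have k1 := near h1 m; have k2 := near h2 m; have k3 := near h3 m; have k4 := near h4 m.
  have {}k1 : \forall x \near m, forall i, u i x = coord c x 0 i by apply: k1.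
  have {}k2 : \forall x \near m, theta x = 1 by apply: k2.
  have {}k3 : \forall x \near m, U x by apply: k3.
  have {}k4 : \forall x \near m, dom c x by apply: k4.
  rewrite -qm in k1 k2 k3 k4.
  split; first by apply/(triv_domP ht); split; [exact: nbhs_singleton k3|exact: nbhs_singleton k4].
  have {}k1 := near_bproj k1; have {}k2 := near_bproj k2.
  have {}k3 := near_bproj k3; have {}k4 := near_bproj k4.
  move=> k; near=> x.
  have Ux : U (bproj E x) by near: x; exact: k3.
  have cx : dom c (bproj E x) by near: x; exact: k4.
  have tx : theta (bproj E x) = 1 by near: x; exact: k2.
  have ux : forall i, u i (bproj E x) = coord c (bproj E x) 0 i by near: x; exact: k1.
  have c'x : dom c' x by apply/(triv_domP ht).
  rewrite (triv_coordE ht c'x); case: (split_ordP k) => [i ->|a ->].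
    by rewrite wl row_mxEl /= ux.
  by rewrite wr row_mxEr -[in LHS](vecK x) xiE tx mul1r.
split=> //.
- move=> b m a v v'; rewrite !xiE.
  have [Km|nKm] := pselect (K m); last by rewrite t0 // !mul0r mulr0 addr0.
  have [Um _] := KU _ Km; rewrite (triv_lin ht Um) !mxE; ring.
- by apply: filter_forall => i; apply: filter_forall => j; exact: Xu.
- apply: filterS nq => m h q /h[c'q wc] v v' h1 h2.
  apply: (tangent_ext_coord (triv_chart ht) c'q sw wc) => k.
  by case: (split_ordP k) => [i ->|a ->]; rewrite ?wl ?wr.
- apply: filterS nq => m h q /h[c'q wc] Z h1 h2.
  apply: (vfield_smooth_near (triv_chart ht) c'q sw wc) => k.
  by case: (split_ordP k) => [i ->|a ->]; rewrite ?wl ?wr.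
Unshelve. all: by end_near. Qed.

(** In an adapted chart the curve is a straight line. *)
Lemma derivable_fiber (F : P -> R) q (v : vfib E (bproj E q)) : smooth_fun F ->
  derivable (fun t : R => F (pt (vec q + t *: v)) : R^o) 0 1.
Proof.
move=> sF; have [U [tau [c [c' [ht Um cm]]]]] := exists_triv E (bproj E q).
have dE (t : R) : dom c' (pt (vec q + t *: v)).
  by apply/(triv_domP ht); rewrite proj_pt.
pose y : 'rV[R]_(n + r) := coord c' q.
pose w : 'rV[R]_(n + r) := row_mx 0 (tau _ v).
have c'q : dom c' q by apply/(triv_domP ht).
have E1 (t : R) : coord c' (pt (vec q + t *: v)) = y + t *: w.
  rewrite (triv_coord ht) // addrC (triv_lin ht Um) /y /w (triv_coordE ht c'q).
  by rewrite scale_row_mx scaler0 add_row_mx addr0 addrC.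
have -> : (fun t : R => F (pt (vec q + t *: v)) : R^o) =
          (fun t : R => (F \o param c' : _ -> R^o) (y + t *: w)).
  by apply/funext => t; rewrite /= -E1 coordK.
have d : differentiable (F \o param c' : _ -> R^o) (y + (0 : R) *: w).
  have [d _] := smooth_fun_chart (triv_chart ht) sF 1; apply: d.
  by exists q => //; rewrite scale0r addr0.
by have [] := is_derive_line d.
Qed.

Lemma vliftE (s : forall m, sections E m) q (F : P -> R) : smooth_fun F ->
  (vlift s q : tangent q) F = derive1 (fun t : R => F (pt (vec q + t *: s (bproj E q))) : R^o) 0.
Proof.
have dF (G : P -> R) : smooth_fun G ->
   derivable (fun t : R => G (pt (vec q + t *: s (bproj E q))) : R^o) 0 1.
  exact: derivable_fiber.
have q0 : pt (vec q + 0 *: s (bproj E q)) = q by rewrite scale0r addr0 vecK.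
apply: tangent_ofE => [a g h sg sh|g h sg sh]; rewrite !derive1E.
  rewrite -[a * _](deriveZ a (dF g sg)) -deriveD //; last exact: (dF h sh).
  by apply: derivableZ; exact: (dF g sg).
have := @deriveM R R (fun t => g (pt (vec q + t *: s (bproj E q))))
  (fun t => h (pt (vec q + t *: s (bproj E q)))) 0 1 (dF g sg) (dF h sh).
rewrite q0 => ->; rewrite /GRing.scale /=; ring.
Qed.

Lemma vlift_proj (s : forall m, sections E m) q (f : M -> R) : smooth_fun f ->
  (vlift s q : tangent q) (f \o bproj E) = 0.
Proof.
move=> sf; rewrite vliftE; last exact: bproj_smooth_fun.
rewrite (_ : (fun t : R => _) = cst (f (bproj E q) : R^o)) ?derive1_cst //.
by apply/funext => t; rewrite /= proj_pt.
Qed.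

Lemma vlift_fiber_linear (s : forall m, sections E m) q (f : P -> R) : smooth_fun f ->
  (forall m (a : R) (v w : vfib E m), f (pt (a *: v + w)) = a * f (pt v) + f (pt w)) ->
  (vlift s q : tangent q) f = f (pt (s (bproj E q))).
Proof.
move=> sf lf; rewrite vliftE // derive1E.
have -> : (fun t : R => f (pt (vec q + t *: s (bproj E q))) : R^o) =
   (fun t : R => t * f (pt (s (bproj E q))) + f q : R^o).
  by apply/funext => t; rewrite addrC lf vecK.
rewrite deriveD // deriveMr // derive_id.
by rewrite derive_cst addr0 /GRing.scale /= mulr1.
Qed.

(** A fibrewise linear function has the same derivative along s^v at all points of a
    fibre, and basic functions have derivative 0, so the two sides agree on coordinates. *)
Lemma vlift_lin (f : M -> R) (s t : forall m, sections E m) q :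
  vlift (fun m => f m *: s m + t m) q = f (bproj E q) *: vlift s q + vlift t q.
Proof.
have [u [X [xi [e he]]]] := exists_bundle_frame (bproj E q).
apply: (nbhs_singleton (frame_ext he) q erefl) => [i|b].
  have su := frame_u he i.
  by rewrite tangent_linE !vlift_proj // mulr0 addr0.
have sxi := frame_xi he b; have lxi := frame_xi_lin he b.
by rewrite tangent_linE !vlift_fiber_linear.
Qed.

Lemma vlift_smooth (s : forall m, sections E m) : smooth_sec s ->
  @smooth_sec _ _ (TM P) (vlift s).
Proof.
move=> /section_smoothP ss F sF; apply: smooth_nearP => q.
have [u [X [xi [e he]]]] := exists_bundle_frame (bproj E q).
apply: (nbhs_singleton (frame_smooth he) q erefl) => // [i|b].
  apply: (smooth_near_eq (g := fun=> 0)).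
    by near=> x; rewrite vlift_proj //; exact: frame_u he i.
  by apply: smooth_near_fun; exact: smooth_fun_cst.
apply: (smooth_near_eq (g := (fun m => xi b (pt (s m))) \o bproj E)).
  near=> x; rewrite vlift_fiber_linear //.
    exact: frame_xi he b.
  exact: frame_xi_lin he b.
apply: smooth_near_fun; apply: bproj_smooth_fun; apply: ss; exact: frame_xi he b.
Unshelve. all: by end_near. Qed.

End BundleFrame.

(** * Horizontal lifts *)

Section Lift.
Context {R : realType}.
Variables (n r : nat) (M : manifold (R := R) n) (E : vbundle M r) (N : connection E).
Local Notation P := (total_space E).
Implicit Types (X Y : forall m, TM M m) (s t : forall m, sections E m).

Let SL : lin_closed (sections E) := @section_lin_closed _ _ _ _ E.

Lemma smooth_fun_section s (F : P -> R) : smooth_sec s -> smooth_fun F ->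
  smooth_fun (fun m => F (pt (s m))).
Proof. by move=> /section_smoothP ss; exact: ss. Qed.

(** The difference d = s - s' equals (1 - theta) d for a bump function theta supported
    where s = s' and equal to 1 at m; by the Leibniz rule the covariant derivative of d
    vanishes at m. *)
Lemma nabla_near X s s' m : smooth_sec X -> smooth_sec s -> smooth_sec s' ->
  (\forall x \near m, s x = s' x) -> N X s m = N X s' m.
Proof.
move=> sX ss ss' e.
have sd := smooth_secB SL ss ss'.
have [theta [st t1 [K cK [KP t0]]]] := smooth_bump e.
have s1 := smooth_funB (smooth_fun_cst 1) st.
have d0 : N X (fun x => s x - s' x) m = 0.
  have := nabla_leibniz N s1 sX sd m.
  rewrite (nbhs_singleton t1) (nbhs_singleton e) !subrr scale0r scaler0 addr0 => <-.
  congr (nabla N X _ m); apply/functional_extensionality_dep => x.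
  have [Kx|nKx] := pselect (K x); first by rewrite KP // subrr scaler0.
  by rewrite t0 // subr0 scale1r.
have := nabla_addr N sX sd ss' m; rewrite d0 add0r => <-.
by congr (nabla N X _ m); apply/functional_extensionality_dep => x; rewrite subrK.
Qed.

Lemma nabla_sum X k (f : 'I_k -> M -> R) (t : 'I_k -> forall m, sections E m) m :
  smooth_sec X -> (forall i, smooth_fun (f i)) -> (forall i, smooth_sec (t i)) ->
  N X (fun x => \sum_i f i x *: t i x) m =
  \sum_i ((X m : tangent m) (f i) *: t i m + f i m *: N X (t i) m).
Proof.
move=> sX sf st; have sz : smooth_sec _ := zero_section_smooth E.
have sS (l : seq 'I_k) := smooth_sec_sum SL l sz sf st.
suff h (l : seq 'I_k) : N X (fun x => \sum_(i <- l) f i x *: t i x) m =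
  \sum_(i <- l) ((X m : tangent m) (f i) *: t i m + f i m *: N X (t i) m) by exact: h.
elim: l => [|i l IH].
  have h := nabla_addr N sX sz sz m.
  rewrite big_nil (_ : (fun x => _) = (fun x => 0 : sections E x)); last first.
    by apply/functional_extensionality_dep => x; rewrite big_nil.
  apply/eqP; rewrite -(subrr (N X (fun x => 0) m)) eq_sym subr_eq -{1}h.
  by apply/eqP; congr (nabla N X _ m); apply/functional_extensionality_dep => x; rewrite addr0.
rewrite big_cons -IH -nabla_leibniz // -nabla_addr //; last exact: smooth_secZ.
by congr (nabla N X _ m); apply/functional_extensionality_dep => x; rewrite big_cons.
Qed.

Section Frame.
Variables (m0 : M) (u : 'I_n -> M -> R) (X_ : 'I_n -> forall m, TM M m)
    (xi : 'I_r -> P -> R) (t_ : 'I_r -> forall m, sections E m).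
Hypothesis he : bundle_frame m0 u X_ xi t_.

Lemma frame_xi0 b m : xi b (pt (0 : vfib E m)) = 0.
Proof.
have := frame_xi_lin he b (-1) (0 : vfib E m) 0.
by rewrite scaleN1r addNr mulN1r addNr.
Qed.

Lemma frame_xi_sum b m k (c : 'I_k -> R) (v : 'I_k -> vfib E m) :
  xi b (pt (\sum_i c i *: v i)) = \sum_i c i * xi b (pt (v i)).
Proof.
have h (l : seq 'I_k) : xi b (pt (\sum_(i <- l) c i *: v i)) =
    \sum_(i <- l) c i * xi b (pt (v i)).
  elim: l => [|i l IH]; first by rewrite !big_nil frame_xi0.
  by rewrite !big_cons (frame_xi_lin he) IH.
exact: h.
Qed.

Lemma frame_xiD b m (v w : vfib E m) : xi b (pt (v + w)) = xi b (pt v) + xi b (pt w).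
Proof. by have := frame_xi_lin he b 1 v w; rewrite scale1r mul1r. Qed.

(** The Christoffel formula: expand s in the frame and apply the Leibniz rule. *)
Lemma nabla_coord : \forall m \near m0, forall X s, smooth_sec X -> smooth_sec s ->
  forall b, xi b (pt (N X s m)) = (X m : tangent m) (fun x => xi b (pt (s x))) +
     \sum_a xi a (pt (s m)) * xi b (pt (N X (t_ a) m)).
Proof.
apply: filterS2 (near_near (frame_tE he)) (frame_xit he) => m tE xit X s sX ss b.
have sf a : smooth_fun (fun x => xi a (pt (s x))).
  by apply: smooth_fun_section => //; exact: frame_xi he a.
have st a : smooth_sec (t_ a) by exact: frame_t he a.
have sE : \forall x \near m, s x = \sum_a xi a (pt (s x)) *: t_ a x.
  by apply: filterS tE => x; apply.
have sz : smooth_sec _ := zero_section_smooth E.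
have sS := smooth_sec_sum SL (index_enum 'I_r) sz sf st.
rewrite (nabla_near sX ss sS sE) nabla_sum // big_split frame_xiD !frame_xi_sum.
congr (_ + _); rewrite (bigD1 b) //= xit eqxx mulr1 big1 ?addr0 // => a /negbTE ab.
by rewrite xit ab mulr0.
Qed.

End Frame.

Lemma exists_section (q : P) : exists s, smooth_sec s /\ s (bproj E q) = vec q.
Proof.
have [u [X [xi [t he]]]] := exists_bundle_frame E (bproj E q).
exists (fun m => \sum_a xi a q *: t a m); split.
  apply: (smooth_sec_sum SL _ (zero_section_smooth E) (f := fun a _ => xi a q)).
    by move=> a; exact: smooth_fun_cst.
  by move=> a; exact: frame_t he a.
rewrite [RHS](nbhs_singleton (frame_tE he)).
by apply: eq_bigr => a _; rewrite vecK.
Qed.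

(** The vector (T s)(X) - (nabla_X s)^v does not depend on the section s through q:
    on u o pr it gives X u, and on xi_b the derivatives of the components of s cancel
    by [nabla_coord], leaving only the values xi_a(q).  Hence the vector chosen in the
    definition of [hlift] exists. *)
Lemma hliftP X (q : P) s (F : P -> R) : smooth_sec X -> smooth_sec s ->
  s (bproj E q) = vec q -> smooth_fun F ->
  (hlift N X q : tangent q) F =
    (X (bproj E q) : tangent (bproj E q)) (fun m => F (pt (s m)))
    - (vlift (N X s) q : tangent q) F.
Proof.
move=> sX ss sq sF.
pose D s F : R := (X (bproj E q) : tangent (bproj E q)) (fun m => F (pt (s m))).
have DE s' : smooth_sec s' -> s' (bproj E q) = vec q -> forall G, smooth_fun G ->
    tangent_of q (D s') G = D s' G.
  move=> ss' s'q; apply: tangent_ofE => [a g h sg sh|g h sg sh]; rewrite /D.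
    by rewrite -tangentL //; exact: smooth_fun_section.
  have s'qE : pt (s' (bproj E q)) = q by rewrite s'q vecK.
  by rewrite -[in g q]s'qE -[in h q]s'qE -tangentM //; exact: smooth_fun_section.
pose w s' : TM P q := (tangent_of q (D s') : TM P q) - vlift (N X s') q.
have [u [X_ [xi [t_ he]]]] := exists_bundle_frame E (bproj E q).
have wD s' G : smooth_sec s' -> s' (bproj E q) = vec q -> smooth_fun G ->
    (w s' : tangent q) G = D s' G - (vlift (N X s') q : tangent q) G.
  by move=> ss' s'q sG; rewrite -(DE s' ss' s'q G sG).
have wE s' : smooth_sec s' -> s' (bproj E q) = vec q -> w s' = w s.
  move=> ss' s'q; apply: (nbhs_singleton (frame_ext he) q erefl) => [i|b].
    have su := frame_u he i; have suE := bproj_smooth_fun (E:=E) su.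
    rewrite (wD s' _ ss' s'q suE) (wD s _ ss sq suE) !vlift_proj // /D.
    by congr (_ - _); apply: eq_tangent => m /=; rewrite !proj_pt.
  have sxi := frame_xi he b; have lxi := frame_xi_lin he b.
  rewrite (wD s' _ ss' s'q sxi) (wD s _ ss sq sxi) !vlift_fiber_linear // /D.
  rewrite !(nbhs_singleton (nabla_coord he)) // s'q sq.
  by rewrite opprD [in RHS]opprD !addrA !subrr.
have ws : [set w : tangent q | forall s : forall m, sections E m,
    smooth_sec s -> s (bproj E q) = vec q ->
    forall F : total_space E -> R, smooth_fun F ->
      w F = (X (bproj E q) : tangent (bproj E q)) (fun m => F (pt (s m)))
            - (vlift (N X s) q : tangent q) F] (w s).
  move=> s' ss' s'q G sG; rewrite -(wE s') //.
  exact: wD.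
rewrite /hlift; case: xgetP => [v _ /= hv|/(_ (w s))//].
exact: hv.
Qed.

Lemma hlift_proj X (q : P) (f : M -> R) : smooth_sec X -> smooth_fun f ->
  (hlift N X q : tangent q) (f \o bproj E) = (X (bproj E q) : tangent _) f.
Proof.
move=> sX sf; have [s [ss sq]] := exists_section q.
rewrite (hliftP sX ss sq (bproj_smooth_fun (E:=E) sf)) vlift_proj // subr0.
by apply: eq_tangent => m /=; rewrite proj_pt.
Qed.

Lemma hlift_xi m0 u (X_ : 'I_n -> forall m, TM M m) xi
    (t_ : 'I_r -> forall m, sections E m) : bundle_frame m0 u X_ xi t_ ->
  \forall m \near m0, forall q, bproj E q = m -> forall X, smooth_sec X -> forall b,
    (hlift N X q : tangent q) (xi b) =
    - \sum_a xi a q * xi b (pt (N X (t_ a) (bproj E q))).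
Proof.
move=> he; apply: filterS (nabla_coord he) => m hm q qm X sX b; subst m.
have [s [ss sq]] := exists_section q.
have sxi := frame_xi he b; have lxi := frame_xi_lin he b.
rewrite (hliftP sX ss sq sxi) vlift_fiber_linear // hm // sq vecK.
by rewrite opprD addrA subrr add0r.
Qed.

Lemma hlift_lin (f : M -> R) X Y (q : P) : smooth_fun f -> smooth_sec X -> smooth_sec Y ->
  hlift N (fun m => f m *: X m + Y m) q = f (bproj E q) *: hlift N X q + hlift N Y q.
Proof.
move=> sf sX sY; have [s [ss sq]] := exists_section q.
apply: tangent_ext => F sF.
have sXY := TM_lin_closed sf sX sY.
apply: etrans (hliftP sXY ss sq sF) (esym _).
apply: etrans (congr2 (fun x y => f (bproj E q) * x + y)
  (hliftP sX ss sq sF) (hliftP sY ss sq sF)) _.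
have -> : N (fun m => f m *: X m + Y m) s = (fun m => f m *: N X s m + N Y s m).
  by apply/functional_extensionality_dep => m; exact: nabla_linl.
have -> : (vlift (fun m => f m *: N X s m + N Y s m) q : tangent q) F =
    f (bproj E q) * (vlift (N X s) q : tangent q) F + (vlift (N Y s) q : tangent q) F.
  by rewrite vlift_lin.
rewrite tangent_linE; ring.
Qed.

(** By [hlift_xi] its coordinates are smooth. *)
Lemma hlift_smooth X : smooth_sec X -> @smooth_sec _ _ (TM P) (hlift N X).
Proof.
move=> sX F sF; apply: smooth_nearP => q.
have [u [X_ [xi [t_ he]]]] := exists_bundle_frame E (bproj E q).
apply: (nbhs_singleton (frame_smooth he) q erefl) => // [i|b].
  apply: smooth_near_fun.
  have su := frame_u he i.
  rewrite (_ : (fun x => _) = (fun m => (X m : tangent m) (u i)) \o bproj E).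
    by apply: bproj_smooth_fun; exact: sX.
  by apply/funext => x; rewrite hlift_proj.
apply: (smooth_near_eq (g := fun x => (-1) * \sum_a xi a x *
    ((fun m => xi b (pt (N X (t_ a) m))) \o bproj E) x)).
  apply: filterS (near_bproj (hlift_xi he)) => x hx.
  by rewrite mulN1r (hx _ erefl _ sX).
apply: smooth_near_fun; apply: smooth_funZ; apply: smooth_fun_sum => a _.
apply: smooth_funM; first exact: frame_xi he a.
apply: bproj_smooth_fun; apply: smooth_fun_section; last exact: frame_xi he b.
by apply: nabla_smooth => //; exact: frame_t he a.
Qed.

(** The lift is function-linear in X, hence pointwise: expand X in a frame of TM. *)
Lemma hlift_eq0 X (q : P) : smooth_sec X -> X (bproj E q) = 0 -> hlift N X q = 0.
Proof.
move=> sX X0; have [u [X_ [xi [t_ he]]]] := exists_bundle_frame E (bproj E q).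
have := @tensor_expand _ _ _ _ (@TM_lin_closed _ _ M) _ (bproj E q) (fun X => hlift N X q) _
  n (fun i m => (X m : tangent m) (u i)) X_ X sX.
rewrite X0 => ->.
- by rewrite big1 // => i _; rewrite tangent_0E scale0r.
- by move=> f Y Z sf sY sZ; exact: hlift_lin.
- by move=> i; apply: sX; exact: frame_u he i.
- by move=> i; exact: frame_X he i.
- by apply: filterS (frame_XE he) => m; apply.
Qed.

Lemma hlift0 q : hlift N (fun m => 0) q = 0.
Proof. by apply: hlift_eq0 => // f sf; exact: smooth_fun_cst. Qed.

Lemma vlift0 q : vlift (fun m => 0 : sections E m) q = 0.
Proof.
have := vlift_lin (fun=> -1) (fun m => 0 : sections E m) (fun m => 0) q.
rewrite scaleN1r addNr => <-; congr (vlift _ q).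
by apply/functional_extensionality_dep => m; rewrite scaler0 addr0.
Qed.

(** Both sides have the same values on u o pr and on xi.  Vertical lifts of the frame
    kill u o pr and are dual to xi, so their coefficients correct the values on xi produced by
    the horizontal part. *)
Lemma lift_frame q0 u (X_ : 'I_n -> forall m, TM M m) xi
    (t_ : 'I_r -> forall m, sections E m) : bundle_frame (bproj E q0) u X_ xi t_ ->
  \forall q \near q0, forall v : TM P q,
   v = \sum_i (v : tangent q) (u i \o bproj E) *: hlift N (X_ i) q
     + \sum_a ((v : tangent q) (xi a) - \sum_i (v : tangent q) (u i \o bproj E) *
                 (hlift N (X_ i) q : tangent q) (xi a)) *: vlift (t_ a) q.
Proof.
move=> he; have h := near_bproj (frame_ext he).
apply: filterS3 h (near_bproj (frame_Xu he)) (near_bproj (frame_xit he)) => q ext Xu xit v.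
apply: (ext q erefl) => [j|b]; rewrite tangent_addE !tangent_sumE.
  have su := frame_u he j.
  rewrite [X in _ = _ + X]big1 => [|a _]; last by rewrite tangent_scaleE vlift_proj // mulr0.
  have E1 i : ((v : tangent q) (u i \o bproj E) *: hlift N (X_ i) q : tangent q) (u j \o bproj E)
     = (v : tangent q) (u i \o bproj E) * (i == j)%:R.
    by rewrite tangent_scaleE hlift_proj ?Xu //; exact: frame_X he i.
  rewrite (eq_bigr _ (fun i _ => E1 i)) addr0 (bigD1 j) //= eqxx mulr1.
  by rewrite big1 ?addr0 // => i /negbTE ->; rewrite mulr0.
have sxi := frame_xi he b; have lxi := frame_xi_lin he b.
have E2 a c : (c *: vlift (t_ a) q : tangent q) (xi b) = c * (a == b)%:R.
  by rewrite tangent_scaleE vlift_fiber_linear // xit.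
rewrite [X in _ = _ + X](eq_bigr _ (fun a _ => E2 a _)) (bigD1 b) //= eqxx mulr1.
rewrite [X in _ = _ + (_ + X)]big1 => [|a /negbTE ->]; last by rewrite mulr0.
by rewrite addr0 addrC subrK.
Qed.

Lemma dsumTE_lin_closed : lin_closed (dsum (TM M) (sections E)).
Proof. exact: dsum_lin_closed (@TM_lin_closed _ _ M) SL. Qed.

Lemma lift_sec_lin (f : M -> R) (a b : forall m, dsum (TM M) (sections E) m) q :
  smooth_fun f -> smooth_sec a -> smooth_sec b ->
  lift_sec N (fun m => f m *: a m + b m) q =
  f (bproj E q) *: lift_sec N a q + lift_sec N b q.
Proof.
move=> sf [a1 a2] [b1 b2]; rewrite /lift_sec scalerDr addrACA.
by rewrite -hlift_lin // -vlift_lin.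
Qed.

Lemma lift_sec_smooth (a : forall m, dsum (TM M) (sections E) m) :
  smooth_sec a -> @smooth_sec _ _ (TM P) (lift_sec N a).
Proof.
move=> [a1 a2]; apply: (smooth_secD (@TM_lin_closed _ _ P)).
  exact: hlift_smooth.
exact: vlift_smooth.
Qed.

(** The sections are the (X_i, 0) and (0, t_a) of a frame, and the coefficients those of
    [lift_frame]. *)
Lemma lift_sec_generate q0 :
  exists c : 'I_(n + r) -> forall m, dsum (TM M) (sections E) m,
  [/\ forall k, smooth_sec (c k),
      forall Z : forall q, TM P q, smooth_sec Z ->
        exists f : 'I_(n + r) -> P -> R, (forall k, smooth_fun (f k)) /\
        \forall q \near q0, Z q = \sum_k f k q *: lift_sec N (c k) q
    & forall v : TM P q0, exists f : 'I_(n + r) -> R,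
        v = \sum_k f k *: lift_sec N (c k) q0].
Proof.
have [u [X [xi [t he]]]] := exists_bundle_frame E (bproj E q0).
pose c (k : 'I_(n + r)) : forall m, dsum (TM M) (sections E) m :=
  match fintype.split k with inl i => fun m => (X i m, 0) | inr a => fun m => (0, t a m) end.
have cl i : c (lshift r i) = fun m => (X i m, 0) by rewrite /c (unsplitK (inl i)).
have cr a : c (rshift n a) = fun m => (0, t a m) by rewrite /c (unsplitK (inr a)).
have lcl i q : lift_sec N (c (lshift r i)) q = hlift N (X i) q.
  by rewrite cl /lift_sec /= vlift0 addr0.
have lcr a q : lift_sec N (c (rshift n a)) q = vlift (t a) q.
  by rewrite cr /lift_sec /= hlift0 add0r.
pose w (k : 'I_(n + r)) q (v : TM P q) : R := match fintype.split k with
  | inl i => (v : tangent q) (u i \o bproj E)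
  | inr a => (v : tangent q) (xi a) - \sum_i (v : tangent q) (u i \o bproj E) *
                 (hlift N (X i) q : tangent q) (xi a) end.
have wE : \forall q \near q0, forall v : TM P q, v = \sum_k w k q v *: lift_sec N (c k) q.
  apply: filterS (lift_frame he) => q hq v; rewrite big_split_ord {1}[v]hq.
  congr (_ + _); apply: eq_bigr => i _.
    by rewrite lcl /w (unsplitK (inl i)).
  by rewrite lcr /w (unsplitK (inr i)).
exists c; split.
- move=> k; case: (split_ordP k) => [i ->|a ->]; rewrite ?cl ?cr; split.
  + exact: frame_X he i.
  + exact: zero_section_smooth.
  + by move=> f sf; exact: smooth_fun_cst.
  + exact: frame_t he a.
- move=> Z sZ; exists (fun k q => w k q (Z q)); split; last first.
    by apply: filterS wE => q; apply.
  have su i : smooth_fun (u i \o bproj E) by apply: bproj_smooth_fun; exact: frame_u he i.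
  move=> k; rewrite /w; case: fintype.split => [i|a]; first exact: sZ.
  apply: smooth_funB; first by apply: sZ; exact: frame_xi he a.
  apply: smooth_fun_sum => i _; apply: smooth_funM; first exact: sZ.
  by apply: hlift_smooth; [exact: frame_X he i|exact: frame_xi he a].
- by move=> v; exists (fun k => w k q0 v); exact: nbhs_singleton wE v.
Qed.

Lemma dsumTE_generate m :
  exists c : 'I_(n + r) -> forall m, dsum (TM M) (sections E) m,
  (forall k, smooth_sec (c k)) /\ forall v : dsum (TM M) (sections E) m,
    exists f : 'I_(n + r) -> R, v = \sum_k f k *: c k m.
Proof.
have [u [X [xi [t he]]]] := exists_bundle_frame E m.
pose c (k : 'I_(n + r)) : forall m, dsum (TM M) (sections E) m :=
  match fintype.split k with inl i => fun m => (X i m, 0) | inr a => fun m => (0, t a m) end.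
have cl i : c (lshift r i) = fun m => (X i m, 0) by rewrite /c (unsplitK (inl i)).
have cr a : c (rshift n a) = fun m => (0, t a m) by rewrite /c (unsplitK (inr a)).
exists c; split.
  move=> k; case: (split_ordP k) => [i ->|a ->]; rewrite ?cl ?cr; split.
  + exact: frame_X he i.
  + exact: zero_section_smooth.
  + by move=> f sf; exact: smooth_fun_cst.
  + exact: frame_t he a.
move=> [v1 v2].
exists (fun k => match fintype.split k with
  inl i => (v1 : tangent m) (u i) | inr a => xi a (pt v2) end).
rewrite big_split_ord.
have hX := nbhs_singleton (frame_XE he) v1; have ht := nbhs_singleton (frame_tE he) v2.
have -> : (v1, v2) = (v1, 0) + (0, v2) :> (TM M m * sections E m)%type.
  by congr pair; rewrite ?addr0 ?add0r.
congr (_ + _).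
  rewrite (eq_bigr (fun i => ((v1 : tangent m) (u i) *: X i m, 0) : dsum (TM M) (sections E) m)).
    rewrite {1}hX; elim/big_rec2 : _ => // i y z _ <-.
    by congr pair; rewrite addr0.
  by move=> i _; rewrite cl (unsplitK (inl i)); congr pair; rewrite scaler0.
rewrite (eq_bigr (fun a => (0, xi a (pt v2) *: t a m) : dsum (TM M) (sections E) m)).
  rewrite {1}ht; elim/big_rec2 : _ => // i y z _ <-.
  by congr pair; rewrite addr0.
by move=> i _; rewrite cr (unsplitK (inr i)); congr pair; rewrite scaler0.
Qed.

End Lift.

(** * The calculus of Courant tuples *)

(** The Gram matrix A of the spanning family need not be invertible, but a row vector lies
    in its row space as soon as it kills the kernel of A; a kernel vector of A gives a
    combination of the e_i orthogonal to everything, hence 0. *)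
Lemma nondeg_represent (R : realType) (V : lmodType R) (B : V -> V -> R) k (e : 'I_k -> V)
    (alpha : V -> R) :
  (forall u v, B u v = B v u) ->
  (forall (a : R) u v w, B (a *: u + v) w = a * B u w + B v w) ->
  (forall u, (forall v, B u v = 0) -> u = 0) ->
  (forall v, exists f : 'I_k -> R, v = \sum_i f i *: e i) ->
  (forall (a : R) u v, alpha (a *: u + v) = a * alpha u + alpha v) ->
  exists x, forall v, B x v = alpha v.
Proof.
move=> Bsym Blin Bnd span al.
have al0 : alpha 0 = 0 by have := al (-1) 0 0; rewrite scaler0 addr0 mulN1r addNr.
have B0 w : B 0 w = 0 by have := Blin (-1) 0 0 w; rewrite scaler0 addr0 mulN1r addNr.
have alS (f : 'I_k -> R) : alpha (\sum_i f i *: e i) = \sum_i f i * alpha (e i).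
  elim: (index_enum _) => [|i l IH]; first by rewrite !big_nil.
  by rewrite !big_cons al IH.
have BS (f : 'I_k -> R) w : B (\sum_i f i *: e i) w = \sum_i f i * B (e i) w.
  elim: (index_enum _) => [|i l IH]; first by rewrite !big_nil.
  by rewrite !big_cons Blin IH.
pose A : 'M[R]_k := \matrix_(i, j) B (e i) (e j).
pose a : 'rV[R]_k := \row_j alpha (e j).
have : (a <= A)%MS.
  rewrite submxE; apply/eqP/rowP => j.
  pose y := col j (cokermx A).
  have Ay : A *m y = 0 by rewrite /y colE mulmxA mulmx_coker mul0mx.
  have ey : \sum_i y i 0 *: e i = 0.
    apply: Bnd => v; have [f ->] := span v.
    rewrite Bsym BS big1 // => i _; rewrite Bsym BS.
    have := congr1 (fun m : 'cV[R]_k => m i 0) Ay; rewrite !mxE => h.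
    rewrite (_ : \sum_j _ = 0) ?mulr0 // -[RHS]h; apply: eq_bigr => l _.
    by rewrite [A i l]mxE Bsym mulrC.
  have := alS (fun i => y i 0); rewrite ey al0 => h.
  rewrite [RHS]mxE [RHS]h mxE; apply: eq_bigr => i _.
  by rewrite /a /y !mxE mulrC.
move=> /submxP[x xA]; exists (\sum_i x 0 i *: e i) => v.
have [f ->] := span v; rewrite Bsym BS alS; apply: eq_bigr => j _; congr (_ * _).
rewrite Bsym BS.
have := congr1 (fun m : 'rV[R]_k => m 0 j) xA; rewrite !mxE => ->.
by apply: eq_bigr => i _; rewrite mxE.
Qed.

Section LieTensor.
Context {R : realType}.
Variables (n : nat) (M : manifold (R := R) n).
Implicit Types (X Y Z : forall m, TM M m).

Lemma lie_linr (f : M -> R) X Y Z p : smooth_fun f -> smooth_sec X ->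
  smooth_sec Y -> smooth_sec Z ->
  lie X (fun m => f m *: Y m + Z m) p =
  (X p : tangent p) f *: Y p + f p *: (lie X Y p : TM M p) + (lie X Z p : TM M p).
Proof.
move=> sf sX sY sZ; apply: tangent_ext => g sg.
have sYZ := TM_lin_closed sf sY sZ.
rewrite lieE // !tangent_addE !tangent_scaleE !lieE //.
have sYg := sY g sg; have sZg := sZ g sg; have sXg := sX g sg.
have -> : (fun x => ((f x *: Y x + Z x : TM M x) : tangent x) g) =
   (fun x => f x * (Y x : tangent x) g + (Z x : tangent x) g) by [].
rewrite tangentD //; last exact: smooth_funM.
rewrite tangentM //; ring.
Qed.

Lemma lie_skew X Y p : smooth_sec X -> smooth_sec Y ->
  (lie X Y p : TM M p) + lie Y X p = 0.
Proof.
move=> sX sY; apply: tangent_ext => g sg.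
by rewrite tangent_addE !lieE // tangent_0E; ring.
Qed.

Lemma lie_linl (f : M -> R) X Y Z p : smooth_fun f -> smooth_sec X ->
  smooth_sec Y -> smooth_sec Z ->
  lie (fun m => f m *: Y m + Z m) X p =
  - ((X p : tangent p) f *: Y p) + f p *: (lie Y X p : TM M p) + (lie Z X p : TM M p).
Proof.
move=> sf sX sY sZ; have sYZ := TM_lin_closed sf sY sZ.
have sk (U W : forall m, TM M m) : smooth_sec U -> smooth_sec W ->
    lie U W p = - (lie W U p : TM M p).
  by move=> sU sW; apply/eqP; rewrite -addr_eq0 lie_skew.
rewrite sk // lie_linr // (sk Y X) // (sk Z X) // !opprD scalerN //.
Qed.

End LieTensor.

(** The features of a vector bundle on which the calculus of brackets rests. *)
Record spanned_sections (R : realType) (n : nat) (M : manifold (R := R) n)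
    (V : vfamily (R := R) M) : Prop := SpannedSections {
  spanned_lin : lin_closed V;
  spanned0 : smooth_sec (fun m => 0 : V m);
  spanned_fiber : forall m, exists k (c : 'I_k -> forall m, V m),
    (forall i, smooth_sec (c i)) /\
    forall v : V m, exists f : 'I_k -> R, v = \sum_i f i *: c i m }.

Section CourantTheory.
Context {R : realType}.
Variables (n : nat) (M : manifold (R := R) n) (V : vfamily (R := R) M).
Variable C : courant_tuple V.
Hypothesis HV : spanned_sections V.

Let VL := spanned_lin HV.
Let V0 := spanned0 HV.
Let Vspan := spanned_fiber HV.

Implicit Types (a b c d : forall m, V m) (f g h : M -> R).
Local Notation br := (bracket C).
Local Notation rho := (anchor C).
Local Notation dot := (pairing C).

Lemma section_ext m (v : V m) : exists a, smooth_sec a /\ a m = v.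
Proof.
have [k [c [sc cE]]] := Vspan m; have [f ->] := cE v.
exists (fun m => \sum_i f i *: c i m); split=> //.
apply: (smooth_sec_sum VL _ V0 (f := fun i _ => f i)) => // i.
exact: smooth_fun_cst.
Qed.

Lemma dotDl m (u v w : V m) : dot (u + v) w = dot u w + dot v w.
Proof. by have := pairing_lin C 1 u v w; rewrite scale1r mul1r. Qed.

Lemma dot0l m (w : V m) : dot 0 w = 0.
Proof. by have := pairing_lin C (-1) 0 0 w; rewrite scaler0 addr0 mulN1r addNr. Qed.

Lemma dotZl m (k : R) (v w : V m) : dot (k *: v) w = k * dot v w.
Proof. by have := pairing_lin C k v 0 w; rewrite addr0 dot0l addr0. Qed.

Lemma dot_suml m k (f : 'I_k -> R) (v : 'I_k -> V m) (w : V m) :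
  dot (\sum_i f i *: v i) w = \sum_i f i * dot (v i) w.
Proof.
elim: (index_enum _) => [|i l IH]; first by rewrite !big_nil dot0l.
by rewrite !big_cons dotDl dotZl IH.
Qed.

Lemma dotNl m (v w : V m) : dot (- v) w = - dot v w.
Proof. by rewrite -scaleN1r dotZl mulN1r. Qed.

Lemma dot_ext m (u v : V m) :
  (forall a, smooth_sec a -> dot u (a m) = dot v (a m)) -> u = v.
Proof.
move=> uv; apply/eqP; rewrite -subr_eq0; apply/eqP; apply: (@pairing_nondeg _ _ _ _ C) => w.
have [a [sa <-]] := section_ext w.
by rewrite dotDl dotNl uv // subrr.
Qed.

Lemma anchor0 m : rho (0 : V m) = 0.
Proof. by have := anchor_lin C (-1) (0 : V m) 0; rewrite scaler0 addr0 scaleN1r addNr. Qed.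

Lemma anchorD m (u v : V m) : rho (u + v) = rho u + rho v.
Proof. by have := anchor_lin C 1 u v; rewrite !scale1r. Qed.

Lemma anchorZ m (k : R) (u : V m) : rho (k *: u) = k *: rho u.
Proof. by have := anchor_lin C k u 0; rewrite !addr0 anchor0 addr0. Qed.

Lemma anchor_sum m k (f : 'I_k -> R) (v : 'I_k -> V m) :
  rho (\sum_i f i *: v i) = \sum_i f i *: rho (v i).
Proof.
elim: (index_enum _) => [|i l IH]; first by rewrite !big_nil anchor0.
by rewrite !big_cons anchorD anchorZ IH.
Qed.

Lemma anchorN m (u : V m) : rho (- u) = - rho u.
Proof. by rewrite -scaleN1r anchorZ scaleN1r. Qed.

Lemma anchor_fun_smooth a f : smooth_sec a -> smooth_fun f ->
  smooth_fun (fun m => (rho (a m) : tangent m) f).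
Proof. by move=> sa sf; exact: (@anchor_smooth _ _ _ _ C _ sa). Qed.

(** The fibres are finitely spanned, so the functional v |-> rho(v) f is represented: the
    value [dual_d] is never the default of its definition. *)
Lemma dual_dP f m (v : V m) : dot (dual_d C f m) v = (rho v : tangent m) f.
Proof.
have [k [c [sc cE]]] := Vspan m.
have [x hx] := @nondeg_represent R (V m) (@pairing _ _ _ _ C m) k (fun i => c i m)
  (fun v => (rho v : tangent m) f) (@pairing_sym _ _ _ _ C m) (@pairing_lin _ _ _ _ C m)
  (@pairing_nondeg _ _ _ _ C m) cE
  (fun (z : R) u v => congr1 (fun w : TM M m => (w : tangent m) f) (anchor_lin C z u v)).
rewrite /dual_d /anchor_adj; case: xgetP => [y _ /= hy|/(_ x)//]; exact: hy.
Qed.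

Lemma dual_d_uniq f m (x : V m) :
  (forall a, smooth_sec a -> dot x (a m) = (rho (a m) : tangent m) f) -> x = dual_d C f m.
Proof. by move=> hx; apply: dot_ext => a sa; rewrite dual_dP hx. Qed.

Lemma dual_dL f g h m : smooth_fun f -> smooth_fun g -> smooth_fun h ->
  dual_d C (fun x => f x * g x + h x) m =
  f m *: dual_d C g m + g m *: dual_d C f m + dual_d C h m.
Proof.
move=> sf sg sh; apply/esym/dual_d_uniq => a sa.
rewrite !dotDl !dotZl !dual_dP tangentD //; last exact: smooth_funM.
rewrite tangentM //; ring.
Qed.

Lemma dual_dD f g m : smooth_fun f -> smooth_fun g ->
  dual_d C (fun x => f x + g x) m = dual_d C f m + dual_d C g m.
Proof.
by move=> sf sg; apply/esym/dual_d_uniq => a sa; rewrite !dotDl !dual_dP tangentD.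
Qed.

Lemma brDl a b c m : smooth_sec a -> smooth_sec b -> smooth_sec c ->
  br (fun x => a x + b x) c m = br a c m + br b c m.
Proof.
move=> sa sb sc; have := @bracket_linl _ _ _ _ C 1 _ _ _ sa sb sc m; rewrite scale1r => <-.
by congr (br _ c m); apply/functional_extensionality_dep => x; rewrite scale1r.
Qed.

Lemma brDr a b c m : smooth_sec a -> smooth_sec b -> smooth_sec c ->
  br c (fun x => a x + b x) m = br c a m + br c b m.
Proof.
move=> sa sb sc; have := @bracket_linr _ _ _ _ C 1 _ _ _ sa sb sc m; rewrite scale1r => <-.
by congr (br c _ m); apply/functional_extensionality_dep => x; rewrite scale1r.
Qed.

Lemma brLr a b c f m : Ca4 C -> smooth_sec a -> smooth_sec b -> smooth_sec c ->
  smooth_fun f -> br a (fun x => f x *: b x + c x) m =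
    (rho (a m) : tangent m) f *: b m + f m *: br a b m + br a c m.
Proof. by move=> h4 sa sb sc sf; rewrite brDr ?h4 //; exact: smooth_secZ. Qed.

Lemma brLl a b c f m : Ca5 C -> smooth_sec a -> smooth_sec b -> smooth_sec c ->
  smooth_fun f -> br (fun x => f x *: b x + c x) a m =
    - ((rho (a m) : tangent m) f *: b m) + f m *: br b a m
    + pair_sec C b a m *: dual_d C f m + br c a m.
Proof. by move=> h5 sa sb sc sf; rewrite brDl ?h5 //; exact: smooth_secZ. Qed.

(** Pair [a, f b] with an arbitrary section and use the Leibniz rule for rho(a). *)
Lemma Ca2_Ca4 : Ca2 C -> Ca4 C.
Proof.
move=> h2 a b f sa sb sf m; apply: dot_ext => c sc.
have sfb := smooth_secZ VL sf sb.
have h := h2 a _ c sa sfb sc m; have h' := h2 a b c sa sb sc m.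
have sbc : smooth_fun (pair_sec C b c) := pairing_smooth C sb sc.
have e : pair_sec C (fun x => f x *: b x) c = (fun x => f x * pair_sec C b c x).
  by apply/funext => x; rewrite /pair_sec dotZl.
rewrite e tangentM // h' /pair_sec dotZl in h.
rewrite dotDl !dotZl; move/eqP: h; rewrite -subr_eq => /eqP <-; ring.
Qed.

(** For a lift, this condition on lifted sections is the bracket condition of an action. *)
Definition anchor_bracket : Prop := forall a b, smooth_sec a -> smooth_sec b ->
  forall m, rho (br a b m) = lie (fun x => rho (a x)) (fun x => rho (b x)) m.

Definition jacobiator a b c m : V m :=
  br a (br b c) m - (br (br a b) c m + br b (br a c) m).

(** The failure of function-linearity in the last slot is exactly the failure of the
    anchor to preserve brackets. *)
Lemma jacobiator_linr a b c d f m : Ca4 C -> smooth_sec a -> smooth_sec b ->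
  smooth_sec c -> smooth_sec d -> smooth_fun f ->
  jacobiator a b (fun x => f x *: c x + d x) m =
  f m *: jacobiator a b c m + jacobiator a b d m +
  ((lie (fun x => rho (a x)) (fun x => rho (b x)) m : tangent m) f
    - (rho (br a b m) : tangent m) f) *: c m.
Proof.
move=> h4 sa sb sc sd sf; rewrite /jacobiator.
have sbr x y : smooth_sec x -> smooth_sec y -> smooth_sec (br x y).
  by move=> sx sy; exact: bracket_smooth.
have E x : smooth_sec x -> br x (fun y => f y *: c y + d y) =
   (fun m => (rho (x m) : tangent m) f *: c m + (f m *: br x c m + br x d m)).
  by move=> sx; apply/functional_extensionality_dep => y; rewrite brLr // addrA.
have E2 x y : smooth_sec x -> smooth_sec y ->
    br x (br y (fun y => f y *: c y + d y)) m =
    (rho (x m) : tangent m) (fun z => (rho (y z) : tangent z) f) *: c m +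
      (rho (y m) : tangent m) f *: br x c m +
    ((rho (x m) : tangent m) f *: br y c m + f m *: br x (br y c) m + br x (br y d) m).
  move=> sx sy; rewrite (E y sy).
  have syc := sbr _ _ sy sc; have syd := sbr _ _ sy sd.
  have syf := anchor_fun_smooth sy sf.
  have sfy := VL sf syc syd.
  by rewrite (brLr _ h4 sx sc sfy syf) (brLr _ h4 sx syc syd sf).
have sra : smooth_sec (fun x => rho (a x) : TM M x) := @anchor_smooth _ _ _ _ C _ sa.
have srb : smooth_sec (fun x => rho (b x) : TM M x) := @anchor_smooth _ _ _ _ C _ sb.
rewrite (lieE m sra srb sf) (E2 a b sa sb) (E2 b a sb sa) (brLr _ h4 (sbr _ _ sa sb) sc sd sf).
by apply: dot_ext => w sw; rewrite !(dotDl, dotNl, dotZl); ring.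
Qed.

(** When the jacobiator vanishes, the error term of [jacobiator_linr] does: the
    number (lie(rho a, rho b) - rho [a, b])(f) annihilates the fibre.  So it is 0, or the
    fibre is 0 and then the tangent space is 0 as well. *)
Lemma Ca3_anchor_bracket :
  (forall m, (forall v : V m, v = 0) -> forall w : TM M m, w = 0) ->
  Ca3 C -> Ca4 C -> anchor_bracket.
Proof.
move=> rich h3 h4 a b sa sb m; apply: tangent_ext => f sf.
have J0 c : smooth_sec c -> jacobiator a b c m = 0.
  by move=> sc; rewrite /jacobiator h3 // subrr.
apply: contrapT => ne; apply: (ne).
suff v0 (v : V m) : v = 0.
  by rewrite (rich m v0 (rho (br a b m))) (rich m v0 (lie _ _ m)).
have [c [sc <-]] := section_ext v.
have := jacobiator_linr m h4 sa sb sc V0 sf.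
rewrite !J0 //; last exact: VL.
rewrite scaler0 !add0r => /esym/eqP.
by rewrite scaler_eq0 subr_eq0 => /orP[/eqP/esym/ne|/eqP].
Qed.

(** By Ca1 the elements dual_d <a, b> are symmetrized brackets, whose anchors are
    symmetrized Lie brackets, hence 0.  Replacing a by f a gives <a, b> rho(dual_d f) = 0, and
    either some <a, b> is nonzero at m or dual_d f itself vanishes there. *)
Lemma anchor_dual_d f m : Ca1 C -> anchor_bracket -> smooth_fun f ->
  rho (dual_d C f m) = 0.
Proof.
move=> h1 hab sf.
have dab a b x : smooth_sec a -> smooth_sec b -> rho (dual_d C (pair_sec C a b) x) = 0.
  move=> sa sb; rewrite -h1 // anchorD !hab // lie_skew //.
    exact: (@anchor_smooth _ _ _ _ C _ sa).
  exact: (@anchor_smooth _ _ _ _ C _ sb).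
apply: contrapT => ne; apply: (ne); rewrite (_ : dual_d C f m = 0) ?anchor0 //.
apply: dot_ext => b sb; rewrite dot0l.
have [a [sa <-]] := section_ext (dual_d C f m).
have sfa := smooth_secZ VL sf sa.
have := dab _ _ m sfa sb.
have -> : pair_sec C (fun x => f x *: a x) b = (fun x => f x * pair_sec C a b x + 0).
  by apply/funext => x; rewrite /pair_sec dotZl addr0.
have sab : smooth_fun (pair_sec C a b) := pairing_smooth C sa sb.
rewrite dual_dL //; last exact: smooth_fun_cst.
have -> : dual_d C (fun=> 0) m = 0.
  by apply/esym/dual_d_uniq => c sc; rewrite dot0l tangent_cst.
rewrite addr0 anchorD !anchorZ dab // scaler0 add0r => /eqP.
by rewrite scaler_eq0 => /orP[/eqP//|/eqP/ne].
Qed.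

Section DualBracket.
Hypotheses (h1 : Ca1 C) (h2 : Ca2 C) (hab : anchor_bracket).
Variables (e : forall m, V m) (G : M -> R).
Hypotheses (se : smooth_sec e) (sG : smooth_fun G).
Hypothesis eG : forall m, e m = dual_d C G m.

(** Pairing with b and Ca2 turn the claim into
    rho(a) rho(b) G - rho([a, b]) G = rho(b) rho(a) G, an instance of [anchor_bracket]. *)
Lemma bracket_dual_r a m : smooth_sec a ->
  br a e m = dual_d C (fun x => (rho (a x) : tangent x) G) m.
Proof.
move=> sa; apply: dual_d_uniq => b sb.
have := h2 sa se sb m; rewrite /pair_sec eG dual_dP.
have -> : (fun m => dot (e m) (b m)) = (fun x => (rho (b x) : tangent x) G).
  by apply/funext => x; rewrite eG dual_dP.
rewrite hab // lieE //; try exact: (@anchor_smooth _ _ _ _ C).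
by move=> /eqP; rewrite -subr_eq => /eqP <-; ring.
Qed.

Lemma bracket_dual_l a m : smooth_sec a -> br e a m = 0.
Proof.
move=> sa; have := h1 se sa m; rewrite bracket_dual_r //.
have -> : pair_sec C e a = (fun x => (rho (a x) : tangent x) G).
  by apply/funext => x; rewrite /pair_sec eG dual_dP.
by rewrite -[RHS]add0r => /addIr.
Qed.

End DualBracket.

(** The symmetric part is - [[a, b] + [b, a], c] = - [dual_d <a, b>, c] = 0. *)
Lemma jacobiator_skew12 a b c m : Ca1 C -> Ca2 C -> anchor_bracket ->
  smooth_sec a -> smooth_sec b -> smooth_sec c ->
  jacobiator a b c m = - jacobiator b a c m.
Proof.
move=> h1 h2 hab sa sb sc.
have sab := bracket_smooth C sa sb; have sba := bracket_smooth C sb sa.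
have sG : smooth_fun (pair_sec C a b) := pairing_smooth C sa sb.
have se := smooth_secD VL sab sba.
have := bracket_dual_l h1 h2 hab se sG (h1 _ _ sa sb) m sc.
rewrite brDl // => /eqP; rewrite addr_eq0 => /eqP h.
rewrite /jacobiator h.
by apply: dot_ext => w sw; rewrite !(dotDl, dotNl, dotZl); ring.
Qed.

(** The symmetric part is [a, dual_d <b, c>] - dual_d (<[a, b], c> + <b, [a, c]>), which
    vanishes by [bracket_dual_r] and Ca2. *)
Lemma jacobiator_skew23 a b c m : Ca1 C -> Ca2 C -> anchor_bracket ->
  smooth_sec a -> smooth_sec b -> smooth_sec c ->
  jacobiator a b c m = - jacobiator a c b m.
Proof.
move=> h1 h2 hab sa sb sc.
have sbr x y : smooth_sec x -> smooth_sec y -> smooth_sec (br x y).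
  by move=> sx sy; exact: bracket_smooth.
have sbc := sbr _ _ sb sc; have scb := sbr _ _ sc sb.
have sab := sbr _ _ sa sb; have sac := sbr _ _ sa sc.
have sG : smooth_fun (pair_sec C b c) := pairing_smooth C sb sc.
have se := smooth_secD VL sbc scb.
have := bracket_dual_r h2 hab se sG (h1 _ _ sb sc) m sa.
rewrite brDr // (_ : (fun x => (rho (a x) : tangent x) (pair_sec C b c)) =
  (fun x => pair_sec C (br a b) c x + pair_sec C b (br a c) x)); last first.
  by apply/funext => x; rewrite h2.
have s1 : smooth_fun (pair_sec C (br a b) c) := pairing_smooth C sab sc.
have s2 : smooth_fun (pair_sec C b (br a c)) := pairing_smooth C sb sac.
rewrite dual_dD // -!h1 // => h.
apply/eqP; rewrite -subr_eq0 opprK; apply/eqP.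
rewrite /jacobiator; move/eqP: h; rewrite -subr_eq0 => /eqP h; rewrite -[RHS]h.
by apply: dot_ext => w sw; rewrite !(dotDl, dotNl, dotZl); ring.
Qed.

End CourantTheory.

(** * The Courant algebroid lift *)

Section CourantLift.
Context {R : realType}.
Variables (n r : nat) (M : manifold (R := R) n) (E : vbundle M r) (N : connection E).
Variable C : courant_tuple (dsum (TM M) (sections E)).
Hypothesis hC : courant_algebroid C.
Variable L : courant_tuple (TM (total_space E)).
Hypothesis hL : is_courant_lift N C L.
Local Notation P := (total_space E).
Local Notation V := (dsum (TM M) (sections E)).
Local Notation phi := (lift_sec N).
Implicit Types (a b c : forall m, V m) (u v w : forall q, TM P q) (q : P).

Lemma spanned_dsum : spanned_sections V.
Proof.
split; first exact: dsumTE_lin_closed.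
  by split; [move=> f sf; exact: smooth_fun_cst|exact: zero_section_smooth].
by move=> m; have [c hc] := dsumTE_generate E m; exists (n + r)%N, c.
Qed.

Lemma spanned_TP : spanned_sections (TM P).
Proof.
split; first exact: TM_lin_closed.
  by move=> f sf; exact: smooth_fun_cst.
move=> q; have [c [sc _ hc]] := lift_sec_generate N q.
exists (n + r)%N, (fun k => phi (c k)); split=> // k; exact: lift_sec_smooth.
Qed.

Let HV := spanned_dsum.
Let HP := spanned_TP.

Lemma lift_sec_surj q (x : TM P q) : exists a, smooth_sec a /\ phi a q = x.
Proof.
have [c [sc _ hc]] := lift_sec_generate N q; have [f ->] := hc x.
pose s (l : seq 'I_(n + r)) m : V m := \sum_(k <- l) f k *: c k m.
have ss l : smooth_sec (s l).
  apply: (smooth_sec_sum (spanned_lin HV) l (spanned0 HV) (f := fun k _ => f k)) => // k.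
  exact: smooth_fun_cst.
have phi0 : phi (fun m => 0) q = 0 by rewrite /lift_sec hlift0 vlift0 addr0.
have sE l : phi (s l) q = \sum_(k <- l) f k *: phi (c k) q.
  elim: l => [|k l IH].
    rewrite big_nil -[RHS]phi0; congr (lift_sec N _ q).
    by apply/functional_extensionality_dep => m; rewrite /s big_nil.
  rewrite big_cons -IH -(lift_sec_lin N q (smooth_fun_cst (f k)) (sc k) (ss l)).
  congr (lift_sec N _ q).
  by apply/functional_extensionality_dep => m; rewrite /s big_cons.
by exists (s (index_enum _)); split; [exact: ss|exact: sE].
Qed.

(** Lifts generate the vector fields locally, so [tensor_expand] applies. *)
Lemma lift_tensor_eq0 (W : lmodType R) q (T : (forall q, TM P q) -> W) :
  (forall (f : P -> R) u v, smooth_fun f -> smooth_sec u -> smooth_sec v ->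
    T (fun x => f x *: u x + v x) = f q *: T u + T v) ->
  (forall a, smooth_sec a -> T (phi a) = 0) ->
  forall u, smooth_sec u -> T u = 0.
Proof.
move=> TL T0 u su; have [c [sc hc _]] := lift_sec_generate N q.
have [f [sf uE]] := hc u su.
rewrite (tensor_expand (spanned_lin HP) TL su sf _ uE).
  by rewrite big1 // => k _; rewrite T0 // scaler0.
by move=> k; exact: lift_sec_smooth.
Qed.

Let C1 : Ca1 C. Proof. by case: hC. Qed.
Let C2 : Ca2 C. Proof. by case: hC. Qed.
Let C3 : Ca3 C. Proof. by case: hC. Qed.
Let C4 : Ca4 C. Proof. exact: (Ca2_Ca4 HV C2). Qed.

Lemma anchor_bracketC : anchor_bracket C.
Proof.
apply: (Ca3_anchor_bracket HV _ C3 C4) => m v0 w.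
by have := v0 (w, 0); case.
Qed.

Lemma lift_repE a q : smooth_sec a -> lift_rep N L a q = hlift N (fun m => anchor C (a m)) q.
Proof. by move=> sa; exact: (lift_anchor hL sa q). Qed.

Lemma anchorC_smooth a : smooth_sec a -> smooth_sec (fun m => anchor C (a m) : TM M m).
Proof. exact: (@anchor_smooth _ _ _ _ C). Qed.

Lemma lift_rep_proj a q (f : M -> R) : smooth_sec a -> smooth_fun f ->
  (lift_rep N L a q : tangent q) (f \o bproj E) = (anchor C (a (bproj E q)) : tangent _) f.
Proof.
by move=> sa sf; rewrite lift_repE // hlift_proj //; exact: anchorC_smooth.
Qed.

Lemma lift_rep_lin (f : M -> R) a b q : smooth_fun f -> smooth_sec a -> smooth_sec b ->
  lift_rep N L (fun m => f m *: a m + b m) q =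
  f (bproj E q) *: lift_rep N L a q + lift_rep N L b q.
Proof. by move=> sf sa sb; rewrite /lift_rep lift_sec_lin // anchor_lin. Qed.

(** The lifted anchor of phi a is the horizontal lift of rho(a), so it projects to rho(a)
    and is linear over functions of the base; brackets are the only issue. *)
Lemma courant_action_lift : courant_action C (bproj E) (lift_rep N L) <->
  forall a b, smooth_sec a -> smooth_sec b -> forall q,
    lie (lift_rep N L a) (lift_rep N L b) q = lift_rep N L (bracket C a b) q.
Proof.
split=> [[] //|h]; split=> //.
- exact: bproj_smooth.
- move=> a sa; apply: (@anchor_smooth _ _ _ _ L); exact: lift_sec_smooth.
- move=> k a b sa sb q; exact: (lift_rep_lin q (smooth_fun_cst k)).
- move=> a sa q; apply: tangent_ext => f sf.
  by rewrite pushforwardE ?lift_rep_proj //; exact: bproj_smooth.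
- move=> f a sf sa q.
  have z : lift_rep N L (fun m => 0) q = 0.
    by rewrite /lift_rep /lift_sec hlift0 vlift0 addr0 anchor0.
  have := lift_rep_lin q sf sa (spanned0 HV); rewrite z addr0 => <-.
  congr (lift_rep N L _ q).
  by apply/functional_extensionality_dep => m; rewrite addr0.
Qed.

Lemma bracket_lift a b : smooth_sec a -> smooth_sec b ->
  bracket L (phi a) (phi b) = phi (bracket C a b).
Proof. by move=> sa sb; apply/functional_extensionality_dep => q; exact: (lift_bracket hL). Qed.

Lemma pair_lift a b : smooth_sec a -> smooth_sec b ->
  pair_sec L (phi a) (phi b) = pair_sec C a b \o bproj E.
Proof. by move=> sa sb; apply/funext => q; exact: (lift_pairing hL). Qed.

Let L4 : Ca4 L := lift_Ca4 hL.
Let L5 : Ca5 L := lift_Ca5 hL.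

(** Both sides pair with phi b to rho(b) f, because phi b is mapped to rho(b)^h. *)
Lemma dual_d_lift (f : M -> R) a q : smooth_fun f -> smooth_sec a ->
  a (bproj E q) = dual_d C f (bproj E q) ->
  phi a q = dual_d L (f \o bproj E) q.
Proof.
move=> sf sa aE; apply: (dual_d_uniq HP) => v sv.
have [b [sb <-]] := lift_sec_surj (v q).
rewrite (lift_pairing hL) // /pair_sec aE (dual_dP _ HV).
by rewrite -lift_rep_proj.
Qed.

Lemma anchor_dual_d_basic (f : M -> R) q : smooth_fun f ->
  anchor L (dual_d L (f \o bproj E) q) = 0.
Proof.
move=> sf; have [a [sa aE]] := section_ext HV (dual_d C f (bproj E q)).
rewrite -(dual_d_lift sf sa aE); have := lift_repE q sa; rewrite /lift_rep => ->.
apply: hlift_eq0; first exact: anchorC_smooth.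
by rewrite aE (anchor_dual_d HV _ C1 anchor_bracketC).
Qed.

(** The image of the lifted anchor consists of horizontal vectors, so dual_d F only
    depends on the horizontal derivatives of F and is a combination of the dual_d (y_i o pr),
    for y_i coordinates of the base.  The anchor kills these since rho o rho^* = 0
    on the base. *)
Lemma anchor_dual_d_lift (F : P -> R) q : smooth_fun F -> anchor L (dual_d L F q) = 0.
Proof.
move=> sF; have [c hc cq] := chart_near (bproj E q).
have [y [X [sy sX _ _ XE]]] := tangent_frame hc cq.
have -> : dual_d L F q =
    \sum_i (hlift N (X i) q : tangent q) F *: dual_d L (y i \o bproj E) q.
  apply/esym/(dual_d_uniq HP) => v sv.
  have [b [sb <-]] := lift_sec_surj (v q).
  have sXb := anchorC_smooth sb.
  have := lift_repE q sb; rewrite /lift_rep => bE; rewrite bE.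
  have TL (f : M -> R) (Y Z : forall m, TM M m) : smooth_fun f -> smooth_sec Y -> smooth_sec Z ->
    hlift N (fun m => f m *: Y m + Z m) q = f (bproj E q) *: hlift N Y q + hlift N Z q.
    exact: hlift_lin.
  have sf i : smooth_fun (fun m => (anchor C (b m) : tangent m) (y i)) by exact: sXb.
  rewrite (tensor_expand (@TM_lin_closed _ _ M) TL sXb sf sX); last first.
    by apply: filterS XE => m; apply.
  rewrite tangent_sumE (dot_suml L); apply: eq_bigr => i _.
  rewrite tangent_scaleE mulrC; congr (_ * _).
  exact: (etrans (dual_dP L HP _ _) (lift_rep_proj q sb (sy i))).
rewrite (anchor_sum L) big1 // => i _.
by rewrite (anchor_dual_d_basic q (sy i)) scaler0.
Qed.

(** The defect of Ca1 is function-linear in both arguments by Ca4 and Ca5, and vanishes on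
    lifts since the lift maps dual_d f to dual_d (f o pr). *)
Lemma Ca1_lift : Ca1 L.
Proof.
pose T u v q : TM P q := bracket L u v q + bracket L v u q - dual_d L (pair_sec L u v) q.
have pairC u v : pair_sec L u v = pair_sec L v u.
  by apply/funext => q; rewrite /pair_sec pairing_sym.
have Tsym u v q : T u v q = T v u q.
  by rewrite /T pairC; congr (_ - _); rewrite addrC.
have TL v q : smooth_sec v -> forall (f : P -> R) u w,
    smooth_fun f -> smooth_sec u -> smooth_sec w ->
    T (fun x => f x *: u x + w x) v q = f q *: T u v q + T w v q.
  move=> sv f u w sf su sw; rewrite /T (brLl HP _ L5) // (brLr HP _ L4) //.
  have -> : pair_sec L (fun x => f x *: u x + w x) v =
      (fun x => f x * pair_sec L u v x + pair_sec L w v x).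
    by apply/funext => x; rewrite /pair_sec pairing_lin.
  have suv : smooth_fun (pair_sec L u v) := pairing_smooth L su sv.
  have swv : smooth_fun (pair_sec L w v) := pairing_smooth L sw sv.
  rewrite (dual_dL _ HP) //.
  by apply: (dot_ext (C := L) HP) => z sz; rewrite !(dotDl, dotNl, dotZl); ring.
have Tphi a b q : smooth_sec a -> smooth_sec b -> T (phi a) (phi b) q = 0.
  move=> sa sb; rewrite /T (bracket_lift sa sb) (bracket_lift sb sa) (pair_lift sa sb).
  have sab := bracket_smooth C sa sb; have sba := bracket_smooth C sb sa.
  rewrite -(@dual_d_lift _ (fun m => 1 *: bracket C a b m + bracket C b a m)).
  - by rewrite (lift_sec_lin N q (smooth_fun_cst 1)) // scale1r subrr.
  - exact: pairing_smooth.
  - exact: (spanned_lin HV (smooth_fun_cst 1)).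
  - by rewrite scale1r C1.
move=> u v su sv q; apply/eqP; rewrite -subr_eq0; apply/eqP.
apply: (lift_tensor_eq0 (T := fun u => T u v q) (TL v q sv)) => // a sa.
have sphi := lift_sec_smooth N sa.
rewrite Tsym; apply: (lift_tensor_eq0 (T := fun v => T v (phi a) q) (TL _ q sphi)) => // b sb.
exact: Tphi.
Qed.

(** The defect of Ca2 is function-linear in its three arguments by Ca4 and Ca5. *)
Lemma Ca2_lift : Ca2 L.
Proof.
pose T u v w q : R^o := (anchor L (u q) : tangent q) (pair_sec L v w) -
  (pair_sec L (bracket L u v) w q + pair_sec L v (bracket L u w) q).
have pairC u v : pair_sec L u v = pair_sec L v u.
  by apply/funext => q; rewrite /pair_sec pairing_sym.
have Tsym u v w q : T u v w q = T u w v q.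
  by rewrite /T pairC [pair_sec L (bracket L u v) w]pairC (pairC v) [X in _ - X]addrC.
have TL u w q : smooth_sec u -> smooth_sec w -> forall (f : P -> R) v z, smooth_fun f ->
    smooth_sec v -> smooth_sec z ->
    T u (fun x => f x *: v x + z x) w q = f q *: T u v w q + T u z w q.
  move=> su sw f v z sf sv sz; rewrite /T.
  have -> : pair_sec L (fun x => f x *: v x + z x) w =
      (fun x => f x * pair_sec L v w x + pair_sec L z w x).
    by apply/funext => x; rewrite /pair_sec pairing_lin.
  have svw : smooth_fun (pair_sec L v w) := pairing_smooth L sv sw.
  have szw : smooth_fun (pair_sec L z w) := pairing_smooth L sz sw.
  rewrite tangentD //; last exact: smooth_funM.
  rewrite tangentM // /pair_sec (brLr HP _ L4) // !(dotDl, dotZl) /GRing.scale /=; ring.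
have TL1 v w q : smooth_sec v -> smooth_sec w -> forall (f : P -> R) u z, smooth_fun f ->
    smooth_sec u -> smooth_sec z ->
    T (fun x => f x *: u x + z x) v w q = f q *: T u v w q + T z v w q.
  move=> sv sw f u z sf su sz; rewrite /T /pair_sec.
  rewrite (brLl HP _ L5) // (brLl HP _ L5) //.
  rewrite (pairing_sym L (v q)) !(dotDl, dotZl, dotNl) !(dual_dP _ HP) anchor_lin tangent_linE.
  rewrite /pair_sec !(pairing_sym L (v q)) /GRing.scale /=; ring.
have Tphi a b c q : smooth_sec a -> smooth_sec b -> smooth_sec c ->
    T (phi a) (phi b) (phi c) q = 0.
  move=> sa sb sc; have sab := bracket_smooth C sa sb; have sac := bracket_smooth C sa sc.
  rewrite /T (pair_lift sb sc).
  have E1 : pair_sec L (bracket L (phi a) (phi b)) (phi c) q =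
      pair_sec C (bracket C a b) c (bproj E q).
    by rewrite (bracket_lift sa sb) (pair_lift sab sc).
  have E2 : pair_sec L (phi b) (bracket L (phi a) (phi c)) q =
      pair_sec C b (bracket C a c) (bproj E q).
    by rewrite (bracket_lift sa sc) (pair_lift sb sac).
  rewrite E1 E2.
  have := lift_rep_proj q sa (pairing_smooth C sb sc); rewrite /lift_rep => ->.
  by rewrite /= C2 // subrr.
move=> u v w su sv sw q; apply/eqP; rewrite -subr_eq0; apply/eqP.
apply: (lift_tensor_eq0 (T := fun u => T u v w q) (TL1 v w q sv sw)) => // a sa.
have sphia := lift_sec_smooth N sa.
apply: (lift_tensor_eq0 (T := fun v => T (phi a) v w q) (TL _ w q sphia sw)) => // b sb.
have sphib := lift_sec_smooth N sb.
rewrite Tsym.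
apply: (lift_tensor_eq0 (T := fun w => T (phi a) w (phi b) q) (TL _ _ q sphia sphib)) => // c sc.
exact: Tphi.
Qed.

Section Action.
Hypothesis hact : forall a b, smooth_sec a -> smooth_sec b -> forall q,
    lie (lift_rep N L a) (lift_rep N L b) q = lift_rep N L (bracket C a b) q.

(** On lifts this is the bracket condition of the action.  The difference of the two sides
    is function-linear: the extra term of Ca5, a multiple of the anchor of dual_d f, is
    killed by [anchor_dual_d_lift]. *)
Lemma anchor_bracket_lift : anchor_bracket L.
Proof.
have srho u : smooth_sec u -> smooth_sec (fun x => anchor L (u x) : TM P x).
  exact: (@anchor_smooth _ _ _ _ L).
pose T u v q : TM P q := anchor L (bracket L u v q) -
  (lie (fun x => anchor L (u x)) (fun x => anchor L (v x)) q : TM P q).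
have rhoL (f : P -> R) u v : (fun x => anchor L (f x *: u x + v x)) =
    (fun x => f x *: anchor L (u x) + anchor L (v x)).
  by apply/functional_extensionality_dep => x; rewrite anchor_lin.
have TLr u q : smooth_sec u -> forall (f : P -> R) v z, smooth_fun f ->
    smooth_sec v -> smooth_sec z ->
    T u (fun x => f x *: v x + z x) q = f q *: T u v q + T u z q.
  move=> su f v z sf sv sz; rewrite /T (brLr HP _ L4) // rhoL lie_linr //; try exact: srho.
  rewrite !anchorD !anchorZ.
  by apply: tangent_ext => g sg; rewrite !(tangent_addE, tangent_oppE, tangent_scaleE); ring.
have TLl v q : smooth_sec v -> forall (f : P -> R) u z, smooth_fun f ->
    smooth_sec u -> smooth_sec z ->
    T (fun x => f x *: u x + z x) v q = f q *: T u v q + T z v q.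
  move=> sv f u z sf su sz; rewrite /T (brLl HP _ L5) // rhoL lie_linl //; try exact: srho.
  rewrite !anchorD !anchorZ anchorN anchorZ anchor_dual_d_lift //.
  apply: tangent_ext => g sg.
  rewrite scaler0 addr0 !(tangent_addE, tangent_oppE, tangent_scaleE); ring.
move=> u v su sv q; apply/eqP; rewrite -subr_eq0; apply/eqP.
apply: (lift_tensor_eq0 (T := fun u => T u v q) (TLl v q sv)) => // a sa.
have sphia := lift_sec_smooth N sa.
apply: (lift_tensor_eq0 (T := fun v => T (phi a) v q) (TLr _ q sphia)) => // b sb.
rewrite /T bracket_lift //; apply/eqP; rewrite subr_eq0; apply/eqP/esym.
exact: hact.
Qed.

(** The jacobiator is function-linear in its last slot because the anchor preserves
    brackets, and skew-symmetric by Ca1 and Ca2.  It vanishes on lifts, and each slot can be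
    moved to the end to replace a lift by an arbitrary field. *)
Lemma Ca3_lift : Ca3 L.
Proof.
have AB := anchor_bracket_lift.
(* the last slot may be tested on lifts *)
have JL q u v : smooth_sec u -> smooth_sec v ->
    (forall c, smooth_sec c -> jacobiator L u v (phi c) q = 0) ->
    forall w, smooth_sec w -> jacobiator L u v w q = 0.
  move=> su sv; apply: lift_tensor_eq0 => f w z sf sw sz.
  by rewrite (jacobiator_linr HP q L4 su sv sw sz sf) (AB u v su sv q) subrr scale0r addr0.
have s12 q u v w := @jacobiator_skew12 _ _ _ _ L HP u v w q Ca1_lift Ca2_lift AB.
have s23 q u v w := @jacobiator_skew23 _ _ _ _ L HP u v w q Ca1_lift Ca2_lift AB.
have sphi a : smooth_sec a -> smooth_sec (phi a) by exact: lift_sec_smooth.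
have J0 a b c q : smooth_sec a -> smooth_sec b -> smooth_sec c ->
    jacobiator L (phi a) (phi b) (phi c) q = 0.
  move=> sa sb sc; have sab := bracket_smooth C sa sb; have sbc := bracket_smooth C sb sc.
  have sac := bracket_smooth C sa sc.
  have s1 := bracket_smooth C sab sc; have s2 := bracket_smooth C sb sac.
  have E1 := etrans (congr1 (bracket L (phi a)) (bracket_lift sb sc)) (bracket_lift sa sbc).
  have E2 := etrans (congr1 (bracket L ^~ (phi c)) (bracket_lift sa sb)) (bracket_lift sab sc).
  have E3 := etrans (congr1 (bracket L (phi b)) (bracket_lift sa sc)) (bracket_lift sb sac).
  apply/eqP; rewrite /jacobiator subr_eq0; apply/eqP.
  apply: etrans (congr1 (fun s : forall q, TM P q => s q) E1) _; apply/esym.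
  apply: etrans (congr2 (fun s t : forall q, TM P q => s q + t q) E2 E3) _.
  have -> : bracket C a (bracket C b c) =
     (fun m => 1 *: bracket C (bracket C a b) c m + bracket C b (bracket C a c) m).
    by apply/functional_extensionality_dep => m; rewrite scale1r C3.
  by rewrite (lift_sec_lin N q (smooth_fun_cst 1) s1 s2) scale1r.
have J1 a b q w : smooth_sec a -> smooth_sec b -> smooth_sec w ->
    jacobiator L (phi a) (phi b) w q = 0.
  by move=> sa sb sw; apply: JL => // *; [exact: sphi|exact: sphi|exact: J0].
have J2 a q v w : smooth_sec a -> smooth_sec v -> smooth_sec w ->
    jacobiator L (phi a) v w q = 0.
  move=> sa sv sw; apply: JL => //; first exact: sphi.
  move=> b sb; rewrite s23 //; try exact: sphi.
  by rewrite J1 // oppr0.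
have J3 q u v w : smooth_sec u -> smooth_sec v -> smooth_sec w ->
    jacobiator L u v w q = 0.
  move=> su sv sw; apply: JL => // c sc; rewrite s23 //; try exact: sphi.
  by rewrite s12 ?J2 ?opprK //; exact: sphi.
move=> u v w su sv sw q; apply/eqP; rewrite -subr_eq0; apply/eqP.
exact: J3.
Qed.

End Action.
End CourantLift.

Theorem theorem4p21 (R : realType) (n r : nat) (M : @manifold R n)
    (E : vbundle M r) (N : connection E)
    (C : courant_tuple (dsum (TM M) (sections E)))
    (hC : courant_algebroid C)
    (L : courant_tuple (TM (total_space E)))
    (hL : is_courant_lift N C L) :
  (courant_action C (bproj E) (lift_rep N L) <-> courant_algebroid L) /\
  (courant_algebroid L ->
   forall q : total_space E,
     coisotropic C (stabilizer (bproj E) (lift_rep N L) q)).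
Proof.
have HV := spanned_dsum E; have HP := spanned_TP N.
have [C1 C2 C3] := hC.
split; last first.
  move=> _ q.
  (* The stabilizer at q is the kernel of rho at pr q: horizontal lifting is
     injective and only depends on the value of the field. *)
  have stE (e : dsum (TM M) (sections E) (bproj E q)) :
      stabilizer (bproj E) (lift_rep N L) q e <-> anchor C e = 0.
    rewrite /stabilizer /act_at /=.
    case: xgetP => [w _ /= [a [sa aE] <-]|h]; last first.
      have [a [sa aE]] := section_ext HV e.
      by exfalso; apply: (h (lift_rep N L a q)); exists a.
    split=> [h|ae0].
      apply: tangent_ext => f sf; rewrite -aE.
      by rewrite -(lift_rep_proj hL q sa sf) h !tangent_0E.
    rewrite (lift_repE hL) //; apply: hlift_eq0; first exact: anchorC_smooth.
    by rewrite aE.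
  split.
  - by apply/stE; rewrite anchor0.
  - move=> k u v /stE u0 /stE v0; apply/stE.
    by rewrite anchor_lin u0 v0 scaler0 addr0.
  - move=> u uW.
    (* dual_d f lies in ker rho, so u in its orthogonal has rho(u) f = <dual_d f, u> = 0 *)
    apply/stE; apply: tangent_ext => f sf; rewrite tangent_0E.
    rewrite -(dual_dP C HV) pairing_sym; apply: uW; apply/stE.
    by apply: (anchor_dual_d HV _ C1 (anchor_bracketC hC)).
rewrite courant_action_lift //; split=> [hact|[L1 L2 L3] a b sa sb q].
  split; [exact: (Ca1_lift hC hL)|exact: (Ca2_lift hC hL)|].
  exact: (Ca3_lift hC hL hact).
have AB : anchor_bracket L.
  by apply: (Ca3_anchor_bracket HP _ L3 (lift_Ca4 hL)) => m v0 w; exact: v0.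
rewrite -AB; [|exact: lift_sec_smooth|exact: lift_sec_smooth].
by rewrite (lift_bracket hL).
Qed.
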